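(* Let $G$ be a non-null triangle-free planar graph drawn in the plane. Then $G$ has a secure multigram.
   Context: All graphs are finite and simple. A cycle of a plane graph is facial if it bounds a face of some connected component of the graph. A vertex is big if it has degree at least $60$, and small otherwise. Multigrams: a monogram is $(v_1)$ with $\deg(v_1)\le 2$. A tetragram (resp. hexagram) is a sequence $(v_1,\dots,v_4)$ (resp. $(v_1,\dots,v_6)$) of vertices forming a facial cycle in that order. A pentagram is $(v_1,\dots,v_5)$ forming a facial cycle in that order with $v_1,\dots,v_4$ of degree exactly $3$. A decagram is a pentagram with $\deg(v_5)=3$; an octagram is a tetragram all of whose vertices have degree $3$. For pentagrams/decagrams, $x_i$ ($i\le 4$) is the neighbor of $v_i$ other than $v_{i-1},v_{i+1}$ ($v_0=v_5$). Secure multigrams: a monogram is always secure. A tetragram is secure if every path of length at most $3$ with ends $v_1,v_3$ lies in the cycle $v_1v_2v_3v_4$, $v_1$ is small of degree exactly $3$, the neighbor $x$ of $v_1$ other than $v_2,v_4$ is small, and either $v_3$ is small or every neighbor $w$ of $x$ is small or lies on a $4$-face $v_1v_2wx$ or $v_1v_4wx$. An octagram is secure if $v_1,\dots,v_4$ are small. A decagram is secure if $x_1,x_3$ are distinct, non-adjacent, have no common neighbor, and $v_1,\dots,v_5,x_1,x_3$ are small. A pentagram is secure if $x_1,\dots,x_4$ are pairwise distinct and non-adjacent, there is no path in $G\setminus\{v_1,\dots,v_4\}$ of length at most $3$ from $x_2$ to $v_5$, every path in $G\setminus\{v_1,\dots,v_4\}$ of length at most $3$ from $x_3$ to $x_4$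 has length exactly $2$ and with $x_3v_3v_4x_4$ forms a facial $5$-cycle, $v_1,\dots,v_5,x_1,\dots,x_4$ are small, at least one of $v_5,x_2$ has no big neighbor, and at least one of $x_3,x_4$ has no big neighbor. A hexagram is secure if every path of length at most $3$ between $v_1$ and $v_3$ is $v_1v_2v_3$, $v_1,v_3,v_6$ are small, $v_1$ has degree exactly $3$, and the neighbor of $v_1$ other than $v_2,v_6$ is small. *)

(* Defs.v *)
(* Plane graphs are represented combinatorially by rotation
   systems (combinatorial maps) of genus 0 on every connected component. *)
From mathcomp Require Import all_boot.
Set Implicit Arguments.
Unset Strict Implicit.
Unset Printing Implicit Defensive.

Section Defs.
Variable V : finType.
Variable adj : rel V.          (* simple graph: symmetric, irreflexive *)
Variable rot : V -> V -> V.    (* rot u v = successor of neighbour v in the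
                                  cyclic (clockwise) order around u *)

Definition triangle_free : Prop :=
  forall a b c : V, ~ [/\ adj a b, adj b c & adj c a].

Definition deg (v : V) : nat := #|[set w | adj v w]|.
Definition big (v : V) : bool := 60 <= deg v.
Definition small (v : V) : bool := deg v < 60.
Definition no_big_nbr (v : V) : Prop := forall w, adj v w -> small w.

Definition dart (p : V * V) : bool := adj p.1 p.2.

Definition rotation_system : Prop :=
  forall u v w, adj u v ->
    [/\ adj u (rot u v),
        (adj u w -> rot u v = rot u w -> v = w) &
        (adj u w -> fconnect (rot u) v w)].

(* face-tracing permutation on darts; its orbits on darts are the faces *)
Definition face_step (p : V * V) : V * V := (p.2, rot p.2 p.1).

Definition comp (x : V) : {set V} := [set y | connect adj x y].

Definition n_darts_in (C : {set V}) : nat := #|[set p | dart p & p.1 \in C]|.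
Definition n_faces_in (C : {set V}) : nat :=
  #|[set p | dart p & (p.1 \in C) && (froot face_step p == p)]|.

(* rotation system whose every component with an edge satisfies Euler's
   formula V - E + F = 2 (i.e. genus 0), written 2V + 2F = #darts + 4 *)
Definition plane_embedding : Prop :=
  rotation_system /\
  forall x, (exists y, adj x y) ->
    2 * #|comp x| + 2 * n_faces_in (comp x) = n_darts_in (comp x) + 4.

Definition facial_walk (s : seq V) : Prop :=
  3 <= size s /\ uniq s /\
  forall a, a \in s ->
    adj a (next s a) /\ face_step (a, next s a) = (next s a, next s (next s a)).

Definition facial (s : seq V) : Prop := facial_walk s \/ facial_walk (rev s).

Definition spath (S : seq V) (x y : V) (p : seq V) : bool :=
  [&& path adj x p, uniq (x :: p), last x p == y & all (fun z => z \notin S) (x :: p)].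

Definition in_cycle (c : seq V) (x : V) (p : seq V) : bool :=
  all (mem c) (x :: p) &&
  path (fun a b => (next c a == b) || (next c b == a)) x p.

Definition is_x (vp v vn x : V) : bool := [&& adj v x, x != vp & x != vn].

Definition monogram (v1 : V) : Prop := deg v1 <= 2.

Definition tetragram v1 v2 v3 v4 : Prop := facial [:: v1; v2; v3; v4].
Definition octagram v1 v2 v3 v4 : Prop :=
  tetragram v1 v2 v3 v4 /\ all (fun v => deg v == 3) [:: v1; v2; v3; v4].
Definition pentagram v1 v2 v3 v4 v5 : Prop :=
  facial [:: v1; v2; v3; v4; v5] /\ all (fun v => deg v == 3) [:: v1; v2; v3; v4].
Definition decagram v1 v2 v3 v4 v5 : Prop :=
  pentagram v1 v2 v3 v4 v5 /\ deg v5 = 3.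
Definition hexagram v1 v2 v3 v4 v5 v6 : Prop :=
  facial [:: v1; v2; v3; v4; v5; v6].

Definition secure_tetragram v1 v2 v3 v4 : Prop :=
  [/\ forall p, spath [::] v1 v3 p -> size p <= 3 -> in_cycle [:: v1; v2; v3; v4] v1 p,
      small v1, deg v1 = 3 &
      forall x, adj v1 x -> x != v2 -> x != v4 ->
        small x /\
        (small v3 \/
         forall w, adj x w ->
           [\/ small w, facial [:: v1; v2; w; x] | facial [:: v1; v4; w; x]])].

Definition secure_octagram v1 v2 v3 v4 : Prop :=
  all small [:: v1; v2; v3; v4].

Definition secure_decagram v1 v2 v3 v4 v5 : Prop :=
  exists x1 x3,
    [/\ is_x v5 v1 v2 x1 /\ is_x v2 v3 v4 x3,
        x1 != x3, ~~ adj x1 x3,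
        (forall w, ~ (adj x1 w /\ adj x3 w)) &
        all small [:: v1; v2; v3; v4; v5; x1; x3]].

Definition secure_pentagram v1 v2 v3 v4 v5 : Prop :=
  exists x1 x2 x3 x4,
    [/\ is_x v5 v1 v2 x1, is_x v1 v2 v3 x2, is_x v2 v3 v4 x3 & is_x v3 v4 v5 x4] /\
    [/\ uniq [:: x1; x2; x3; x4],
        (forall a b, a \in [:: x1; x2; x3; x4] -> b \in [:: x1; x2; x3; x4] -> ~~ adj a b),
        (forall p, spath [:: v1; v2; v3; v4] x2 v5 p -> 3 < size p) &
        (forall p, spath [:: v1; v2; v3; v4] x3 x4 p -> size p <= 3 ->
           exists m, p = [:: m; x4] /\ facial [:: x3; v3; v4; x4; m])] /\
    [/\ all small [:: v1; v2; v3; v4; v5; x1; x2; x3; x4],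
        no_big_nbr v5 \/ no_big_nbr x2 &
        no_big_nbr x3 \/ no_big_nbr x4].

Definition secure_hexagram v1 v2 v3 (v4 v5 : V) v6 : Prop :=
  [/\ forall p, spath [::] v1 v3 p -> size p <= 3 -> p = [:: v2; v3],
      all small [:: v1; v3; v6], deg v1 = 3 &
      forall x, adj v1 x -> x != v2 -> x != v6 -> small x].

Definition has_secure_multigram : Prop :=
  [\/ exists v1, monogram v1,
      exists v1 v2 v3 v4, tetragram v1 v2 v3 v4 /\ secure_tetragram v1 v2 v3 v4,
      exists v1 v2 v3 v4, octagram v1 v2 v3 v4 /\ secure_octagram v1 v2 v3 v4 |
   [\/ exists v1 v2 v3 v4 v5, pentagram v1 v2 v3 v4 v5 /\ secure_pentagram v1 v2 v3 v4 v5,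
      exists v1 v2 v3 v4 v5, decagram v1 v2 v3 v4 v5 /\ secure_decagram v1 v2 v3 v4 v5 |
      exists v1 v2 v3 v4 v5 v6,
        hexagram v1 v2 v3 v4 v5 v6 /\ secure_hexagram v1 v2 v3 v4 v5 v6]].

End Defs.

(* Main.v *)
(* Suppose that no multigram is secure; in particular all degrees are at least 3.
   By Euler's formula some face has length 4 or 5, and what lies on the other side
   of it is a disc bounded by a cycle of length at most 6, the rim, with vertices
   in its interior. In a minimal disc of this kind every cycle of length 4 or 5
   through an interior vertex is facial, and every such 6-cycle encloses at most
   one vertex. Hence none of the paths forbidden in a secure multigram exists
   there, and an insecure candidate must have big vertices, or vertices of the rim,
   close to it. Discharging from these vertices contradicts Euler's formula for the
   disc.

   The sides of a cycle, which in the plane come from the Jordan curve theorem, are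
   obtained from Euler's formula by linear algebra over F_2: the rank of the
   boundary map of the faces and that of the coboundary map of all vertices but
   one add up to the number of edges, so every cycle is the boundary of a set of
   faces. *)

Require Import Defs.
From mathcomp Require Import all_boot all_algebra zify.
From Stdlib Require Import Classical.

Set Implicit Arguments.
Unset Strict Implicit.
Unset Printing Implicit Defensive.

(** * Sides of cycles in plane maps *)

Section ChainRank.
Import GRing.Theory.
Local Open Scope ring_scope.

(** The conditions in a secure multigram are of two kinds. Those on short paths and common
    neighbours are settled by minimality, because a forbidden path closes up to a short cycle in the
    disc. Those on degrees fail only near vertices with charge to spare, so every insecure candidate
    points to a donor. The edges that a rim vertex has outside the disc are unknown, so such a
    vertex counts as big; the price is paid at 4-faces with two consecutive rim edges.

    The charges leave no slack. An interior vertex or a face needs 240 = 4 * 60, and a big vertex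
    keeps 4 of the 60 units of each of its edges, which is where degree 60 comes from. A rim of
    length s contributes 40 * s net against the 240 that stem from the constant in Euler's formula.
    So 6 is the largest length that works, and it gives a tie: the strict inequality comes from the
    4 units kept at one edge from the rim into the disc. *)

Lemma mxrank_const_ker (K : fieldType) m n (A : 'M[K]_(m, n)) :
  (forall u : 'rV_m, u *m A = 0 -> forall i j, u 0 i = u 0 j) ->
  (m <= \rank A + 1)%N.
Proof.
move=> kerA; suff le1 : (\rank (kermx A) <= 1)%N.
  by rewrite -leq_subLR -mxrank_ker.
case: m A kerA => [|m] A kerA; first by rewrite (leq_trans (rank_leq_row _)).
have sub1 : (kermx A <= (const_mx 1 : 'rV[K]_m.+1))%MS.
  apply/row_subP => i; apply/submxP; exists (kermx A i 0)%:M.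
  apply/rowP => j; rewrite mul_scalar_mx !mxE mulr1.
  have := kerA (row i (kermx A)); rewrite -row_mul mulmx_ker row0.
  by move=> /(_ erefl j 0); rewrite !mxE.
exact: leq_trans (mxrankS sub1) (rank_leq_row _).
Qed.

(* M and N represent consecutive boundary maps of a chain complex; equality of
   the dimensions forces exactness in the middle. *)
Lemma chain_rank (K : fieldType) (T1 T2 T3 : finType)
    (Fs : {set T1}) (Es : {set T2}) (Ws : {set T3})
    (M : T1 -> T2 -> K) (N : T2 -> T3 -> K) :
  (forall f w, f \in Fs -> w \in Ws -> \sum_(e in Es) M f e * N e w = 0) ->
  (forall c : T1 -> K,
     (forall e, e \in Es -> \sum_(f in Fs) c f * M f e = 0) ->
     {in Fs &, forall f f', c f = c f'}) ->
  (forall c : T3 -> K,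
     (forall e, e \in Es -> \sum_(w in Ws) N e w * c w = 0) ->
     {in Ws, forall w, c w = 0}) ->
  (#|Fs| + #|Ws| <= #|Es| + 1)%N /\
  ((#|Fs| + #|Ws| = #|Es| + 1)%N ->
     forall z : T2 -> K,
       (forall w, w \in Ws -> \sum_(e in Es) z e * N e w = 0) ->
       exists c : T1 -> K,
         forall e, e \in Es -> z e = \sum_(f in Fs) c f * M f e).
Proof.
move=> orth kerM kerN.
pose MM : 'M[K]_(#|Fs|, #|Es|) := \matrix_(i, j) M (enum_val i) (enum_val j).
pose NN : 'M[K]_(#|Es|, #|Ws|) := \matrix_(i, j) N (enum_val i) (enum_val j).
(* Vectors are indexed by ordinals, chains by elements; [ext] converts a vector into a function on
   the whole type, with value 0 off the set. *)
have ext (T : finType) (A : {set T}) (u : 'I_#|A| -> K) :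
    exists c : T -> K, forall i, c (enum_val i) = u i.
  exists (fun x => if [pick i | enum_val i == x] is Some i then u i else 0) => i.
  by case: pickP => [j /eqP/enum_val_inj-> // | /(_ i)]; rewrite eqxx.
have MN0 : MM *m NN = 0.
  apply/matrixP => i j; rewrite !mxE.
  rewrite -[RHS](orth (enum_val i) (enum_val j)) ?enum_valP // [RHS]big_enum_val.
  by apply: eq_bigr => k _; rewrite !mxE.
have rM : (#|Fs| <= \rank MM + 1)%N.
  apply: mxrank_const_ker => u uM i j.
  have [c cE] := ext _ _ (u 0); rewrite -!cE.
  apply: kerM; rewrite ?enum_valP // => e eE.
  have /matrixP/(_ 0 (enum_rank_in eE e)) := uM; rewrite [LHS]mxE [RHS]mxE => uE; rewrite -[RHS]uE.
  rewrite [LHS]big_enum_val; apply: eq_bigr => k _.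
  by rewrite cE [MM _ _]mxE enum_rankK_in.
have rN : \rank NN = #|Ws|.
  rewrite -mxrank_tr; apply/eqP; rewrite -/(row_free _) -kermx_eq0.
  apply/eqP/row_matrixP => i; rewrite row0.
  set u := row i _; have uN : u *m NN^T = 0 by rewrite -row_mul mulmx_ker row0.
  apply/rowP => j; rewrite [RHS]mxE.
  have [c cE] := ext _ _ (u 0); rewrite -cE.
  apply: kerN; rewrite ?enum_valP // => e eE.
  have /matrixP/(_ 0 (enum_rank_in eE e)) := uN; rewrite [LHS]mxE [RHS]mxE => uE; rewrite -[RHS]uE.
  rewrite [LHS]big_enum_val; apply: eq_bigr => k _.
  by rewrite cE [NN^T _ _]mxE [NN _ _]mxE enum_rankK_in // mulrC.
have := mulmx0_rank_max MN0; rewrite rN => le.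
split; first by lia.
move=> eq z zN.
have rME : \rank MM = (#|Es| - \rank NN)%N by rewrite rN; lia.
have subM : (MM <= kermx NN)%MS by apply/sub_kermxP.
(* The image of M lies in the kernel of N and has the same dimension. *)
have /eqmxP eqM : (MM == kermx NN)%MS.
  by rewrite -(mxrank_leqif_eq subM) mxrank_ker rME.
pose zz : 'rV[K]_#|Es| := \row_j z (enum_val j).
have /submxP[D zD] : (zz <= MM)%MS.
  rewrite eqM; apply/sub_kermxP/rowP => j; rewrite !mxE.
  rewrite -[RHS](zN (enum_val j)) ?enum_valP // [RHS]big_enum_val.
  by apply: eq_bigr => k _; rewrite !mxE.
have [c cE] := ext _ _ (D 0); exists c => e eE.
have /matrixP/(_ 0 (enum_rank_in eE e)) := zD; rewrite !mxE enum_rankK_in // => ->.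
rewrite [RHS]big_enum_val; apply: eq_bigr => k _.
by rewrite cE mxE enum_rankK_in.
Qed.

End ChainRank.

(* The root selects the component in which the argument takes place. *)
Record planeMap := PlaneMap {
  vert :> finType;
  edge : rel vert;
  turn : vert -> vert -> vert;
  edge_sym : symmetric edge;
  edge_irr : irreflexive edge;
  embedded : plane_embedding edge turn;
  edge_tf : triangle_free edge;
  deg_gt2 : forall v, 2 < deg edge v;
  root : vert }.

Arguments edge {p}.
Arguments turn {p}.
Arguments root {p}.

(** * Rotations, darts and the face permutation *)

Section Basics.
Variable G : planeMap.
Implicit Types (u v w : G) (p : G * G) (S : {set G * G}).

Lemma edgeC u v : edge u v = edge v u.
Proof. exact: edge_sym. Qed.

Lemma edge_neq u v : edge u v -> u != v.
Proof. by apply: contraTneq => ->; rewrite edge_irr. Qed.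

Lemma no_triangle a b c : @edge G a b -> edge b c -> edge a c -> False.
Proof.
by move=> ab bc ac; apply: (@edge_tf G a b c); split => //; rewrite edgeC.
Qed.

Lemma turn_edge u v : edge u v -> edge u (turn u v).
Proof. by move=> uv; case: (embedded G) => /(_ u v v uv) [] . Qed.

Lemma turn_inj u v w : edge u v -> edge u w -> turn u v = turn u w -> v = w.
Proof. by move=> uv uw; case: (embedded G) => /(_ u v w uv) [] _ /(_ uw). Qed.

Lemma turn_connect u v w : edge u v -> edge u w -> fconnect (turn u) v w.
Proof. by move=> uv uw; case: (embedded G) => /(_ u v w uv) [] _ _ /(_ uw). Qed.

Lemma turn_ind u v (P : G -> Prop) : edge u v -> P v ->
  (forall w, edge u w -> P w -> P (turn u w)) -> forall w, edge u w -> P w.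
Proof.
move=> uv Pv step w uw; have /iter_findex <- := turn_connect uv uw.
suff [] : edge u (iter (findex (turn u) v w) (turn u) v) /\
          P (iter (findex (turn u) v w) (turn u) v) by [].
elim: (findex _ _ _) => [//|n [e Pe]] /=.
by split; [apply: turn_edge | apply: step].
Qed.

(** Otherwise the orbit of [v] would have at most two elements; but it contains all neighbours of
    [u], of which there are at least three. *)
Lemma turn2_neq u v : edge u v -> turn u (turn u v) != v.
Proof.
move=> uv; apply/eqP => E.
have sub : [set w | edge u w] \subset [set v; turn u v].
  apply/subsetP => w; rewrite inE => uw.
  have: w \in [set v; turn u v]; last by [].
  move: w uw; apply: (turn_ind uv); first by rewrite !inE eqxx.
  by move=> w uw; rewrite !inE => /orP[] /eqP->; rewrite ?E eqxx ?orbT.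
have := subset_leq_card sub; rewrite cards2 leqNgt => /negP[].
by have := @deg_gt2 G u; rewrite /deg; lia.
Qed.

Lemma turn_neq u v : edge u v -> turn u v != v.
Proof. by move=> uv; apply/eqP => E; have := turn2_neq uv; rewrite !E eqxx. Qed.

(* turn u is controlled only on the neighbours of u; turnt u is a permutation. *)
Definition turnt u w := if edge u w then turn u w else w.

Lemma turnt_inj u : injective (turnt u).
Proof.
move=> v w; rewrite /turnt; case: ifP => uv; case: ifP => uw //.
- exact: turn_inj.
- by move=> E; rewrite -E turn_edge in uw.
- by move=> E; rewrite E turn_edge in uv.
Qed.

Definition turnback u w := finv (turnt u) w.

Lemma turnK u w : edge u w -> turnback u (turn u w) = w.
Proof.
move=> uw; have <- : turnt u w = turn u w by rewrite /turnt uw.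
exact: finv_f (@turnt_inj u) w.
Qed.

Lemma reindex_turn (R : Type) (idx : R) (op : Monoid.com_law idx) u (F : G -> R) :
  \big[op/idx]_(w | edge u w) F w = \big[op/idx]_(w | edge u w) F (turn u w).
Proof.
rewrite (reindex_inj (@turnt_inj u)) /=; apply: eq_big => w; rewrite /turnt.
  by case: ifP => [uw|->]; rewrite ?turn_edge.
by case: ifP => // ->.
Qed.

Definition flip p : G * G := (p.2, p.1).

Lemma flipK : involutive flip. Proof. by case. Qed.

Definition darts := [set p : G * G | edge p.1 p.2 & connect edge root p.1].

Lemma flip_darts p : (flip p \in darts) = (p \in darts).
Proof.
rewrite !inE /= edgeC; case E: (edge p.1 p.2) => //=.
apply/idP/idP => H; apply: connect_trans H (connect1 _) => //.
by rewrite edgeC.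
Qed.

(* face_step, extended by the identity outside the darts so that it is injective. *)
Definition next_dart p : G * G := if edge p.1 p.2 then (p.2, turn p.2 p.1) else p.

Lemma next_dart_inj : injective next_dart.
Proof.
move=> [a b] [c d]; rewrite /next_dart /=; case: ifP => ab; case: ifP => cd //.
- by move=> [E]; subst d => H; congr (_, _); apply: turn_inj H; rewrite edgeC.
- by case=> *; subst; rewrite turn_edge // edgeC in cd.
- by case=> *; subst; rewrite turn_edge // edgeC in ab.
Qed.

Lemma next_dartE a b : edge a b -> next_dart (a, b) = (b, turn b a).
Proof. by rewrite /next_dart /= => ->. Qed.

Lemma next_darts p : (next_dart p \in darts) = (p \in darts).
Proof.
rewrite /next_dart; case: ifP => // ab.
rewrite -[RHS]flip_darts !inE /= -![edge p.2 p.1]edgeC ab turn_edge //.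
by rewrite edgeC.
Qed.

Lemma dartP p : p \in darts -> edge p.1 p.2. Proof. by rewrite inE => /andP[]. Qed.

Lemma iter_next_dart n p : p \in darts -> iter n (@face_step G turn) p = iter n next_dart p.
Proof.
move=> pD; suff [] : iter n (@face_step G turn) p = iter n next_dart p /\
    iter n next_dart p \in darts by [].
elim: n => [//|n [E D]] /=; rewrite next_darts E; split=> //.
by rewrite /next_dart (dartP D).
Qed.

Lemma fconnect_next_dart p : p \in darts ->
  fconnect (@face_step G turn) p =1 fconnect next_dart p.
Proof.
move=> pD q; apply/idP/idP => /iter_findex <-; last first.
  by rewrite -iter_next_dart ?fconnect_iter.
by rewrite iter_next_dart ?fconnect_iter.
Qed.

Lemma froot_next_dart p : p \in darts ->
  froot (@face_step G turn) p = froot next_dart p.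
Proof. by move=> pD; rewrite /fingraph.root (eq_pick (fconnect_next_dart pD)). Qed.

Definition nfaces S := #|[set p in S | froot next_dart p == p]|.

Definition ivert := [set v : G | connect edge root v].

Lemma euler : 2 * #|ivert| + 2 * nfaces darts = #|darts| + 4.
Proof.
have [w rw] : exists w, @edge G root w.
  have /card_gt0P[w] : 0 < #|[set w | @edge G root w]|.
    by have := @deg_gt2 G root; rewrite /deg; lia.
  by rewrite inE => rw; exists w.
have [_ /(_ root)] := embedded G => /(_ (ex_intro _ w rw)).
have -> : n_darts_in (@edge G) (Defs.comp edge root) = #|darts|.
  by rewrite /n_darts_in; apply: eq_card => p; rewrite !inE.
have -> : n_faces_in (@edge G) turn (Defs.comp edge root) = nfaces darts.
  rewrite /nfaces /n_faces_in; apply: eq_card => p; rewrite in_set [RHS]in_set andbA.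
  have -> : dart edge p && (p.1 \in Defs.comp edge root) = (p \in darts) by rewrite !inE.
  by case pD: (p \in darts) => //=; rewrite froot_next_dart.
by have -> : #|Defs.comp (@edge G) root| = #|ivert| by apply: eq_card => p; rewrite !inE.
Qed.

End Basics.

(** * Sets of faces and their boundaries modulo 2 *)

Section Regions.
Variable G : planeMap.
Implicit Types (u v w : G) (p : G * G) (S B : {set G * G}).

(* A set of faces is encoded by the set of the darts on their boundaries. *)
Definition region S := S \subset darts G /\ forall p, (next_dart p \in S) = (p \in S).

Definition boundary S p := (p \in S) (+) (flip p \in S).

Definition inner S := [set p in S | flip p \in S].

Lemma region_dart S p : region S -> p \in S -> p \in darts G.
Proof. by case=> /subsetP sub _ /sub. Qed.

Lemma region_edge S u v : region S -> (u, v) \in S -> edge u v.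
Proof. by move=> rS /(region_dart rS)/dartP. Qed.

Lemma region_turn S u v : region S -> edge u v -> ((v, turn v u) \in S) = ((u, v) \in S).
Proof. by case=> _ cS uv; rewrite -(cS (u, v)) next_dartE. Qed.

Lemma region_iter S n p : region S -> (iter n (@next_dart G) p \in S) = (p \in S).
Proof. by case=> _ cS; elim: n => //= n IH; rewrite cS. Qed.

Lemma region_fconnect S p q : region S -> fconnect (@next_dart G) p q -> (p \in S) = (q \in S).
Proof. by move=> rS /iter_findex <-; rewrite region_iter. Qed.

Lemma region_froot S p : region S -> (froot (@next_dart G) p \in S) = (p \in S).
Proof. by move=> rS; rewrite (region_fconnect rS (connect_root _ p)). Qed.

Lemma froot_next p : froot (@next_dart G) (next_dart p) = froot (@next_dart G) p.
Proof.
apply/eqP; rewrite root_connect; last exact/fconnect_sym/next_dart_inj.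
by rewrite fconnect_sym ?fconnect1 //; apply: next_dart_inj.
Qed.

(** Turning around [v] crosses one edge at a time. No edge at [v] is in the boundary, so membership
    in [S] is carried from each edge to the next. *)
Lemma region_star S v w : region S ->
  (forall u, edge v u -> ~~ boundary S (v, u)) -> (v, w) \in S ->
  forall u, edge v u -> (v, u) \in S /\ (u, v) \in S.
Proof.
move=> rS nb vwS; have vw := region_edge rS vwS.
have flipS u : edge v u -> ((u, v) \in S) = ((v, u) \in S).
  by move=> /nb; rewrite /boundary /flip /=; case: (_ \in S); case: (_ \in S).
move=> u vu; rewrite flipS //; suff : (v, u) \in S by [].
move: u vu; apply: (turn_ind vw) => // u vu vuS.
by rewrite region_turn ?flipS // edgeC.
Qed.

(** By [region_star] membership spreads from a vertex to its neighbours, hence over the whole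
    component of the root. *)
Lemma region_no_boundary S : region S ->
  (forall p, p \in darts G -> ~~ boundary S p) -> S = set0 \/ S = darts G.
Proof.
move=> rS nb; have [->|/set0Pn[[v w] vwS]] := eqVneq S set0; first by left.
right; apply/eqP; rewrite eqEsubset; case: (rS) => -> _ /=.
have star v' w' : (v', w') \in S -> forall u, edge v' u -> (v', u) \in S /\ (u, v') \in S.
  move=> vwS'; apply: (region_star rS) (vwS') => u v'u; apply: nb.
  by have := region_dart rS vwS'; rewrite !inE /= v'u => /andP[].
apply/subsetP => -[a b]; rewrite inE /= => /andP[ab ra].
have va : connect edge v a.
  apply: connect_trans ra; rewrite (sym_connect_sym (@edgeC G)).
  by have := region_dart rS vwS; rewrite inE /= => /andP[].
suff : forall x, connect edge v x -> forall y, edge x y -> (x, y) \in S.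
  by move=> /(_ a va b ab).
move=> x /connectP[q]; elim/last_ind: q x => [|q y IH] x /=.
  by move=> _ -> u /(star _ _ vwS)[].
rewrite rcons_path last_rcons => /andP[pq e] -> z yz.
have [_ /star/(_ z yz)[] //] := star _ _ (IH _ pq erefl _ e) _ e.
Qed.

Lemma inner_flip S p : (flip p \in inner S) = (p \in inner S).
Proof. by rewrite !inE flipK andbC. Qed.

(** Selects one of the two darts of each edge. *)
Let up p := enum_rank p.1 < enum_rank p.2.

Lemma big_inner (R : Type) (idx : R) (op : Monoid.com_law idx) S (F : G * G -> R) :
  region S -> \big[op/idx]_(p in inner S) F p =
  \big[op/idx]_(p in [set p in inner S | up p]) op (F p) (F (flip p)).
Proof.
move=> rS; rewrite (bigID up) /= big_split /=; congr (op _ _).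
  by apply: eq_bigl => p; rewrite [RHS]inE.
rewrite (reindex_inj (can_inj (@flipK G))) /=; apply: eq_bigl => p.
rewrite [RHS]inE inner_flip; case pI: (p \in inner S) => //=.
have /edge_neq : edge p.1 p.2.
  by move: pI; rewrite inE => /andP[/(region_dart rS)/dartP].
by rewrite -(inj_eq enum_rank_inj) neq_ltn /up /= -leqNgt => /orP[]; lia.
Qed.

Lemma card_inner S : region S -> #|inner S| = #|[set p in inner S | up p]|.*2.
Proof.
move=> rS; rewrite -!sum1_card (big_inner _ (fun=> 1) rS) -muln2.
by rewrite big_distrl.
Qed.

Section F2.
Import GRing.Theory.
Local Open Scope ring_scope.

Let F2E (x : 'F_2) : x = (x != 0)%:R.
Proof. by case: x => -[|[|//]] ?; apply: val_inj. Qed.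

Let F2D (x : 'F_2) : x + x = 0.
Proof. by rewrite [x]F2E; case: (x != 0); apply: val_inj. Qed.

Let F2nat n : (n%:R : 'F_2) = (odd n)%:R.
Proof. by apply: val_inj; rewrite /= !val_Fp_nat // !modn2 oddb. Qed.

Let F2b (a b : bool) : (a%:R + b%:R : 'F_2) = (a (+) b)%:R.
Proof. by case: a; case: b; apply: val_inj. Qed.

Let F2inj (a b : bool) : (a%:R : 'F_2) = b%:R -> a = b.
Proof. by case: a; case: b. Qed.

(* chain_rank over F_2 for the faces of B, the edges with B on both sides and
   the vertices of Ws; the edges are represented by their darts p with up p. *)
Lemma region_rank B (Ws : {set G}) :
  region B -> Ws \proper ivert G ->
  (forall v w, v \in Ws -> edge v w -> (v, w) \in inner B) ->
  (forall S, region S -> S \subset B ->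
     (forall p, p \in inner B -> ~~ boundary S p) -> S = set0 \/ S = B) ->
  (2 * nfaces B + 2 * #|Ws| <= #|inner B| + 2)%N /\
  ((2 * nfaces B + 2 * #|Ws|)%N = (#|inner B| + 2)%N ->
   forall Z : rel G, symmetric Z ->
     (forall v, v \in Ws -> ~~ odd #|[set w | edge v w & Z v w]|) ->
     exists S, [/\ region S, S \subset B &
       forall p, p \in inner B -> boundary S p = Z p.1 p.2]).
Proof.
move=> rB Wsub WsB kerB.
set Fs := [set p in B | froot (@next_dart G) p == p].
set Es := [set p in inner B | up p].
pose fr := froot (@next_dart G).
(* Incidence modulo 2: an edge with the same face on both sides gets 1 + 1 = 0. *)
pose M (f e : G * G) : 'F_2 := (fr e == f)%:R + (fr (flip e) == f)%:R.
pose N (e : G * G) w : 'F_2 := (e.1 == w)%:R + (e.2 == w)%:R.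
have sumN (F : G * G -> 'F_2) w : w \in Ws -> (forall p, F (flip p) = F p) ->
    \sum_(e in Es) F e * N e w = \sum_(u | edge w u) F (w, u).
  move=> wW Fflip.
  transitivity (\sum_(p in inner B) F p * (p.1 == w)%:R).
    rewrite (big_inner _ _ rB); apply: eq_bigr => p _.
    by rewrite /N mulrDr Fflip.
  rewrite (bigID (fun p : G * G => p.1 == w)) /= [X in _ + X]big1 ?addr0; last first.
    by move=> p /andP[_ /negPf->]; rewrite mulr0.
  rewrite (reindex_onto (fun u => (w, u)) (fun p => p.2)) /=; last first.
    by move=> [a b] /andP[_ /eqP /= ->].
  apply: eq_big => [u|u /andP[/andP[_ _] _]]; rewrite ?eqxx ?mulr1 ?andbT //.
  apply/idP/idP; last exact: WsB.
  by rewrite inE => /andP[/(region_edge rB)].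
have FsE p : p \in inner B -> forall c : G * G -> 'F_2,
    \sum_(f in Fs) c f * M f p = c (fr p) + c (fr (flip p)).
  have one q (c : G * G -> 'F_2) : q \in B ->
      \sum_(f in Fs) c f * (fr q == f)%:R = c (fr q).
    move=> qB; rewrite (bigD1 (fr q)) /=; last first.
      rewrite inE region_froot // qB /fr root_root ?eqxx //.
      exact/fconnect_sym/next_dart_inj.
    rewrite eqxx mulr1 big1 ?addr0 // => f /andP[_ /negPf].
    by rewrite eq_sym => ->; rewrite mulr0.
  rewrite inE => /andP[pB fB] c; rewrite -!one // -big_split /=.
  by apply: eq_bigr => f _; rewrite -mulrDr.
(* Over F_2 a function on the faces is a set of faces, and the boundary map sends it to the boundary
   of that set. *)
pose cut (c : G * G -> 'F_2) := [set p in B | c (fr p) != 0].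
have cut_region c : region (cut c).
  split; first by apply/subsetP => p; rewrite inE => /andP[/(region_dart rB)].
  by move=> p; rewrite !inE /fr froot_next; case: rB => _ ->.
have cut_bd c p : p \in inner B ->
    c (fr p) + c (fr (flip p)) = (boundary (cut c) p)%:R.
  rewrite inE => /andP[pB fB]; rewrite /boundary !inE pB fB /=.
  by rewrite {1}[c (fr p)]F2E {1}[c (fr (flip p))]F2E F2b.
have innerEs p : p \in inner B -> p \in Es \/ flip p \in Es.
  move=> pI; have /edge_neq : edge p.1 p.2.
    by move: pI; rewrite inE => /andP[/(region_dart rB)/dartP].
  rewrite -(inj_eq enum_rank_inj) neq_ltn ![_ \in Es]inE inner_flip pI /up /=.
  by case/orP; [left|right].
have bd_flip S p : boundary S (flip p) = boundary S p.
  by rewrite /boundary flipK addbC.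
have [|c cM|c cN|le eq] :=
    @chain_rank _ _ _ _ Fs Es Ws M N.
(* At [w] the faces on one side of the edges are those on the other side shifted by one turn, so
   every corner is counted twice. *)
- move=> f w fF wW; rewrite sumN //; last by move=> p; rewrite /M flipK addrC.
  rewrite /M big_split /= [X in X + _]reindex_turn -[RHS](F2D (\sum_(u | edge w u)
    (fr (w, turn w u) == f)%:R)).
  congr (_ + _); apply: eq_bigr => u wu.
  by rewrite /flip /= -next_dartE ?[edge u w]edgeC // /fr froot_next.
- have [||cut0|cutB] := kerB (cut c) (cut_region c).
  + by apply/subsetP => p; rewrite inE => /andP[].
  + move=> p pI; apply: (contraFN _ (erefl false)) => bp.
    have [pE|pE] := innerEs p pI; have := cM _ pE.
      by rewrite FsE // cut_bd // bp.
    by rewrite FsE ?inner_flip // cut_bd ?inner_flip // bd_flip bp.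
  + have c0 f : f \in Fs -> c f = 0.
      rewrite inE => /andP[fB /eqP fE]; apply/eqP/negPn.
      by apply/negP => cf; have := in_set0 f; rewrite -cut0 inE fB /fr fE cf.
    by move=> f f' /c0-> /c0->.
  + have c1 f : f \in Fs -> c f = 1.
      rewrite inE => /andP[fB /eqP fE]; move: (fB).
      by rewrite -{1}cutB inE /fr fE => /andP[_ cf]; rewrite [c f]F2E cf.
    by move=> f f' /c1-> /c1->.
(* The support of a cocycle is closed under adjacency; by connectivity it would reach the vertex of
   [ivert G] that is missing from [Ws]. *)
- pose U := [set w in Ws | c w != 0].
  have sumc p : p \in inner B -> \sum_(w in Ws) N p w * c w =
     (p.1 \in U)%:R + (p.2 \in U)%:R.
    have one q : \sum_(w in Ws) (q == w)%:R * c w = (q \in U)%:R.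
      case qW: (q \in Ws); last first.
        rewrite inE qW big1 // => w wW; case: eqP => [E|]; last by rewrite mul0r.
        by rewrite E wW in qW.
      rewrite (bigD1 q) //= eqxx mul1r big1 ?addr0 => [|w /andP[_ /negPf]].
        by rewrite inE qW; apply: F2E.
      by rewrite eq_sym => ->; rewrite mul0r.
    move=> _; rewrite -!one -big_split /=; apply: eq_bigr => w _.
    by rewrite -mulrDl.
  have Uclosed v w : v \in U -> edge v w -> w \in U.
    move=> vU vw; have vI : (v, w) \in inner B.
      by apply: WsB => //; move: vU; rewrite inE => /andP[].
    have [pE|pE] := innerEs _ vI; have := cN _ pE.
      by rewrite sumc // vU F2b; case: (w \in U).
    by rewrite sumc ?inner_flip //= vU F2b; case: (w \in U).
  move=> w wW; apply/eqP/negPn/negP => cw.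
  have wU : w \in U by rewrite inE wW.
  case/properP: Wsub => /subsetP sub [x xi xW]; case/negP: xW.
  have : connect edge w x.
    apply: connect_trans (_ : connect edge root x); last by rewrite inE in xi.
    by rewrite (sym_connect_sym (@edgeC G)); have := sub _ wW; rewrite inE.
  case/connectP => q pq ->; suff : last w q \in U by rewrite inE => /andP[].
  by elim: q w wU pq {wW cw} => //= y q IH w wU /andP[/(Uclosed _ _ wU)/IH].
- have cE : #|inner B| = (#|Es| * 2)%N by rewrite card_inner // muln2.
  have nF : nfaces B = #|Fs| by [].
  split; first by rewrite nF cE; lia.
  move=> E Z Zsym Zeven; have [||c cZ] := eq _ (fun e => (Z e.1 e.2)%:R).
  + by rewrite nF cE in E; lia.
  + move=> w wW; rewrite (sumN (fun e => (Z e.1 e.2)%:R)) //; last first.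
      by move=> p; rewrite /= Zsym.
    rewrite -natr_sum F2nat; have -> : (\sum_(u | edge w u) Z w u)%N =
        #|[set u | edge w u & Z w u]|.
      by rewrite -sum1dep_card big_mkcondr.
    by rewrite (negPf (Zeven _ wW)).
  + exists (cut c); split => //; first by apply/subsetP => p; rewrite inE => /andP[].
    move=> p pI; apply: F2inj; have [pE|pE] := innerEs p pI.
      by rewrite (cZ _ pE) FsE // cut_bd.
    by rewrite Zsym (cZ _ pE) FsE ?inner_flip // cut_bd ?inner_flip // bd_flip.
Qed.

End F2.
End Regions.

(** * The two sides of a cycle and Euler's formula for a disc *)

Section Discs.
Variable G : planeMap.
Implicit Types (u v w : G) (p : G * G) (S A B : {set G * G}) (k s : seq G).

Definition cyc k := [&& uniq k, cycle edge k & 2 < size k].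
Definition link k u w :=
  ((u \in k) && (next k u == w)) || ((w \in k) && (next k w == u)).
Definition bounds S k := region S /\ forall p, p \in darts G -> boundary S p = link k p.1 p.2.
Definition interior S k := [set v | (v \notin k) && [exists w, (v, w) \in S]].

Lemma linkC k : symmetric (link k).
Proof. by move=> u w; rewrite /link orbC. Qed.

Lemma cyc_uniq k : cyc k -> uniq k. Proof. by case/and3P. Qed.

Lemma cyc_mem k : cyc k -> exists a, a \in k.
Proof. by case/and3P; case: k => // a k _ _ _; exists a; rewrite mem_head. Qed.

Lemma cyc_next k a : cyc k -> a \in k -> edge a (next k a).
Proof. by case/and3P => _ ck _; apply: next_cycle. Qed.

Lemma next2_neq k a : cyc k -> a \in k -> next k (next k a) != a.
Proof.
case/and3P => uk _ szk ak; have [i k' kE] := rot_to ak.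
rewrite -!(next_rot i uk) kE.
have : uniq (a :: k') by rewrite -kE rot_uniq.
have : 2 < size (a :: k') by rewrite -kE size_rot.
case: k' {kE} => [|b [|c r]] //= _; rewrite !inE !eqxx /=.
by rewrite [b == a]eq_sym; case: (a == b) => //=; rewrite [c == a]eq_sym; case: (a == c).
Qed.

Lemma link_edge k u w : cyc k -> link k u w -> edge u w.
Proof.
move=> ck; rewrite /link => /orP[] /andP[uk /eqP <-]; last rewrite edgeC;
exact: cyc_next.
Qed.

Lemma link_mem k u w : link k u w -> (u \in k) /\ (w \in k).
Proof. by rewrite /link => /orP[] /andP[uk /eqP <-]; rewrite mem_next uk. Qed.

Lemma cyc_ind k (Q : G -> Prop) a : cyc k -> a \in k -> Q a ->
  (forall b, b \in k -> Q b -> Q (next k b)) -> forall b, b \in k -> Q b.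
Proof.
move=> /cyc_uniq uk ak Qa step b bk.
have : b \in k by [].
rewrite -(fconnect_cycle (cycle_next uk) ak) => /iter_findex <-.
suff [] : iter (findex (next k) a b) (next k) a \in k /\
  Q (iter (findex (next k) a b) (next k) a) by [].
by elim: (findex _ _ _) => //= n [nk Qn]; rewrite mem_next; split; last apply: step.
Qed.

(** Each corner at [v] matches a dart of [S] entering [v] with one leaving it. The boundary edges at
    [v] are thus the symmetric difference of two sets of equal size. *)
Lemma region_even S v : region S -> ~~ odd #|[set w | edge v w & boundary S (v, w)]|.
Proof.
move=> rS; pose A1 := [set w | edge v w & (v, w) \in S].
pose A2 := [set w | edge v w & (w, v) \in S].
have cA : #|A1| = #|A2|.
  rewrite -!sum1dep_card !big_mkcondr /= reindex_turn; apply: eq_bigr => w vw.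
  by rewrite region_turn // edgeC.
have -> : [set w | edge v w & boundary S (v, w)] = (A1 :\: A2) :|: (A2 :\: A1).
  apply/setP => w; rewrite !inE /boundary /=.
  by case: (edge v w); case: (_ \in S); case: (_ \in S).
have := cardsID A2 A1; have := cardsID A1 A2; rewrite [A2 :&: A1]setIC cA => E1 E2.
rewrite cardsU (_ : _ :&: _ = set0) ?cards0.
  by rewrite (_ : #|A1 :\: A2| = #|A2 :\: A1|); lia.
apply/setP => w; rewrite in_setI !in_setD in_set0.
by case: (w \in A1); case: (w \in A2).
Qed.

Lemma region_symdiff S S' : region S -> region S' ->
  region [set p | (p \in S) (+) (p \in S')].
Proof.
move=> [sS cS] [sS' cS']; split; last by move=> p; rewrite !inE cS cS'.
apply/subsetP => p; rewrite inE; case pS: (p \in S) => /=.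
  by move=> _; apply: (subsetP sS).
exact: (subsetP sS').
Qed.

Lemma region_eq_boundary S S' : region S -> region S' ->
  (forall p, p \in darts G -> boundary S p = boundary S' p) ->
  S = S' \/ S = darts G :\: S'.
Proof.
move=> rS rS' bE; have rD := region_symdiff rS rS'.
have [|D0|DD] := region_no_boundary rD.
- move=> p /bE; rewrite /boundary !inE.
  by case: (p \in S); case: (flip p \in S); case: (p \in S'); case: (flip p \in S').
- left; apply/setP => p; have := in_set0 p; rewrite -D0 inE.
  by case: (p \in S); case: (p \in S').
- right; apply/setP => p; rewrite in_setD.
  case pS: (p \in S); last by rewrite -DD inE pS /= andNb.
  have := subsetP (proj1 rS) p pS; rewrite -DD inE pS /= => ->.
by [].
Qed.

Lemma regionC S : region S -> region (darts G :\: S).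
Proof.
case=> sS cS; split; first exact: subsetDl.
by move=> p; rewrite !in_setD next_darts cS.
Qed.

Lemma boundaryC S p : region S -> p \in darts G ->
  boundary (darts G :\: S) p = boundary S p.
Proof.
move=> rS pD; rewrite /boundary !in_setD flip_darts pD !andbT.
by case: (p \in S); case: (flip p \in S).
Qed.

Lemma boundary_flip S p : boundary S (flip p) = boundary S p.
Proof. by rewrite /boundary flipK addbC. Qed.

(* At every vertex of k the boundary of S has even degree, hence contains both
   or none of the two edges of k. *)
Lemma sub_boundary S k : cyc k -> region S ->
  (forall p, p \in darts G -> boundary S p -> link k p.1 p.2) ->
  (forall p, p \in darts G -> boundary S p = false) \/
  (forall p, p \in darts G -> boundary S p = link k p.1 p.2).
Proof.
move=> ck rS sub.
have bdD p : boundary S p -> p \in darts G.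
  rewrite /boundary; case pS: (p \in S) => /=; first by rewrite (region_dart rS pS).
  move=> fS; by rewrite -flip_darts; apply: region_dart rS fS.
have stepQ a : a \in k ->
    boundary S (next k a, next k (next k a)) = boundary S (a, next k a).
  move=> ak; set b := next k a; have bk : b \in k by rewrite mem_next.
  have := region_even b rS; set D := [set w | _ & _].
  have DE : D = [set w in [set a; next k b] | boundary S (b, w)].
    apply/setP => w; rewrite !inE; case bd: (boundary S (b, w)); rewrite ?andbF // !andbT.
    have bw := dartP (bdD _ bd); rewrite bw; symmetry; apply/orP.
    have /orP[/andP[/= _ /eqP <-]|/andP[/= wk /eqP E]] := sub _ (bdD _ bd) bd.
      by right; rewrite eqxx.
    left; apply/eqP.
    by rewrite -(prev_next (cyc_uniq ck) w) E prev_next // cyc_uniq.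
  rewrite DE; have ne : a != next k b by rewrite eq_sym next2_neq.
  rewrite -[(a, b)]/(flip (b, a)) boundary_flip.
  have -> : [set w in [set a; next k b] | boundary S (b, w)] =
     (if boundary S (b, a) then [set a] else set0) :|:
     (if boundary S (b, next k b) then [set next k b] else set0).
    apply/setP => w; rewrite in_setU in_set in_set2.
    case: (w =P a) => [->|/eqP wa] /=.
      by case: (boundary S (b, a)); case: (boundary S (b, next k b));
         rewrite !inE ?eqxx ?(negPf ne).
    case: (w =P next k b) => [->|/eqP wb] /=.
      by case: (boundary S (b, a)); case: (boundary S (b, next k b));
         rewrite !inE ?eqxx ?orbT // eq_sym (negPf ne).
    by case: (boundary S (b, a)); case: (boundary S (b, next k b));
         rewrite !inE ?(negPf wa) ?(negPf wb).
  by case: (boundary S (b, a)); case: (boundary S (b, next k b));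
     rewrite ?setU0 ?set0U ?cards1 ?cards2.
have [a ak] := cyc_mem ck.
have allQ b : b \in k -> boundary S (b, next k b) = boundary S (a, next k a).
  by move: b; apply: (cyc_ind ck ak) => // b bk <-; apply: stepQ.
have bdE p : p \in darts G -> link k p.1 p.2 -> boundary S p = boundary S (a, next k a).
  case: p => [x y] pD /orP[]/andP[/= xk /eqP <-]; rewrite ?allQ //.
  by rewrite -[(_, _)]/(flip (y, next k y)) boundary_flip allQ.
case Qa: (boundary S (a, next k a)) in bdE; [right|left] => p pD.
  case lk: (link k p.1 p.2); first by rewrite bdE.
  by apply/negbTE/negP => /(sub p pD); rewrite lk.
by apply/negbTE/negP => bp; have := bdE p pD (sub p pD bp); rewrite bp.
Qed.

(** Exactness from [region_rank] on the whole component: with one vertex omitted, Euler's formula is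
    the required equality of dimensions, and a cycle has even degree everywhere. *)
Lemma cycle_bounds k : cyc k -> {subset k <= ivert G} -> exists S, bounds S k.
Proof.
move=> ck sub; have rD : region (darts G).
  by split=> // p; rewrite next_darts.
have inD : inner (darts G) = darts G.
  by apply/setP => p; rewrite !in_set1 || rewrite in_set flip_darts andbb.
have [|v w vW vw|S rS _ nb|_ rk] := @region_rank G (darts G) (ivert G :\ root) rD.
- by apply: properD1; rewrite inE.
- by rewrite inD inE /= vw; move: vW; rewrite !inE => /andP[_ ->].
- by apply: region_no_boundary => // p pD; apply: nb; rewrite inD.
have eqr : 2 * nfaces (darts G) + 2 * #|ivert G :\ root| = #|inner (darts G)| + 2.
  have := cardsD1 root (ivert G); have := euler G; rewrite inD.
  have -> : root \in ivert G by rewrite inE. rewrite add1n.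
  by move: (nfaces _) #|darts G| #|ivert G| #|ivert G :\ root| => x y z t; lia.
have [|S [rS _ bS]] := rk eqr (link k) (@linkC k).
- move=> v _; case vk: (v \in k); last first.
    rewrite (_ : [set w | _ & _] = set0) ?cards0 //.
    apply/setP => w; rewrite !inE; apply/negbTE/nandP; right.
    by apply/negP => /link_mem[]; rewrite vk.
  rewrite (_ : [set w | _ & _] = [set next k v; prev k v]).
    rewrite cards2; have -> // : next k v != prev k v.
    apply: contra (next2_neq ck vk) => /eqP ->; rewrite next_prev // cyc_uniq //.
  apply/setP => w; rewrite !inE; apply/andP/orP.
    case=> _ /orP[/andP[_ /eqP <-]|/andP[_ /eqP <-]]; first by left.
    by right; rewrite prev_next // cyc_uniq.
  case=> /eqP ->; first by rewrite cyc_next // /link vk eqxx.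
  have pk : prev k v \in k by rewrite mem_prev.
  have nE : next k (prev k v) = v by rewrite next_prev // cyc_uniq.
  have := cyc_next ck pk; rewrite nE edgeC /link pk nE eqxx orbT => -> //.
by exists S; split => // p pD; apply: bS; rewrite inD.
Qed.

Lemma cyc_ivert k a : cyc k -> a \in k -> a \in ivert G -> {subset k <= ivert G}.
Proof.
move=> ck ak ai; apply: (cyc_ind ck ak ai) => b bk; rewrite !inE => rb.
exact: connect_trans rb (connect1 (cyc_next ck bk)).
Qed.

Lemma interiorP S k v : bounds S k -> v \in interior S k ->
  v \notin k /\ forall u, edge v u -> (v, u) \in S /\ (u, v) \in S.
Proof.
case=> rS bS; rewrite inE => /andP[vk /existsP[w vw]]; split=> //.
apply: (region_star rS) (vw) => u uv.
have vu : (v, u) \in darts G.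
  by have := region_dart rS vw; rewrite !inE /= uv => /andP[].
by rewrite bS //=; apply: contra vk => /link_mem[].
Qed.

Lemma interior_mem S k v u : region S -> v \notin k -> (v, u) \in S \/ (u, v) \in S ->
  v \in interior S k.
Proof.
move=> rS vk H; rewrite inE vk /=; apply/existsP.
case: H => [|uv]; first by exists u.
by exists (turn v u); rewrite region_turn // (region_edge rS uv).
Qed.

(** Each edge of [k] has exactly one of its two darts in [S], and these are the darts of [S] that
    are not inner. *)
Lemma card_bounds S k : cyc k -> {subset k <= ivert G} -> bounds S k ->
  #|S| = #|inner S| + size k.
Proof.
move=> ck sub [rS bS].
have -> : size k = #|[set a in k]| by rewrite cardsE (card_uniqP (cyc_uniq ck)).
pose f a := if (a, next k a) \in S then (a, next k a) else (next k a, a).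
rewrite -(cardsID [set p | flip p \in S] S); congr (_ + _).
  by apply: eq_card => p; rewrite !inE.
rewrite -(card_in_imset (f := f)); last first.
  move=> a b; rewrite !inE => ak bk; rewrite /f.
  have na := next2_neq ck ak; have nb := next2_neq ck bk.
  case: ifP => _; case: ifP => _ [] // E1 E2; case/eqP: na.
    by rewrite E2 -E1.
  by rewrite E1 -E2.
have kD a : a \in k -> (a, next k a) \in darts G.
  by move=> ak; rewrite inE /= cyc_next //; have := sub _ ak; rewrite inE.
apply: eq_card => p; rewrite !inE; apply/andP/imsetP.
  case=> fS pS; have pD := region_dart rS pS.
  have : boundary S p by rewrite /boundary pS (negPf fS).
  rewrite bS // => /orP[]/andP[pk /eqP E].
    by exists p.1; rewrite ?inE // /f E -surjective_pairing pS.
  exists p.2; rewrite ?inE // /f E; have -> : (p.2, p.1) = flip p by [].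
  by rewrite (negPf fS) -surjective_pairing.
case=> a; rewrite inE => ak ->; have := bS _ (kD a ak).
rewrite /boundary /link /= ak eqxx /= /f /flip /=.
by case aS: ((a, next k a) \in S); case naS: ((next k a, a) \in S); rewrite //= ?aS ?naS.
Qed.

Lemma bounds_nonempty S k : cyc k -> {subset k <= ivert G} -> bounds S k -> S != set0.
Proof.
move=> ck sub bS; rewrite -card_gt0 (card_bounds ck sub bS).
by case/and3P: ck => _ _; lia.
Qed.

Lemma boundsC S k : bounds S k -> bounds (darts G :\: S) k.
Proof.
by case=> rS bS; split=> [|p pD]; [exact: regionC | rewrite boundaryC // bS].
Qed.

Lemma bounds_eq S S' k : bounds S k -> bounds S' k -> S = S' \/ S = darts G :\: S'.
Proof.
by case=> rS bS [rS' bS']; apply: region_eq_boundary => // p pD; rewrite bS ?bS'.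
Qed.

(* The rank bound for the other side of k, subtracted from Euler's formula. *)
Lemma euler_disc A k : cyc k -> {subset k <= ivert G} -> bounds A k ->
  #|inner A| + 2 <= 2 * #|interior A k| + 2 * nfaces A.
Proof.
move=> ck sub bA; have [B BE bB] : exists2 B, B = darts G :\: A & bounds B k.
  by exists (darts G :\: A) => //; apply: boundsC.
have [rB bdB] := bB; have [rA bdA] := bA.
have A0 := bounds_nonempty ck sub bA; have B0 := bounds_nonempty ck sub bB.
have [|v w vW vw|S rS SB nb|le _] := @region_rank G B (interior B k) rB.
- apply/properP; split.
    apply/subsetP => v; rewrite inE => /andP[_ /existsP[w /(region_dart rB)]].
    by rewrite !inE => /andP[].
  have [a ak] := cyc_mem ck.
  by exists a; [exact: sub | rewrite inE ak].
- by rewrite inE; have [_ /(_ w vw)[-> ->]] := interiorP bB vW.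
(* The boundary of [S] lies on [k], so [S] is empty, or [B], or would contain the nonempty [A]. *)
- have [|S0|Sk] := sub_boundary ck rS.
  + move=> p pD bS; rewrite -bdB //; apply: contraT => bp.
    have : p \notin inner B by apply/negP => /nb; rewrite bS.
    move: bS bp; rewrite /boundary [p \in inner B]inE.
    case pS: (p \in S); first by rewrite (subsetP SB _ pS) /=; case: (flip p \in B).
    by move=> /= fS; rewrite (subsetP SB _ fS); case: (p \in B).
  + have [|->|SD] := region_no_boundary rS; first by move=> p /S0->.
      by left.
    case/set0Pn: A0 => p pA; have := subsetP SB p.
    by rewrite SD (region_dart rA pA) BE !inE pA => /(_ isT).
  + have [->|SE] : S = B \/ S = darts G :\: B by apply: (@bounds_eq S B k).
      by right.
    case/set0Pn: A0 => p pA; have := subsetP SB p.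
    by rewrite SE BE !in_setD (region_dart rA pA) pA => /(_ isT).
have eV : #|ivert G| = #|interior A k| + #|interior B k| + size k.
  have -> : size k = #|[set a in k]| by rewrite cardsE (card_uniqP (cyc_uniq ck)).
  rewrite -(cardsID [set a in k] (ivert G)) addnC; congr (_ + _); last first.
    apply: eq_card => a; rewrite in_setI (_ : a \in [set _ | _] = (a \in k)) ?inE //.
    by case ak: (a \in k); rewrite ?andbF // andbT; have := sub _ ak; rewrite inE.
  rewrite -(cardsID (interior A k)); congr (_ + _); apply: eq_card => v.
    rewrite [LHS]inE andbC; case vi: (v \in interior A k) => //=.
    have [vk _] := interiorP bA vi; rewrite !inE vk /=.
    move: vi; rewrite inE => /andP[_ /existsP[w /(region_dart rA)]].
    by rewrite inE => /andP[].
  rewrite [LHS]inE; apply/andP/idP.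
    rewrite !inE; case=> vA /andP[vk rv]; rewrite vk /= in vA *.
    have /card_gt0P[w] : 0 < #|[set w | edge v w]|.
      by have := @deg_gt2 G v; rewrite /deg; lia.
    rewrite inE => vw; apply/existsP; exists w; rewrite BE !inE /= vw rv !andbT.
    by apply: contra vA => vA; apply/existsP; exists w.
  move=> vi; have [vk st] := interiorP bB vi; move: vi; rewrite inE vk /=.
  case/existsP=> w vwB; split.
    apply/negP => /(interiorP bA)[_ /(_ w (region_edge rB vwB))[vA _]].
    by move: vwB; rewrite BE inE vA.
  by rewrite !inE vk /=; have := region_dart rB vwB; rewrite inE => /andP[].
have eD : #|darts G| = #|A| + #|B|.
  by rewrite BE -(cardsID A (darts G)) (setIidPr (proj1 rA)).
have eF : nfaces (darts G) = nfaces A + nfaces B.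
  rewrite BE /nfaces -(cardsID A [set p in darts G | _]).
  congr (_ + _); apply: eq_card => p; rewrite !inE.
    case pA: (p \in A); rewrite ?andbF //= andbT.
    by have := region_dart rA pA; rewrite inE => ->.
  by rewrite -!andbA; congr (_ && _).
have := euler G; have := card_bounds ck sub bA; have := card_bounds ck sub bB.
by move: (nfaces _) (nfaces _) (nfaces _) #|_| #|_| #|_| #|_| #|_| #|_| #|_| eV eD eF le; lia.
Qed.

End Discs.

Section NextCycle.
Variable T : eqType.
Implicit Types a b c d e f : T.

Lemma next4 a b c d (s := [:: a; b; c; d]) : uniq s ->
  [/\ next s a = b, next s b = c, next s c = d & next s d = a].
Proof.
move=> /cycle_next; set nx := next s.
by rewrite /s /= => /and5P[/eqP-> /eqP-> /eqP-> /eqP-> _].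
Qed.

Lemma next5 a b c d e (s := [:: a; b; c; d; e]) : uniq s ->
  [/\ next s a = b, next s b = c, next s c = d, next s d = e & next s e = a].
Proof.
move=> /cycle_next; set nx := next s.
by rewrite /s /= => /and5P[/eqP-> /eqP-> /eqP-> /eqP-> /andP[/eqP-> _]].
Qed.

Lemma next6 a b c d e f (s := [:: a; b; c; d; e; f]) : uniq s ->
  [/\ next s a = b, next s b = c & next s c = d] /\
  [/\ next s d = e, next s e = f & next s f = a].
Proof.
move=> /cycle_next; set nx := next s.
by rewrite /s /= => /and5P[/eqP-> /eqP-> /eqP-> /eqP-> /and3P[/eqP-> /eqP-> _]].
Qed.

End NextCycle.

(** * Face lengths and facial walks *)

Section Faces.
Variable G : planeMap.
Implicit Types (u v w : G) (p : G * G) (S A B : {set G * G}) (k s : seq G).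

Definition flen p := order (@next_dart G) p.

Lemma iter_flen p : iter (flen p) (@next_dart G) p = p.
Proof. exact/iter_order/next_dart_inj. Qed.

Lemma flen_next p : flen (next_dart p) = flen p.
Proof.
rewrite /flen /order; apply/esym/eq_card => q.
exact: same_fconnect1 (@next_dart_inj G) p q.
Qed.

Lemma big_region (R : Type) (idx : R) (op : Monoid.com_law idx) S (F : G * G -> R) :
  region S -> \big[op/idx]_(p in S) F p =
  \big[op/idx]_(r in [set r in S | froot (@next_dart G) r == r])
    \big[op/idx]_(i < flen r) F (iter i (@next_dart G) r).
Proof.
move=> rS; have nI := @next_dart_inj G.
rewrite (partition_big (froot (@next_dart G))
  (fun r => r \in [set r in S | froot (@next_dart G) r == r])) /=; last first.
  by move=> p pS; rewrite inE region_froot // pS root_root ?eqxx //; apply: fconnect_sym.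
apply: eq_bigr => r; rewrite inE => /andP[rS' /eqP rE].
rewrite (eq_bigl (mem (orbit (@next_dart G) r))); last first.
  move=> p /=; rewrite -fconnect_orbit -root_connect; last exact: fconnect_sym.
  rewrite rE [RHS]eq_sym; case: eqP => [E|]; rewrite ?andbF // andbT.
  by rewrite -(region_froot _ rS) E.
rewrite -big_uniq ?orbit_uniq //= /orbit -[order _ r]/(flen r).
move: (flen r) => m; elim: m r {rS' rE} => [|n IH] q; first by rewrite /= big_nil big_ord0.
by rewrite /= big_cons IH big_ord_recl; congr (op _ _); apply: eq_bigr => i _; rewrite /= -iterSr.
Qed.

Lemma card_region S : region S ->
  #|S| = \sum_(r in [set r in S | froot (@next_dart G) r == r]) flen r.
Proof.
move=> rS; rewrite -sum1_card big_region //; apply: eq_bigr => r _.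
by rewrite sum1_card card_ord.
Qed.

Lemma card_darts : #|darts G| = \sum_(v in ivert G) deg edge v.
Proof.
rewrite -sum1_card (eq_bigl (fun p => (p.1 \in ivert G) && edge p.1 p.2)); last first.
  by move=> p; rewrite !inE andbC.
rewrite -(pair_big_dep (mem (ivert G)) (fun v w => edge v w) (fun _ _ => 1)) /=.
by apply: eq_bigr => v _; rewrite /deg -sum1dep_card.
Qed.

Lemma flen_gt3 p : p \in darts G -> 3 < flen p.
Proof.
case: p => [a b] pD; have ab := dartP pD; rewrite /= in ab.
have ba : edge b a by rewrite edgeC.
set c := turn b a; have bc : edge b c := turn_edge ba.
have cb : edge c b by rewrite edgeC.
set d := turn c b; have cd : edge c d := turn_edge cb.
have := iter_flen (a, b); have : 0 < flen (a, b) by rewrite order_gt0.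
case: (flen _) => [|[|[|[|n]]]] //= _; rewrite !next_dartE //.
- by case=> E; have := edge_neq ab; rewrite E eqxx.
- by case=> E; have := turn_neq ba; rewrite E eqxx.
- case=> E; case: (no_triangle ab bc); rewrite -/c -/d edgeC in E *.
  by rewrite -E.
Qed.

(** A face is a priori only a closed walk. At length 4 it is a cycle because vertices two steps
    apart differ by [turn_neq]. *)
Lemma facial_walk4 a b : edge a b -> flen (a, b) = 4 ->
  exists c d, facial_walk edge turn [:: a; b; c; d].
Proof.
move=> ab; have ba : edge b a by rewrite edgeC.
set c := turn b a; have bc : edge b c := turn_edge ba.
have cb : edge c b by rewrite edgeC.
set d := turn c b; have cd : edge c d := turn_edge cb.
have dc : edge d c by rewrite edgeC.
set e := turn d c; have de : edge d e := turn_edge dc.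
move=> E; have := iter_flen (a, b); rewrite E /= !next_dartE // -/c -/d -/e => -[Ea Eb].
exists c, d; have ac : a != c by rewrite eq_sym turn_neq.
have bd : b != d by rewrite eq_sym turn_neq.
rewrite Ea in de Eb; have us : uniq [:: a; b; c; d].
  by rewrite /= !inE !negb_or ac bd !edge_neq // edgeC.
split=> //; split=> //; have [na nb nc nd] := next4 us.
by move=> x; rewrite !inE => /or4P[] /eqP ->; rewrite ?(na, nb, nc, nd) /face_step /=;
  rewrite ?Eb //; split => //; rewrite -Ea.
Qed.

Lemma facial_walk5 a b : edge a b -> flen (a, b) = 5 ->
  exists c d e, facial_walk edge turn [:: a; b; c; d; e].
Proof.
move=> ab; have ba : edge b a by rewrite edgeC.
set c := turn b a; have bc : edge b c := turn_edge ba.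
have cb : edge c b by rewrite edgeC.
set d := turn c b; have cd : edge c d := turn_edge cb.
have dc : edge d c by rewrite edgeC.
set e := turn d c; have de : edge d e := turn_edge dc.
have ed : edge e d by rewrite edgeC.
set f := turn e d; have ef : edge e f := turn_edge ed.
move=> E; have := iter_flen (a, b); rewrite E /= !next_dartE // -/c -/d -/e -/f => -[Ea Eb].
exists c, d, e; have ac : a != c by rewrite eq_sym turn_neq.
have bd : b != d by rewrite eq_sym turn_neq.
have ce : c != e by rewrite eq_sym turn_neq.
rewrite Ea in ef Eb; have us : uniq [:: a; b; c; d; e].
  have ad : a != d by apply/eqP => E'; apply: (no_triangle ab bc); rewrite E' edgeC.
  have be : b != e by apply/eqP => E'; apply: (no_triangle bc cd); rewrite E' edgeC.
  by rewrite /= !inE !negb_or ac bd ce ad be !edge_neq // edgeC.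
split=> //; split=> //; have [na nb nc nd ne] := next5 us.
by move=> x; rewrite !inE => /or4P[|||/orP[]] /eqP ->;
  rewrite ?(na, nb, nc, nd, ne) /face_step /=; rewrite ?Eb //; split => //; rewrite -Ea.
Qed.

Lemma facial_walk_cyc k : facial_walk (@edge G) turn k -> cyc k.
Proof.
case=> sz [uk fk]; rewrite /cyc uk sz andbT /=.
by rewrite cycle_from_next // => x /fk[].
Qed.

Definition walk k := [set p : G * G | (p.1 \in k) && (p.2 == next k p.1)].

Lemma walk_next k a : a \in k -> (a, next k a) \in walk k.
Proof. by move=> ak; rewrite inE /= ak eqxx. Qed.

Lemma facial_walk_bounds k : facial_walk (@edge G) turn k -> {subset k <= ivert G} ->
  bounds (walk k) k.
Proof.
move=> fw sub; have ck := facial_walk_cyc fw; have uk := cyc_uniq ck.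
have [_ [_ fk]] := fw; split; last first.
  move=> [x y] _; rewrite /boundary /link !inE /= [next k x == _]eq_sym [next k y == _]eq_sym.
  case: (boolP ((x \in k) && _)) => [/andP[xk /eqP ->]|_] //=.
  by rewrite mem_next xk /= eq_sym next2_neq.
have nextw p : p \in walk k -> next_dart p \in walk k.
  case: p => x y; rewrite inE /= => /andP[xk /eqP ->]; have [e [E]] := fk x xk.
  by rewrite next_dartE // E walk_next ?mem_next.
split; first by apply/subsetP => -[x y]; rewrite !inE /= => /andP[xk /eqP ->];
  have := sub x xk; rewrite inE => ->; rewrite cyc_next.
move=> p; apply/idP/idP; last exact: nextw.
rewrite /next_dart; case: ifP => // pe; rewrite inE /= => /andP[p2k /eqP E].
set x := prev k p.2; have xk : x \in k by rewrite mem_prev.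
have nx : next k x = p.2 by rewrite next_prev.
have [_ [E2]] := fk x xk; rewrite !nx -E in E2.
have -> : p = (x, p.2).
  rewrite [p]surjective_pairing /=; congr (_, _); symmetry; apply: turn_inj E2; rewrite edgeC //.
  by rewrite -nx cyc_next.
by rewrite -nx walk_next.
Qed.

End Faces.

(** * Minimal discs *)

Section GoodDiscs.
Variable G : planeMap.
Implicit Types (u v w : G) (p : G * G) (S A B : {set G * G}) (k s : seq G).

Lemma link_rot i k : uniq k -> link (rot i k) =2 link k.
Proof. by move=> uk u w; rewrite /link !mem_rot !next_rot. Qed.

Lemma link_rev k : uniq k -> link (rev k) =2 link k.
Proof.
move=> uk u w; rewrite /link !mem_rev !next_rev //.
have E x y : (x \in k) && (prev k x == y) = (y \in k) && (next k y == x).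
  apply/andP/andP => -[xk /eqP <-]; rewrite ?mem_prev ?mem_next xk.
    by rewrite next_prev ?eqxx.
  by rewrite prev_next ?eqxx.
by rewrite !E orbC.
Qed.

Lemma cyc_rot i k : cyc k -> cyc (rot i k).
Proof. by rewrite /cyc rot_uniq rot_cycle size_rot. Qed.

Lemma cyc_rev k : cyc k -> cyc (rev k).
Proof.
case/and3P=> uk ck sz; rewrite /cyc rev_uniq uk size_rev sz andbT /=.
by rewrite rev_cycle (eq_cycle (e' := edge)) // => x y; rewrite edgeC.
Qed.

Lemma bounds_link S k k' : link k =2 link k' -> bounds S k -> bounds S k'.
Proof. by move=> E [rS bS]; split => // p pD; rewrite -E bS. Qed.

(** In a cycle of length at most 5 a chord would cut off a triangle. *)
Lemma no_chord k a b : cyc k -> size k <= 5 -> a \in k -> b \in k -> edge a b -> link k a b.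
Proof.
move=> ck sz ak bk ab; have uk := cyc_uniq ck; have [i k' kE] := rot_to ak.
rewrite -(link_rot i uk); move: ck sz bk; rewrite -(mem_rot i) -(size_rot i k) => /(cyc_rot i).
rewrite kE; case: k' {kE} => [|x [|y [|z [|t [|? ?]]]]] // ck sz;
  move: (ck) => /and3P[us es // _].
- move: es; rewrite /= => /and4P[ax xy ya _]; case: (no_triangle ax xy).
  by rewrite edgeC.
- have [na nx ny nz] := next4 us; move: es; rewrite /= => /and5P[ax xy yz za _].
  rewrite !inE => /or4P[] /eqP E; subst b; rewrite /link ?na ?nx ?ny ?nz ?inE ?eqxx ?orbT //.
    by rewrite edge_irr in ab.
  by case: (no_triangle ax xy ab).
- have [na nx ny nz nt] := next5 us; move: es; rewrite /= => /and5P[ax xy yz zt /andP[ta _]].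
  rewrite !inE => /or4P[|||/orP[]] /eqP E; subst b;
    rewrite /link ?na ?nx ?ny ?nz ?nt ?inE ?eqxx ?orbT //.
  + by rewrite edge_irr in ab.
  + by case: (no_triangle ax xy ab).
  + by case: (no_triangle ab zt); rewrite edgeC.
Qed.

(** Otherwise D darts would allow at most D/6 faces and D/3 vertices, against 2V + 2F = D + 4. *)
Lemma short_face : exists2 p, p \in darts G & flen p <= 5.
Proof.
have rD : region (darts G) by split=> // p; rewrite next_darts.
have [/existsP[p /andP[]]|/existsPn long] := boolP [exists p in darts G, flen p <= 5].
  by exists p.
have F6 : nfaces (darts G) * 6 <= #|darts G|.
  rewrite card_region // -sum_nat_const; apply: leq_sum => p.
  by rewrite inE => /andP[pD _]; have := long p; rewrite pD /= -ltnNge.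
have V3 : #|ivert G| * 3 <= #|darts G|.
  by rewrite card_darts -sum_nat_const; apply: leq_sum => v _; apply: deg_gt2.
by have := euler G; move: (nfaces _) #|_| #|_| F6 V3; lia.
Qed.

(* A hexagon around one vertex may be divided into three 4-faces only, each with
   two consecutive edges of k; the discharging has no answer to this case. *)
Record good A k : Prop := Good {
  good_cyc : cyc k;
  good_size : size k <= 6;
  good_sub : {subset k <= ivert G};
  good_bounds : bounds A k;
  good_int : interior A k != set0;
  good_six : size k = 6 -> 1 < #|interior A k| }.

(** The disc is everything outside a face of length 4 or 5. A vertex of that face has a third
    neighbour, which by [no_chord] is off the face and so lies inside the disc. *)
Lemma exists_good : exists A k, good A k.
Proof.
have [[a b] pD fl] := short_face; have ab := dartP pD; rewrite /= in ab.
have [k [kw ak sz]] : exists k, [/\ facial_walk (@edge G) turn k, a \in k & size k <= 5].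
  have := flen_gt3 pD; case E: (flen _) fl => [|[|[|[|[|[|?]]]]]] // _ _.
    by have [c [d fw]] := facial_walk4 ab E; exists [:: a; b; c; d]; rewrite inE eqxx.
  by have [c [d [e fw]]] := facial_walk5 ab E; exists [:: a; b; c; d; e]; rewrite inE eqxx.
have ck := facial_walk_cyc kw; have uk := cyc_uniq ck.
have sub : {subset k <= ivert G}.
  by apply: cyc_ivert ck ak _; move: pD; rewrite !inE => /andP[].
exists (darts G :\: walk k), k.
split => //; first exact: leq_trans sz _; last by move: sz => /[swap] ->.
  exact/boundsC/facial_walk_bounds.
have [w aw wk] : exists2 w, edge a w & w \notin k.
  have [/existsP[w /andP[]]|/existsPn H] := boolP [exists w, edge a w && (w \notin k)].
    by exists w.
  have sub2 : [set w | edge a w] \subset [set next k a; prev k a].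
    apply/subsetP => w; rewrite !inE => aw; have := H w; rewrite aw /= negbK => wk.
    have /orP[/andP[_ /eqP ->]|/andP[_ /eqP E]] := no_chord ck sz ak wk aw.
      by rewrite eqxx.
    by rewrite -E prev_next // eqxx orbT.
  have := leq_trans (@deg_gt2 G a) (subset_leq_card sub2).
  by rewrite cards2; case: (_ != _).
apply/set0Pn; exists w; apply: (@interior_mem _ _ _ w a) (wk) _.
  by apply: regionC; case: (facial_walk_bounds kw sub).
left; rewrite in_setD; apply/andP; split; first by rewrite inE /= (negPf wk).
rewrite inE /= [edge w a]edgeC aw /=.
have := sub _ ak; rewrite inE => ra; exact: connect_trans ra (connect1 aw).
Qed.

(** Minimality is in the number of darts and over all good discs, whatever their rims, so neither an
    inner cycle nor the removal of a face can leave a good disc. *)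
Definition minimal_disc A s := good A s /\ forall A' s', good A' s' -> #|A| <= #|A'|.

Lemma exists_minimal_disc : exists A s, minimal_disc A s.
Proof.
have [A [s gA]] := exists_good.
have [n] := ubnP #|A|; elim: n A s gA => // n IH A s gA leA.
have [[A' [s' [gA' lt]]]|H] := classic (exists A' s', good A' s' /\ #|A'| < #|A|).
  by apply: (IH A' s') => //; lia.
exists A, s; split=> // A' s' gA'; rewrite leqNgt; apply/negP => lt.
by apply: H; exists A', s'.
Qed.

(** With no vertex inside and no chord, every dart of [S] runs along [k], so tracing a face in [S]
    follows [k] in one of its two directions. *)
Lemma empty_facial S k : cyc k -> {subset k <= ivert G} -> bounds S k ->
  interior S k = set0 -> (forall a b, a \in k -> b \in k -> edge a b -> link k a b) ->
  facial edge turn k.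
Proof.
move=> ck sub bS int0 nochord; have [rS _] := bS; have uk := cyc_uniq ck.
have memk u w : (u, w) \in S -> u \in k /\ w \in k.
  move=> uw; split; apply: contraT => nk.
    by have := interior_mem rS nk (or_introl uw); rewrite int0 inE.
  by have := interior_mem rS nk (or_intror uw); rewrite int0 inE.
have aux l : cyc l -> link l =2 link k -> l =i k ->
    forall a, a \in l -> (a, next l a) \in S -> facial_walk edge turn l.
  move=> cl lE lk a al aS; have ul := cyc_uniq cl.
  have step x : x \in l -> (x, next l x) \in S ->
      turn (next l x) x = next l (next l x) /\ (next l x, next l (next l x)) \in S.
    move=> xl xS; set y := next l x; have xy : edge x y := cyc_next cl xl.
    have tS : (y, turn y x) \in S by rewrite region_turn.
    have [yk tk] := memk _ _ tS; have yt : edge y (turn y x) by rewrite turn_edge // edgeC.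
    suff E : turn y x = next l y by rewrite -E.
    have := nochord _ _ yk tk yt; rewrite -lE => /orP[/andP[_ /eqP //]|/andP[_ /eqP E]].
    have := turn_neq (_ : edge y x); rewrite edgeC => /(_ xy)/eqP[].
    by rewrite -[LHS](prev_next ul) E /y prev_next.
  have all x : x \in l -> (x, next l x) \in S.
    apply: (@cyc_ind _ _ (fun x => (x, next l x) \in S) _ cl al aS) => b bl.
    by case/(step b bl).
  split; first by case/and3P: cl.
  split=> // x xl; split; first exact: cyc_next.
  by rewrite /face_step /=; have [-> _] := step x xl (all x xl).
have /set0Pn[[a b] abS] := bounds_nonempty ck sub bS.
have [ak bk] := memk _ _ abS.
have /orP[/andP[_ /eqP E]|/andP[_ /eqP E]] := nochord _ _ ak bk (region_edge rS abS).
  by left; apply: aux ak _ => //; rewrite E.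
have rk : rev k =i k by move=> x; rewrite mem_rev.
right; apply: (aux _ (cyc_rev ck) (link_rev uk) rk a); rewrite ?mem_rev //.
by rewrite next_rev // -E prev_next // E.
Qed.

(* The part of a side of k that lies outside of s is empty or everything outside s. *)
Lemma inner_cycle A s k : cyc s -> {subset s <= ivert G} -> bounds A s -> cyc k ->
  (forall a, a \in k -> (a, next k a) \in A \/ (next k a, a) \in A) ->
  (exists2 v, v \in k & v \notin s) ->
  exists S, bounds S k /\ S \proper A.
Proof.
move=> cs ss bA ck kA [v vk vs]; have [rA bdA] := bA.
have dA u w : (u, w) \in A \/ (w, u) \in A -> (u, w) \in darts G.
  by case=> /(region_dart rA) //; rewrite -flip_darts.
have ks : {subset k <= ivert G}.
  apply: (cyc_ivert ck vk); have := dA _ _ (kA v vk).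
  by rewrite !inE => /andP[].
have linkA p : link k p.1 p.2 -> p \in A \/ flip p \in A.
  case: p => x y /orP[]/andP[/= xk /eqP <-]; first exact: kA.
  by rewrite /flip /=; case: (kA y xk); auto.
have proper S : bounds S k -> S \subset A -> S \proper A.
  move=> [rS bS] sub; rewrite properEneq sub andbT; apply/eqP => E.
  have pD : (v, next k v) \in darts G by apply/dA/kA.
  have := bS _ pD; rewrite E bdA //= /link vk eqxx /= (negPf vs) /= => /andP[nk].
  move=> /eqP E'; have := cyc_next cs nk; rewrite E' => _.
  by move: vs; rewrite -E' mem_next nk.
have [S bS] := cycle_bounds ck ks; have [rS bdS] := bS.
set B := darts G :\: A; have bB : bounds B s := boundsC bA; have [rB bdB] := bB.
(* No edge of [k] has [B] on both sides, so the boundary of [D] can only lie on [s]. *)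
pose D := S :&: B.
have DE p : (p \in D) = (p \in S) && (p \in B) by rewrite inE.
have rD : region D.
  split; first by apply/subsetP => p; rewrite DE => /andP[/(region_dart rS)].
  by move=> p; rewrite !DE; case: rS => _ ->; case: rB => _ ->.
have BE p : p \in darts G -> (p \in B) = (p \notin A) by move=> pD; rewrite inE pD andbT.
have flipB p : p \in darts G -> (flip p \in B) = (flip p \notin A).
  by move=> pD; rewrite BE // flip_darts.
have [|D0|Dk] := sub_boundary cs rD.
- move=> p pD; rewrite -bdB // /boundary !DE.
  case lk: (link k p.1 p.2).
    by have [pA|pA] := linkA _ lk; rewrite (BE p) // flipB // pA /= ?andbF ?addbF ?addFb;
      case: (_ \in S) => //= ->.
  have := bdS p pD; rewrite lk /boundary.
  by case: (p \in S); case: (flip p \in S) => //=; rewrite !andbT.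
- have [|DD|DD] := region_no_boundary rD; first by move=> p /D0->.
    exists S; split => //; apply: proper => //; apply/subsetP => p pS.
    apply: contraT => pA; have := DE p; rewrite DD inE pS BE ?pA //.
    exact: region_dart rS pS.
  have /set0Pn[p pA] := bounds_nonempty cs ss bA.
  have := DE p; rewrite DD (region_dart rA pA) BE ?(region_dart rA pA) //.
  by rewrite pA andbF.
- have [E|E] : D = B \/ D = darts G :\: B by apply: (@bounds_eq _ _ _ s).
    exists (darts G :\: S); split; first exact: boundsC.
    apply: proper; first exact: boundsC.
    apply/subsetP => p; rewrite inE => /andP[pS pD]; apply: contraT => pA.
    by have := DE p; rewrite E BE // pA (negPf pS).
  have /set0Pn[p pA] := bounds_nonempty cs ss bA.
  have pD := region_dart rA pA.
  by have := DE p; rewrite E inE BE // pD pA andbF.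
Qed.

End GoodDiscs.

(** * Facial cycles with a common corner *)

Section Facial.
Variable G : planeMap.
Implicit Types (a b c d e f u v w : G) (k : seq G).

Lemma facial_walk_rot i k : facial_walk (@edge G) turn k -> facial_walk edge turn (rot i k).
Proof.
case=> sz [uk fk]; split; first by rewrite size_rot.
split; first by rewrite rot_uniq.
by move=> x; rewrite mem_rot !next_rot //; apply: fk.
Qed.

Lemma facial_rev k : facial (@edge G) turn k -> facial edge turn (rev k).
Proof. by case=> fk; [right; rewrite revK | left]. Qed.

Lemma facial_rot i k : facial (@edge G) turn k -> facial edge turn (rot i k).
Proof.
case=> fk; first by left; apply: facial_walk_rot.
right; rewrite rev_rot /rotr.
exact: facial_walk_rot.
Qed.

Lemma facial_cyc k : facial (@edge G) turn k -> cyc k.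
Proof.
by case=> /facial_walk_cyc // /cyc_rev; rewrite revK.
Qed.

Lemma facial_orient k : facial (@edge G) turn k -> exists l,
  [/\ facial_walk (@edge G) turn l, l =i k, size l = size k & link l =2 link k].
Proof.
move=> fk; case: (fk) => fw; [by exists k | exists (rev k); split=> //].
- by move=> x; rewrite mem_rev.
- by rewrite size_rev.
- exact/link_rev/cyc_uniq/facial_cyc.
Qed.

Lemma facial_walk4_edges a b c d : facial_walk (@edge G) turn [:: a; b; c; d] ->
  [/\ edge a b, edge b c, edge c d & edge d a].
Proof. by move/facial_walk_cyc/and3P => [_ /= /and5P[? ? ? ? _]]. Qed.

(** Both walks iterate [next_dart] from the same dart. *)
Lemma facial_walk_sub k l a : facial_walk (@edge G) turn k -> facial_walk (@edge G) turn l ->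
  a \in k -> a \in l -> next k a = next l a -> {subset k <= l}.
Proof.
move=> fk fl ak al E x; have uk := cyc_uniq (facial_walk_cyc fk).
rewrite -(fconnect_cycle (cycle_next uk) ak) => /iter_findex <-.
have it m : facial_walk (@edge G) turn m -> a \in m -> forall n,
    iter n (next m) a \in m /\
    iter n (@next_dart G) (a, next m a) = (iter n (next m) a, iter n.+1 (next m) a).
  case=> _ [um fm] am; elim=> [|n [mn IH]] //; split; first by rewrite /= mem_next.
  rewrite [LHS]/= IH /=; have [e [E']] := fm _ mn; rewrite next_dartE //.
  by rewrite E'.
have [_ Ek] := it k fk ak (findex (next k) a x).
have [nl El] := it l fl al (findex (next k) a x).
by move: Ek; rewrite E El => -[<-].
Qed.

(** The corner [a b c] belongs to one face only: two faces there would give both [turn b a = c] and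
    [turn b c = a], so that [b] had degree 2. Applied to a face and a second short cycle that shares
    a corner with it, this rules the cycle out. *)
Lemma facial_share k1 k2 a b c : facial (@edge G) turn k1 -> facial (@edge G) turn k2 ->
  a != c -> link k1 a b -> link k1 b c -> link k2 a b -> link k2 b c ->
  k1 =i k2 /\ size k1 = size k2.
Proof.
move=> f1 f2 ac l1a l1c l2a l2c.
have orient k : facial (@edge G) turn k -> link k a b -> link k b c ->
    exists l, [/\ facial_walk (@edge G) turn l, l =i k, size l = size k &
      (a \in l /\ next l a = b /\ turn b a = c) \/ (c \in l /\ next l c = b /\ turn b c = a)].
  move=> fk la lc.
  have [l [fl lk sl ll]] := facial_orient fk.
  exists l; split=> //; rewrite -ll in la; rewrite -ll in lc.
  have ul := cyc_uniq (facial_walk_cyc fl); have [_ [_ fl']] := fl.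
  have [bl cl] := link_mem lc; have [al _] := link_mem la.
  case/orP: la => /andP[_ /eqP E1]; case/orP: lc => /andP[_ /eqP E2].
  - by left; split=> //; split=> //; rewrite -E2 -E1; have [_ [->]] := fl' a al.
  - by case/eqP: ac; rewrite -(prev_next ul a) E1 -E2 prev_next.
  - by case/eqP: ac; rewrite -E1 E2.
  - by right; split=> //; split=> //; rewrite -E1 -E2; have [_ [->]] := fl' c cl.
have ab := link_edge (facial_cyc f1) l1a; have bc := link_edge (facial_cyc f1) l1c.
have [l [fl lk sl H1]] := orient _ f1 l1a l1c.
have [m [fm mk sm H2]] := orient _ f2 l2a l2c.
suff E : l =i m.
  have E' : k1 =i k2 by move=> x; rewrite -lk -mk.
  split=> //; rewrite -sl -sm; apply/perm_size/uniq_perm => //.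
    exact/cyc_uniq/facial_walk_cyc.
  exact/cyc_uniq/facial_walk_cyc.
have bot : turn b a = c -> turn b c = a -> False.
  by move=> E1 E2; have := @turn2_neq G b a; rewrite edgeC ab E1 E2 eqxx => /(_ isT).
case: H1 => -[i1 [n1 t1]]; case: H2 => -[i2 [n2 t2]]; try by case: bot.
  by move=> x; apply/idP/idP; apply: (@facial_walk_sub _ _ a) => //; rewrite n1 n2.
by move=> x; apply/idP/idP; apply: (@facial_walk_sub _ _ c) => //; rewrite n1 n2.
Qed.

Lemma link4 a b c d (k := [:: a; b; c; d]) : uniq k ->
  [/\ link k a b, link k b c, link k c d & link k d a].
Proof.
move=> uk; have [na nb nc nd] := next4 uk.
by split; rewrite /link ?(na, nb, nc, nd) !inE !eqxx ?orbT.
Qed.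

Lemma link5 a b c d e (k := [:: a; b; c; d; e]) : uniq k ->
  [/\ link k a b, link k b c, link k c d, link k d e & link k e a].
Proof.
move=> uk; have [na nb nc nd ne] := next5 uk.
by split; rewrite /link ?(na, nb, nc, nd, ne) !inE !eqxx ?orbT.
Qed.

Lemma link6 a b c d e f (k := [:: a; b; c; d; e; f]) : uniq k ->
  [/\ link k a b, link k b c & link k c d] /\ [/\ link k d e, link k e f & link k f a].
Proof.
move=> uk; have [[na nb nc] [nd ne nf]] := next6 uk.
by do ![split]; rewrite /link ?(na, nb, nc, nd, ne, nf) !inE !eqxx ?orbT.
Qed.

Lemma cyc4 a b c d : edge a b -> edge b c -> edge c d -> edge d a -> a != c -> b != d ->
  cyc [:: a; b; c; d].
Proof.
move=> ab bc cd da ac bd; rewrite /cyc /= ab bc cd da !inE !negb_or ac bd !edge_neq //.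
by rewrite edgeC.
Qed.

Lemma cyc5 a b c d e : edge a b -> edge b c -> edge c d -> edge d e -> edge e a ->
  cyc [:: a; b; c; d; e].
Proof.
move=> ab bc cd de ea; have ae : edge a e by rewrite edgeC.
have ac : a != c by apply/eqP => E; subst c; apply: (no_triangle ae (b := e)) cd; rewrite edgeC.
have ad : a != d by apply/eqP => E; subst d; apply: (no_triangle ab bc); rewrite edgeC.
have bd : b != d by apply/eqP => E; subst d; apply: (no_triangle ea ab); rewrite edgeC.
have be : b != e by apply/eqP => E; subst e; apply: (no_triangle bc cd); rewrite edgeC.
have ce : c != e by apply/eqP => E; subst e; apply: (no_triangle ab bc).
by rewrite /cyc /= ab bc cd de ea !inE !negb_or ac ad bd be ce !edge_neq.
Qed.

Lemma cyc6 a b c d e f : edge a b -> edge b c -> edge c d -> edge d e -> edge e f -> edge f a ->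
  a != c -> b != d -> c != e -> d != f -> e != a -> f != b ->
  cyc [:: a; b; c; d; e; f].
Proof.
move=> ab bc cd de ef fa ac bd ce df ea fb.
have ad : a != d by apply/eqP => E; subst d; apply: (no_triangle ab bc); rewrite edgeC.
have be : b != e by apply/eqP => E; subst e; apply: (no_triangle bc cd); rewrite edgeC.
have cf : c != f by apply/eqP => E; subst f; apply: (no_triangle cd de); rewrite edgeC.
rewrite /cyc /= ab bc cd de ef fa !inE !negb_or ac ad bd be ce cf df.
by rewrite [a == e]eq_sym [b == f]eq_sym ea fb !edge_neq // edgeC.
Qed.

Lemma deg3_nbr v a b c w : deg edge v = 3 -> edge v a -> edge v b -> edge v c ->
  a != b -> a != c -> b != c -> edge v w -> [|| w == a, w == b | w == c].
Proof.
move=> d3 va vb vc ab ac bc vw.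
have sub : [set a; b; c] \subset [set w | edge v w].
  by apply/subsetP => x; rewrite !inE => /orP[/orP[]|] /eqP->.
have c3 : #|[set a; b; c]| = 3.
  by rewrite -setUA cardsU1 cards2 !inE negb_or ab ac bc.
have : [set a; b; c] == [set w | edge v w] by rewrite eqEcard sub c3 -d3 leqnn.
by move=> /eqP/setP/(_ w); rewrite !inE vw -orbA.
Qed.

Lemma third_nbr v a b : edge v a -> edge v b -> a != b ->
  exists c, [/\ edge v c, c != a & c != b].
Proof.
move=> va vb ab.
have /subsetPn[c] : ~~ ([set w | edge v w] \subset [set a; b]).
  apply/negP => /subset_leq_card; rewrite cards2 ab leqNgt.
  by have := @deg_gt2 G v; rewrite /deg => ->.
by rewrite !inE negb_or => vc /andP[ca cb]; exists c.
Qed.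

End Facial.

(** The hypothetical counterexample, bundled so that it can be used wherever its plane map is
    expected. *)
Record insecureDisc := InsecureDisc {
  disc_map :> planeMap;
  disc : {set disc_map * disc_map};
  rim : seq disc_map;
  disc_min : minimal_disc disc rim;
  insecure : ~ has_secure_multigram (@edge disc_map) turn }.

(** * Short cycles inside a minimal disc *)

Section Interior.
Variable G : insecureDisc.
Implicit Types (a b c d e f u v w : G) (k : seq G).

Definition inn v := v \in interior (disc G) (rim G).
(* The edge uw lies in the closed disc. *)
Definition cl u w := ((u, w) \in disc G) || ((w, u) \in disc G).
(* Vertices of the rim may have arbitrary neighbours outside of the disc, so they
   are treated like big ones. *)
Definition big_or_rim v := big edge v || (v \in rim G).
Local Notation bs := big_or_rim.

Lemma disc_good : good (disc G) (rim G). Proof. by case: (disc_min G). Qed.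
Lemma disc_bounds : bounds (disc G) (rim G). Proof. exact: good_bounds disc_good. Qed.
Lemma disc_region : region (disc G). Proof. by case: disc_bounds. Qed.

Lemma clC u w : cl u w = cl w u. Proof. by rewrite /cl orbC. Qed.

Lemma cl_edge u w : cl u w -> edge u w.
Proof. by move=> /orP[] /(region_edge disc_region) //; rewrite edgeC. Qed.

Lemma inn_dart v w : inn v -> edge v w -> (v, w) \in disc G /\ (w, v) \in disc G.
Proof. by move=> iv vw; have [_] := interiorP disc_bounds iv; apply. Qed.

Lemma inn_cl v w : inn v -> edge v w -> cl v w.
Proof. by move=> iv vw; rewrite /cl; have [-> _] := inn_dart iv vw. Qed.

Lemma cl_inn u w : cl u w -> w \notin rim G -> inn w.
Proof. by move=> /orP c wr; apply: (interior_mem disc_region wr (u := u)); case: c; auto. Qed.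

Lemma inn_nrim v : inn v -> v \notin rim G.
Proof. by move=> iv; have [] := interiorP disc_bounds iv. Qed.

Lemma nbs_small v : ~~ bs v -> small edge v.
Proof. by rewrite negb_or /big /small -ltnNge => /andP[]. Qed.

Lemma nbs_nrim v : ~~ bs v -> v \notin rim G.
Proof. by rewrite negb_or => /andP[]. Qed.

Lemma nbs_inn v w : inn v -> edge v w -> ~~ bs w -> inn w.
Proof. by move=> iv vw nw; apply: cl_inn (inn_cl iv vw) (nbs_nrim nw). Qed.

Lemma facial_cl k v : facial edge turn k -> v \in k -> inn v ->
  forall a b, link k a b -> cl a b.
Proof.
move=> fk vk iv; have uk := cyc_uniq (facial_cyc fk).
have [l [fl lm _ ll]] := facial_orient fk; have lk : v \in l by rewrite lm.
have cyl := facial_walk_cyc fl; have [_ [_ fl']] := fl.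
have all x : x \in l -> (x, next l x) \in disc G.
  apply: (@cyc_ind _ _ (fun x => (x, next l x) \in disc G) _ cyl lk); first by
    have [] := inn_dart iv (cyc_next cyl lk).
  move=> b bl bA; have [e [<-]] := fl' b bl.
  by rewrite region_turn //; exact: disc_region.
move=> a b; rewrite -ll => /orP[]/andP[xl /eqP <-]; by rewrite /cl (all _ xl) ?orbT.
Qed.

(** By [inner_cycle] the cycle cuts off a proper part of the disc. With a vertex inside and length
    at most 5 this part would be a smaller good disc. *)
Lemma inner_cyc k : cyc k -> (exists2 v, v \in k & inn v) ->
  (forall a, a \in k -> cl a (next k a)) ->
  exists S, [/\ bounds S k, {subset k <= ivert G}, S \proper disc G & size k <= 5 -> interior S k = set0].
Proof.
move=> ck [v vk iv] ckl; have gA := disc_good; have [_ mA] := disc_min G.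
have sub : {subset k <= ivert G}.
  apply: cyc_ivert (vk) _ => //; have [vA _] := inn_dart iv (cyc_next ck vk).
  by have := region_dart disc_region vA; rewrite !inE => /andP[].
have [S [bS pS]] : exists S, bounds S k /\ S \proper disc G.
  apply: (inner_cycle (good_cyc gA) (good_sub gA) (good_bounds gA) ck).
    by move=> a ak; apply/orP/ckl.
  by exists v; rewrite ?inn_nrim.
exists S; split=> // sz; apply/eqP/negPn/negP => i0.
have := mA S k; rewrite leqNgt (proper_card pS) => H; suff /H : good S k by [].
by split=> //; [exact: leq_trans sz _ | move: sz => /[swap] ->].
Qed.

(** As in [inner_cyc], up to the hexagon around a single vertex that [good_six] excludes from good
    discs. *)
Lemma six_cyc k : cyc k -> size k = 6 -> (exists2 v, v \in k & inn v) ->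
  (forall a, a \in k -> cl a (next k a)) ->
  exists S, [/\ bounds S k, {subset k <= ivert G} & #|interior S k| <= 1].
Proof.
move=> ck sz ki ckl; have [S [bS sub pS _]] := inner_cyc ck ki ckl.
exists S; split=> //; rewrite leqNgt; apply/negP => i2; have [_ mA] := disc_min G.
have := mA S k; rewrite leqNgt (proper_card pS) => H; suff /H : good S k by [].
split=> //; first by rewrite sz.
by rewrite -card_gt0; lia.
Qed.

Lemma short_facial k : cyc k -> size k <= 5 -> (exists2 v, v \in k & inn v) ->
  (forall a, a \in k -> cl a (next k a)) -> facial edge turn k.
Proof.
move=> ck sz ki ckl; have [S [bS sub pS i0]] := inner_cyc ck ki ckl.
apply: (empty_facial ck sub bS (i0 sz)) => a b; exact: no_chord.
Qed.

Lemma four_facial a b c d : inn a -> edge a b -> cl b c -> cl c d -> edge d a -> a != c ->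
  b != d -> facial edge turn [:: a; b; c; d].
Proof.
move=> ia ab bc cd da ac bd.
have ck := cyc4 ab (cl_edge bc) (cl_edge cd) da ac bd.
have [na nb nc nd] := next4 (cyc_uniq ck).
apply: short_facial => //; first by exists a; rewrite ?inE ?eqxx.
move=> x; rewrite !inE => /or4P[] /eqP->; rewrite ?(na, nb, nc, nd) //.
  exact: inn_cl.
by rewrite clC inn_cl // edgeC.
Qed.

Lemma five_facial a b c d e : inn a -> edge a b -> cl b c -> cl c d -> cl d e -> edge e a ->
  facial edge turn [:: a; b; c; d; e].
Proof.
move=> ia ab bc cd de ea.
have ck := cyc5 ab (cl_edge bc) (cl_edge cd) (cl_edge de) ea.
have [na nb nc nd ne] := next5 (cyc_uniq ck).
apply: short_facial => //; first by exists a; rewrite ?inE ?eqxx.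
move=> x; rewrite !inE => /or4P[|||/orP[]] /eqP->; rewrite ?(na, nb, nc, nd, ne) //.
  exact: inn_cl.
by rewrite clC inn_cl // edgeC.
Qed.

Lemma six_region a b c d e f (k := [:: a; b; c; d; e; f]) : inn a ->
  edge a b -> cl b c -> cl c d -> cl d e -> cl e f -> edge f a ->
  a != c -> b != d -> c != e -> d != f -> e != a -> f != b ->
  cyc k /\ exists S, [/\ bounds S k, {subset k <= ivert G} & #|interior S k| <= 1].
Proof.
move=> ia ab bc cd de ef fa ac bd ce df ea fb.
have ck : cyc k.
  exact: cyc6 ab (cl_edge bc) (cl_edge cd) (cl_edge de) (cl_edge ef) fa ac bd ce df ea fb.
split=> //; have [[na nb nc] [nd ne nf]] := next6 (cyc_uniq ck).
apply: six_cyc => //; first by exists a; rewrite ?inE ?eqxx.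
move=> x; rewrite !inE => /or4P[|||/or3P[]] /eqP->; rewrite ?(na, nb, nc, nd, ne, nf) //.
  exact: inn_cl.
by rewrite clC inn_cl // edgeC.
Qed.

End Interior.

(** * Local structure of a minimal disc *)

Section Multigrams.
Variable G : insecureDisc.
Implicit Types (a b c d e f u v w x y : G) (k : seq G).
Local Notation bs := (@big_or_rim G).

Lemma in_cycle2 k x y z : @link G k x y -> link k y z -> in_cycle k x [:: y; z].
Proof.
move=> xy yz; have [xk yk] := link_mem xy; have [_ zk] := link_mem yz.
rewrite /in_cycle /= xk yk zk /= andbT.
have E u w : link k u w -> (next k u == w) || (next k w == u).
  by case/orP=> /andP[_ ->]; rewrite ?orbT.
by rewrite !E.
Qed.

Lemma linkW k u w : link k u w -> link k w u. Proof. by rewrite linkC. Qed.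

(** A path of length at most 3 from [v] to [d] off the face runs through [c] and closes up through
    [a] to a 4- or 5-cycle in the disc. That cycle is facial and shares the corner [v a d] with the
    given face, against [facial_share]. The last hypothesis serves twice: it yields the 4-faces at
    big neighbours of [c], and it excludes a path whose last edge might leave the disc. *)
Lemma insecure_tetragram v a d b c : inn v -> deg edge v = 3 ->
  facial edge turn [:: v; a; d; b] -> edge v c -> c != a -> c != b -> ~~ bs c ->
  (bs d -> forall w, edge c w -> bs w -> cl w a || cl w b) -> False.
Proof.
move=> iv d3 fk vc ca cb nc exempt.
have ck := facial_cyc fk; have uk := cyc_uniq ck.
have [va ad db bv] : [/\ edge v a, edge a d, edge d b & edge b v].
  by case/and3P: ck => _ /= /and5P[? ? ? ? _] _.
have [l1 l2 l3 l4] := link4 uk.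
have [c1 c2 c3 c4] : [/\ cl v a, cl a d, cl d b & cl b v].
  by split; apply: (facial_cl fk _ iv); rewrite ?inE ?eqxx.
have vb : edge v b by rewrite edgeC.
have [vd ab] : v != d /\ a != b.
  by move: uk; rewrite /= !inE !negb_or => /and4P[/and3P[_ ? _] /andP[_ ?] _ _].
have ic := nbs_inn iv vc nc.
have nbr x : edge v x -> [|| x == a, x == b | x == c].
  by apply: deg3_nbr; rewrite // eq_sym.
have nvd : ~~ edge v d by apply/negP => vd'; apply: (no_triangle va ad).
have cd : c != d by apply: contraNneq nvd => <-.
have bad k2 : c \in k2 -> [:: v; a; d; b] =i k2 -> False.
  move=> cin E; move: cin; rewrite -E !inE (negPf ca) (negPf cb) (negPf cd) !orbF.
  by rewrite eq_sym (negPf (edge_neq vc)).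
case: (@insecure G); constructor 2; exists v, a, d, b; split; first exact: fk.
split; rewrite ?d3 //; last 2 first.
- by rewrite /small d3.
- move=> x vx xa xb; have /or3P[] := nbr x vx; rewrite ?(negPf xa) ?(negPf xb) // => /eqP->.
  split; first exact: nbs_small.
  case bd: (big edge d); last by left; rewrite /small ltnNge -/(big edge d) bd.
  right=> w cw; case bw: (big edge w); last by constructor 1; rewrite /small ltnNge -/(big edge w) bw.
  have vw : v != w by apply: contraTneq bw => <-; rewrite /big d3.
  have := exempt; rewrite /big_or_rim bd => /(_ isT w cw); rewrite bw => /(_ isT) /orP[wa|wb].
    constructor 2; apply: four_facial iv va _ _ _ vw _; rewrite ?[cl a w]clC //.
    - by rewrite clC inn_cl.
    - by rewrite edgeC.
    - by rewrite eq_sym.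
  constructor 3; apply: four_facial iv vb _ _ _ vw _; rewrite ?[cl b w]clC //.
  - by rewrite clC inn_cl.
  - by rewrite edgeC.
  - by rewrite eq_sym.
move=> [|x [|y [|z [|? ?]]]] // /and4P[ps us ls _] _; move: ps us ls; rewrite /= ?andbT.
- by move=> _ _ /eqP E; rewrite E eqxx in vd.
- by move=> vx _ /eqP E; rewrite -E vx in nvd.
- move=> /andP[vx xy] _ /eqP E; subst y.
  have /or3P[] := nbr x vx => /eqP E; subst x.
  + exact: in_cycle2 l1 l2.
  + by apply: (@in_cycle2 _ v b d); rewrite linkC.
  have f2 : facial edge turn [:: v; c; d; a].
    apply: four_facial iv vc _ _ _ vd ca; first exact: inn_cl.
      by rewrite clC.
    by rewrite edgeC.
  have [m1 m2 m3 m4] := link4 (cyc_uniq (facial_cyc f2)).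
  have [E _] := facial_share fk f2 vd l1 l2 (linkW m4) (linkW m3).
  by case: (bad _ _ E); rewrite ?inE ?eqxx ?orbT.
- move=> /and3P[vx xy yz] _ /eqP E; subst z.
  have /or3P[] := nbr x vx => /eqP E; subst x.
  + by case: (no_triangle xy yz ad).
  + by case: (no_triangle xy yz); rewrite edgeC.
  have cy : cl c y by apply: inn_cl.
  (* Only an edge between two rim vertices can lie outside the disc; then the last hypothesis puts
     [y] next to [a] or [b], which makes a triangle. *)
  have yd : cl y d.
    case yr: (y \in rim G); last by apply: inn_cl yz; apply: cl_inn cy _; rewrite yr.
    case dr: (d \in rim G); last first.
      by rewrite clC; apply: inn_cl; [apply: cl_inn c2 _; rewrite dr | rewrite edgeC].
    have := exempt; rewrite /big_or_rim dr orbT => /(_ isT y xy); rewrite yr orbT => /(_ isT).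
    case/orP=> /cl_edge ye; first by case: (no_triangle ye ad yz).
    by case: (no_triangle ye _ yz); rewrite edgeC.
  have f2 : facial edge turn [:: v; c; y; d; a].
    apply: five_facial iv vc cy yd _ _; first by rewrite clC.
    by rewrite edgeC.
  have [m1 m2 m3 m4 m5] := link5 (cyc_uniq (facial_cyc f2)).
  by have [_] := facial_share fk f2 vd l1 l2 (linkW m5) (linkW m4).
Qed.

(** As for tetragrams: a second path of length at most 3 from [a] to [c] would close up through [b]
    to a 4- or 5-face sharing the corner [a b c] with the hexagon. *)
Lemma insecure_hexagram a b c d e f g : inn a -> deg edge a = 3 ->
  facial edge turn [:: a; b; c; d; e; f] -> ~~ bs c -> ~~ bs f ->
  edge a g -> g != b -> g != f -> ~~ bs g -> False.
Proof.
move=> ia d3 fk nc nf ag gb gf ng.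
have ck := facial_cyc fk; have uk := cyc_uniq ck.
have [ab bc fa] : [/\ edge a b, edge b c & edge f a].
  by case/and3P: ck => _ /= /and5P[? ? ? ? /and3P[? ? _]] _.
have [[l1 l2 l3] [l4 l5 l6]] := link6 uk.
have af : edge a f by rewrite edgeC.
have clk u w : link [:: a; b; c; d; e; f] u w -> cl u w.
  by apply: (facial_cl fk _ ia); rewrite ?inE ?eqxx.
have ic := cl_inn (clk _ _ l2) (nbs_nrim nc).
have iff := nbs_inn ia af nf; have ig := nbs_inn ia ag ng.
have [ac bf] : a != c /\ b != f.
  by move: uk; rewrite /= !inE !negb_or => /and5P[/and5P[? ? _ _ _] /and4P[_ _ _ ?] _ _ _].
have nbr x : edge a x -> [|| x == b, x == f | x == g].
  by apply: deg3_nbr; rewrite // eq_sym.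
have nac : ~~ edge a c by apply/negP => H; apply: (no_triangle ab bc).
case: (@insecure G); constructor 4; constructor 3; exists a, b, c, d, e, f; split; first exact: fk.
split=> //; last 2 first.
- by rewrite /= (nbs_small nc) (nbs_small nf) /small d3.
- move=> x ax xb xf; have /or3P[] := nbr x ax; rewrite ?(negPf xb) ?(negPf xf) // => /eqP->.
  exact: nbs_small.
have mid x : edge a x -> x != b -> inn x.
  by move=> /nbr/or3P[] /eqP-> //; rewrite eqxx.
move=> [|x [|y [|z [|? ?]]]] // /and4P[ps us ls _] _; move: ps us ls; rewrite /= ?andbT.
- by move=> _ _ /eqP E; rewrite E eqxx in ac.
- by move=> vx _ /eqP E; rewrite -E vx in nac.
- move=> /andP[ax xy] _ /eqP E; subst y; case: (eqVneq x b) => [->//|xb].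
  have ix := mid x ax xb.
  have f2 : facial edge turn [:: a; x; c; b].
    apply: four_facial ia ax _ _ _ ac xb; [exact: inn_cl|rewrite clC|rewrite edgeC] => //.
    exact: clk.
  have [m1 m2 m3 m4] := link4 (cyc_uniq (facial_cyc f2)).
  by have [_] := facial_share fk f2 ac l1 l2 (linkW m4) (linkW m3).
- move=> /and3P[ax xy yz] _ /eqP E; subst z; case: (eqVneq x b) => [E|xb].
    by subst x; case: (no_triangle xy yz bc).
  have ix := mid x ax xb.
  have f2 : facial edge turn [:: a; x; y; c; b].
    apply: five_facial ia ax _ _ _ _; last by rewrite edgeC.
    - exact: inn_cl.
    - by rewrite clC inn_cl // edgeC.
    - by rewrite clC; apply: clk.
  have [m1 m2 m3 m4 m5] := link5 (cyc_uniq (facial_cyc f2)).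
  by have [_] := facial_share fk f2 ac l1 l2 (linkW m5) (linkW m4).
Qed.

End Multigrams.

(** * Cubic vertices and 6-cycles around at most one vertex *)

Section PlaneLemmas.
Variable G : planeMap.
Implicit Types (a b c d e f u v w x y z : G) (k l : seq G) (S : {set G * G}).

Lemma has_nbr z : exists u, edge z u.
Proof.
have /card_gt0P[u] : 0 < #|[set u | edge z u]| by apply: leq_trans (@deg_gt2 G z).
by rewrite inE; exists u.
Qed.

Lemma three_nbrs z a : edge z a ->
  exists b c, [/\ edge z b, edge z c, b != a, c != a & c != b].
Proof.
move=> za; have zb := turn_edge za; have ba := turn_neq za.
have ab : a != turn z a by rewrite eq_sym.
have [c [zc ca cb]] := third_nbr za zb ab.
by exists (turn z a), c.
Qed.

Lemma not_two_nbrs z p q : ~ (forall w, edge z w -> w = p \/ w = q).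
Proof.
move=> H; have [u zu] := has_nbr z; have [b [c [zb zc]]] := three_nbrs zu.
by case: (H _ zu) => ->; case: (H _ zb) => ->; case: (H _ zc) => ->; rewrite ?eqxx.
Qed.

Lemma deg3_turn v a b c : deg edge v = 3 -> edge v a -> edge v b -> edge v c ->
  a != b -> a != c -> b != c -> turn v a = b -> turn v b = c /\ turn v c = a.
Proof.
move=> d3 va vb vc ab ac bc E.
have nbr w : edge v w -> [|| w == a, w == b | w == c] by apply: deg3_nbr.
have Eb : turn v b = c.
  have := nbr _ (turn_edge vb); rewrite (negPf (turn_neq vb)) /= => /orP[] /eqP // E'.
  by have := turn2_neq va; rewrite E E' eqxx.
split=> //; have := nbr _ (turn_edge vc); rewrite (negPf (turn_neq vc)) orbF.
case/orP=> /eqP // E'; have := turn_inj vc va; rewrite E' E => /(_ erefl) H.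
by rewrite H eqxx in ac.
Qed.

Lemma walk_region l S a : facial_walk (@edge G) turn l -> region S -> a \in l ->
  (a, next l a) \in S -> forall x, x \in l -> (x, next l x) \in S.
Proof.
move=> fl rS al aS; have cyl := facial_walk_cyc fl; have [_ [_ fl']] := fl.
apply: (@cyc_ind _ _ (fun x => (x, next l x) \in S) _ cyl al aS) => b bl bS.
by have [e [<-]] := fl' b bl; rewrite region_turn.
Qed.

Lemma interior_two S k y z : #|interior S k| <= 1 -> y \in interior S k -> z \in interior S k ->
  y = z.
Proof. by move=> /card_le1_eqP H yi zi; exact: H zi yi. Qed.

Lemma interior_nbr S k z y : bounds S k -> #|interior S k| <= 1 -> z \in interior S k ->
  edge z y -> y \in k.
Proof.
move=> bS i1 zi zy; apply: contraT => yk; have [_ /(_ y zy)[zyS _]] := interiorP bS zi.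
have yi : y \in interior S k.
  by apply: (@interior_mem _ _ _ _ z) yk _; [case: bS | right].
by have := edge_neq zy; rewrite (interior_two i1 zi yi) eqxx.
Qed.

(* The face f lies on one side of the edge ab of k, and that side cannot be S;
   so the corner of S at a next to ab contains the third neighbour of a. *)
Lemma third_inside S k (f : seq G) a b a' z y y' : bounds S k -> {subset k <= ivert G} -> cyc k ->
  #|interior S k| <= 1 -> facial (@edge G) turn f -> link f a b -> link f a a' -> a' != b ->
  link k a b -> deg edge a = 3 -> edge a z -> z != b -> z != a' -> z \notin k ->
  y \in f -> y' \in f -> y != y' -> y \notin k -> y' \notin k -> z \in interior S k.
Proof.
move=> bS sub ck i1 ff fab faa a'b kab d3 az zb za' zk yf yf' yy yk yk'.
have [rS bdS] := bS.
have [l [fl ll _ lk]] := facial_orient ff.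
have cl := facial_walk_cyc fl; have ul := cyc_uniq cl; have [_ [_ fl']] := fl.
have out x : x \in l -> (x, next l x) \notin S.
  move=> xl; apply/negP => xS; have inS := walk_region fl rS xl xS.
  have int u : u \in f -> u \notin k -> u \in interior S k.
    rewrite -ll => uf uk; apply: (interior_mem rS uk (u := next l u)); left; exact: inS.
  by have := interior_two i1 (int y yf yk) (int y' yf' yk'); move/eqP; rewrite (negPf yy).
have ab := link_edge ck kab; have ba : edge b a by rewrite edgeC.
have aa := link_edge (facial_cyc ff) faa; have a'a : edge a' a by rewrite edgeC.
have aD : (a, b) \in darts G.
  by have [ak _] := link_mem kab; have := sub _ ak; rewrite !inE /= ab.
have := bdS _ aD; rewrite /= kab /boundary /flip /=.
rewrite -lk in fab; rewrite -lk in faa.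
case/orP: fab => /andP[xl /eqP E1]; case/orP: faa => /andP[xl' /eqP E2].
- by case/eqP: a'b; rewrite -E1 -E2.
- have aS : (a, b) \notin S by rewrite -E1 out.
  rewrite (negPf aS) /= => baS.
  have t : turn a a' = b by have [_ []] := fl' _ xl'; rewrite E2 E1.
  have [tb tz] : turn a b = z /\ turn a z = a'.
    by apply: deg3_turn => //; rewrite eq_sym.
  by apply: (interior_mem rS zk (u := a)); right; rewrite -tb region_turn.
- have bS' : (b, a) \notin S by rewrite -E1 out.
  rewrite (negPf bS') addbF => abS.
  have t : turn a b = a' by have [_ []] := fl' _ xl; rewrite E1 E2.
  have [ta tz] : turn a a' = z /\ turn a z = b.
    by apply: deg3_turn => //; rewrite eq_sym.
  apply: (interior_mem rS zk (u := a)); left.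
  by rewrite -tz region_turn // in abS; rewrite edgeC.
- by case/eqP: a'b; rewrite -(prev_next ul a') E2 -E1 prev_next.
Qed.

(** Any chord of a 6-cycle other than the three long diagonals cuts off a triangle. *)
Lemma no_chord6 a b c d e f (k := [:: a; b; c; d; e; f]) : cyc k ->
  ~~ edge a d -> ~~ edge b e -> ~~ edge c f ->
  forall x y, x \in k -> y \in k -> edge x y -> link k x y.
Proof.
move=> ck nad nbe ncf; have [[l1 l2 l3] [l4 l5 l6]] := link6 (cyc_uniq ck).
have [e1 e2 e3] : [/\ edge a b, edge b c & edge c d] by rewrite !(link_edge ck).
have [e4 e5 e6] : [/\ edge d e, edge e f & edge f a] by rewrite !(link_edge ck).
have L x y : x \in k -> y \in k -> edge x y -> link k x y || link k y x.
  rewrite !inE => /or4P[|||/or3P[]] /eqP -> /or4P[|||/or3P[]] /eqP ->;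
  rewrite ?edge_irr ?l1 ?l2 ?l3 ?l4 ?l5 ?l6 ?orbT // ?(negPf nad) ?(negPf nbe) ?(negPf ncf) //
    => xy; have yx := xy; rewrite edgeC in yx.
  all: try by rewrite ?(negPf nad) ?(negPf nbe) ?(negPf ncf) in yx.
  all: try by case: (no_triangle e1 e2).
  all: try by case: (no_triangle e2 e3).
  all: try by case: (no_triangle e3 e4).
  all: try by case: (no_triangle e4 e5).
  all: try by case: (no_triangle e5 e6).
  all: try by case: (no_triangle e6 e1).
by move=> x y xk yk xy; have := L x y xk yk xy; rewrite [link k y x]linkC orbb.
Qed.

End PlaneLemmas.

(** * Pentagrams and decagrams in the disc *)

Section Pentagons.
Variable G : insecureDisc.
Implicit Types (a b c d e f u v w x y z : G) (k : seq G).
Local Notation bs := (@big_or_rim G).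

(** Excludes adjacent outer neighbours of two consecutive vertices of a pentagon. The 4-cycle is
    facial, and since [y] is not in [big_or_rim] the last hypothesis of [insecure_tetragram] is
    vacuous. *)
Lemma insecure_side v w y x c : inn v -> inn w -> inn x -> deg edge v = 3 ->
  edge v w -> edge v x -> w != x -> edge w y -> edge x y -> y != v ->
  edge v c -> c != w -> c != x -> ~~ bs c -> ~~ bs y -> False.
Proof.
move=> iv iw ix d3 vw vx wx wy xy yv vc cw cx nc ny.
have fk : facial edge turn [:: v; w; y; x].
  apply: four_facial iv vw _ _ _ _ wx; first exact: inn_cl.
  - by rewrite clC inn_cl.
  - by rewrite edgeC.
  - by rewrite eq_sym.
by apply: (insecure_tetragram iv d3 fk vc cw cx nc); rewrite (negPf ny).
Qed.

Definition inner_pentagon v1 v2 v3 v4 v5 :=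
  facial edge turn [:: v1; v2; v3; v4; v5] /\ {in [:: v1; v2; v3; v4; v5], forall v, inn v}.

Lemma inner_pentagon_rot v1 v2 v3 v4 v5 :
  inner_pentagon v1 v2 v3 v4 v5 -> inner_pentagon v2 v3 v4 v5 v1.
Proof.
case=> fk ik; split; first exact: (facial_rot 1 fk).
by move=> v vk; apply: ik; rewrite -(mem_rot 1).
Qed.

Lemma inner_pentagon_rev v1 v2 v3 v4 v5 :
  inner_pentagon v1 v2 v3 v4 v5 -> inner_pentagon v4 v3 v2 v1 v5.
Proof.
case=> fk ik; split; first exact: (facial_rot 1 (facial_rev fk)).
by move=> v vk; apply: ik; rewrite -mem_rev -(mem_rot 1).
Qed.

Section Pentagon.
Variables v1 v2 v3 v4 v5 : G.
Hypothesis pk : inner_pentagon v1 v2 v3 v4 v5.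

Lemma pentagon_edges :
  [/\ edge v1 v2, edge v2 v3, edge v3 v4, edge v4 v5 & edge v5 v1].
Proof. by case: pk => /facial_cyc/and3P[_ /= /and5P[? ? ? ? /andP[? _]] _] _. Qed.

Lemma pentagon_inn : [/\ inn v1, inn v2, inn v3, inn v4 & inn v5].
Proof. by case: pk => _ i; split; apply: i; rewrite !inE eqxx ?orbT. Qed.

Lemma pentagon_diag :
  [/\ v1 != v3, v2 != v4, v3 != v5, v4 != v1 & v5 != v2].
Proof.
have := cyc_uniq (facial_cyc (proj1 pk)); rewrite /= !inE !negb_or.
move=> /and5P[/and4P[_ ? ? _] /and3P[_ ? ?] /andP[_ ?] _ _].
by split=> //; rewrite eq_sym.
Qed.

Lemma pentagon_chord :
  [/\ ~~ edge v1 v3, ~~ edge v2 v4, ~~ edge v3 v5, ~~ edge v4 v1 & ~~ edge v5 v2].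
Proof.
have [e1 e2 e3 e4 e5] := pentagon_edges.
have T a b c : edge a b -> edge b c -> ~~ edge a c.
  by move=> ab bc; apply/negP; apply: no_triangle ab bc.
by split; [apply: T e1 e2 | apply: T e2 e3 | apply: T e3 e4 | apply: T e4 e5 | apply: T e5 e1].
Qed.

(** The resulting 4-cycle would be a face sharing the corner [v1 v2 v3] with the pentagon. *)
Lemma pentagon_four y : edge v1 y -> edge v3 y -> y != v2 -> False.
Proof.
move=> e1y e3y yv2; have [e1 e2 _ _ _] := pentagon_edges; have [d13 _ _ _ _] := pentagon_diag.
have [i1 i2 i3 _ _] := pentagon_inn.
have f2 : facial edge turn [:: v1; v2; v3; y].
  apply: four_facial i1 e1 _ _ _ d13 _; try exact: inn_cl.
    by rewrite edgeC.
  by rewrite eq_sym.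
have [l1 l2 _ _ _] := link5 (cyc_uniq (facial_cyc (proj1 pk))).
have [m1 m2 _ _] := link4 (cyc_uniq (facial_cyc f2)).
by have [_] := facial_share (proj1 pk) f2 d13 l1 l2 m1 m2.
Qed.

(** The 5-cycle [v1 v2 v3 z y] is facial and shares the corner at [v2] with the pentagon, so it is
    the pentagon. *)
Lemma pentagon_five y z : inn y -> edge v1 y -> edge v3 z -> edge y z -> y != v2 -> z != v2 ->
  y = v5 /\ z = v4.
Proof.
move=> iy e1y e3z yz yv2 zv2; have [e1 e2 e3 e4 e5] := pentagon_edges.
have [d13 _ _ _ _] := pentagon_diag; have [i1 i2 i3 _ _] := pentagon_inn.
have [c1 c2 c3 c4 c5] := pentagon_chord.
have f2 : facial edge turn [:: v1; v2; v3; z; y].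
  apply: five_facial i1 e1 _ _ _ _; try exact: inn_cl; last by rewrite edgeC.
  by rewrite clC; apply: inn_cl.
have [l1 l2 _ _ _] := link5 (cyc_uniq (facial_cyc (proj1 pk))).
have [m1 m2 _ _ _] := link5 (cyc_uniq (facial_cyc f2)).
have [E _] := facial_share (proj1 pk) f2 d13 l1 l2 m1 m2.
have := E y; have := E z; rewrite !inE !eqxx !orbT (negPf yv2) (negPf zv2) /=.
have -> : (y == v1) = false by apply/negP => /eqP H; rewrite H edge_irr in e1y.
have -> : (z == v3) = false by apply/negP => /eqP H; rewrite H edge_irr in e3z.
have -> : (y == v3) = false by apply/negP => /eqP H; rewrite H (negPf c1) in e1y.
have -> : (z == v1) = false by apply/negP => /eqP H; rewrite H edgeC (negPf c1) in e3z.
have -> : (y == v4) = false by apply/negP => /eqP H; rewrite H edgeC (negPf c4) in e1y.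
have -> : (z == v5) = false by apply/negP => /eqP H; rewrite H (negPf c3) in e3z.
by rewrite /= !orbF => /eqP -> /eqP ->.
Qed.

End Pentagon.

(** A forbidden path of length 3 closes up to a 6-cycle, which encloses at most one vertex. An
    enclosed vertex would have too few neighbours, and an empty 6-cycle would be a secure hexagram.
    The last two hypotheses keep the middle edge of the path inside the disc. *)
Lemma insecure_pentagon v1 v2 v3 v4 v5 x1 x2 x3 x4 :
  inner_pentagon v1 v2 v3 v4 v5 ->
  {in [:: v1; v2; v3; v4; v5], forall v, ~~ bs v} ->
  {in [:: v1; v2; v3; v4], forall v, deg edge v = 3} ->
  [/\ edge v1 x1, edge v2 x2, edge v3 x3 & edge v4 x4] ->
  [/\ x1 != v5, x2 != v1, x3 != v2 & x4 != v3] ->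
  [/\ x1 != v2, x2 != v3, x3 != v4 & x4 != v5] ->
  {in [:: x1; x2; x3; x4], forall x, ~~ bs x} ->
  (forall w, edge v5 w -> ~~ bs w) \/ (forall w, edge x2 w -> ~~ bs w) ->
  (forall w, edge x3 w -> ~~ bs w) \/ (forall w, edge x4 w -> ~~ bs w) -> False.
Proof.
move=> pk nv d3 [a1 a2 a3 a4] [xp1 xp2 xp3 xp4] [xn1 xn2 xn3 xn4] nx H1 H2.
have fk := proj1 pk.
have [e1 e2 e3 e4 e5] := pentagon_edges pk.
have [d13 d24 d35 d41 d52] := pentagon_diag pk.
have [c13 c24 c35 c41 c52] := pentagon_chord pk.
have [i1 i2 i3 i4 i5] := pentagon_inn pk.
have [g1 g2 g3 g4] : [/\ deg edge v1 = 3, deg edge v2 = 3, deg edge v3 = 3 & deg edge v4 = 3].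
  by split; apply: d3; rewrite !inE eqxx ?orbT.
have [n1 n2 n3 n4] : [/\ ~~ bs x1, ~~ bs x2, ~~ bs x3 & ~~ bs x4].
  by split; apply: nx; rewrite !inE eqxx ?orbT.
have [m1 m2 m3 m4 m5] : [/\ ~~ bs v1, ~~ bs v2, ~~ bs v3, ~~ bs v4 & ~~ bs v5].
  by split; apply: nv; rewrite !inE eqxx ?orbT.
have [j1 j2 j3 j4] : [/\ inn x1, inn x2, inn x3 & inn x4].
  by split; [exact: nbs_inn i1 a1 n1 | exact: nbs_inn i2 a2 n2 | exact: nbs_inn i3 a3 n3 |
    exact: nbs_inn i4 a4 n4].
have r1 := inner_pentagon_rot pk; have r2 := inner_pentagon_rot r1.
have r3 := inner_pentagon_rot r2; have r4 := inner_pentagon_rot r3.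
have [b1 b2 b3 b4 b5] : [/\ edge v2 v1, edge v3 v2, edge v4 v3, edge v5 v4 & edge v1 v5].
  by split; rewrite edgeC.
have T a b c : edge a b -> edge b c -> ~~ edge a c.
  by move=> ab bc; apply/negP; apply: no_triangle ab bc.
have ne u w x : edge u x -> ~~ edge u w -> x != w.
  by move=> ux; apply: contraNneq => <-.
have x12 : x1 != x2.
  by apply/eqP => E; apply: (no_triangle e1 a2); rewrite -E.
have x23 : x2 != x3.
  by apply/eqP => E; apply: (no_triangle e2 a3); rewrite -E.
have x34 : x3 != x4.
  by apply/eqP => E; apply: (no_triangle e3 a4); rewrite -E.
have x13 : x1 != x3.
  by apply/eqP => E; apply: (pentagon_four pk a1 _ xn1); rewrite E.
have x24 : x2 != x4.
  by apply/eqP => E; apply: (pentagon_four r1 a2 _ xn2); rewrite E.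
have x14 : x1 != x4.
  by apply/eqP => E; apply: (pentagon_four r3 a4 _ xn4); rewrite -E.
have e12 : ~~ edge x1 x2.
  apply/negP => E; apply: (@insecure_side v1 v2 x2 x1 v5) => //; last by rewrite eq_sym.
  by rewrite eq_sym.
have e23 : ~~ edge x2 x3.
  by apply/negP => E; apply: (@insecure_side v2 v3 x3 x2 v1) => //; rewrite eq_sym.
have e34 : ~~ edge x3 x4.
  by apply/negP => E; apply: (@insecure_side v3 v4 x4 x3 v2) => //; rewrite eq_sym.
have e13 : ~~ edge x1 x3.
  apply/negP => E; have [//|E1 _] := pentagon_five pk j1 a1 a3 E _ xp3.
  by rewrite E1 eqxx in xp1.
have e24 : ~~ edge x2 x4.
  apply/negP => E; have [//|E1 _] := pentagon_five r1 j2 a2 a4 E _ xp4.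
  by rewrite E1 eqxx in xp2.
have e14 : ~~ edge x1 x4.
  rewrite edgeC; apply/negP => E; have [//|E1 _] := pentagon_five r3 j4 a4 a1 E _ xp1.
  by rewrite E1 eqxx in xp4.
have i12 x y : edge x2 x -> edge y v5 -> edge x y -> cl y x.
  move=> ex ey exy; case: H1 => H.
    have v5y : edge v5 y by rewrite edgeC.
    by apply: inn_cl (nbs_inn i5 v5y (H _ v5y)) _; rewrite edgeC.
  by rewrite clC; apply: inn_cl (nbs_inn j2 ex (H _ ex)) _.
have i34 x y : edge x3 x -> edge y x4 -> edge x y -> cl y x.
  move=> ex ey exy; case: H2 => H.
    by rewrite clC; apply: inn_cl (nbs_inn j3 ex (H _ ex)) _.
  have x4y : edge x4 y by rewrite edgeC.
  by apply: inn_cl (nbs_inn j4 x4y (H _ x4y)) _; rewrite edgeC.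
have rr := inner_pentagon_rot (inner_pentagon_rot (inner_pentagon_rev pk)).
have P25 p : spath edge [:: v1; v2; v3; v4] x2 v5 p -> 3 < size p.
  case: p => [|x [|y [|z [|? ?]]]] // /and4P[ps us ls av]; move: ps us ls av;
    rewrite /= ?andbT.
  - by move=> _ _ /eqP E; rewrite E edgeC (negPf c52) in a2.
  - move=> x2x _ /eqP E _; subst x; case: (pentagon_four r4 _ a2 xp2).
    by rewrite edgeC.
  - move=> /andP[x2x xy] _ /eqP E; subst y => /and3P[_ xS _]; move: xS.
    rewrite !inE !negb_or => /and4P[xv1 _ _ _].
    have v5x : edge v5 x by rewrite edgeC.
    by have [E _] := pentagon_five rr j2 a2 v5x x2x xp2 xv1; rewrite E eqxx in xn2.
  - move=> /and3P[x2x xy yz] us /eqP E; subst z => /and4P[_ xS yS _]; move: xS yS us.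
    rewrite !inE !negb_or => /and4P[xv1 xv2 xv3 xv4] /and4P[yv1 yv2 yv3 yv4].
    move=> /and3P[/and3P[x2x' x2y x2v5] /andP[_ xv5] yv5].
    have [ck [S [bS sub in1]]] : cyc [:: v1; v5; y; x; x2; v2] /\ exists S,
        [/\ bounds S [:: v1; v5; y; x; x2; v2],
          {subset [:: v1; v5; y; x; x2; v2] <= ivert G} &
          #|interior S [:: v1; v5; y; x; x2; v2]| <= 1].
      apply: six_region i1 b5 _ _ _ _ b1 _ _ _ _ _ _ => //; try by rewrite eq_sym.
      - by apply: inn_cl; rewrite // edgeC.
      - exact: i12.
      - by rewrite clC; apply: inn_cl.
      - by apply: inn_cl; rewrite // edgeC.
    have [l1 _ _ _ l5] := link5 (cyc_uniq (facial_cyc fk)).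
    have [_ [_ _ l6]] := link6 (cyc_uniq ck).
    have x1n u : edge x1 u -> u != v5 /\ u != v2 /\ u != x2.
      move=> x1u; split; last split.
      - by apply: contraTneq x1u => ->; apply/negP => H; apply: (no_triangle a1 H).
      - by apply: contraTneq x1u => ->; apply/negP => H; apply: (no_triangle a1 H).
      - by apply: contraTneq x1u => ->.
    have x1k : x1 \notin [:: v1; v5; y; x; x2; v2].
      rewrite !inE !negb_or xp1 xn1 x12 (eq_sym x1 v1) edge_neq //=.
      apply/and3P; split=> //.
        by apply: contraTneq yz => <-; apply: (T _ v1); rewrite // edgeC.
      by apply: contraTneq x2x => <-; rewrite edgeC.
    have v3k : v3 \notin [:: v1; v5; y; x; x2; v2].
      by rewrite !inE !negb_or ![v3 == _]eq_sym d13 (eq_sym v5) d35 yv3 xv3 xn2 edge_neq.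
    have v4k : v4 \notin [:: v1; v5; y; x; x2; v2].
      rewrite !inE !negb_or d41 edge_neq // ![v4 == _]eq_sym yv4 xv4 d24 andbT /=.
      by apply: contraTneq a2 => ->.
    (* [v3] and [v4] cannot both be inside, so the pentagon is outside and [x1] inside. *)
    have x1i : x1 \in interior S [:: v1; v5; y; x; x2; v2].
      apply: (third_inside bS sub ck in1 fk l1 (linkW l5) d52 (linkW l6) g1 a1 xn1 xp1 x1k
        (y := v3) (y' := v4) _ _ (edge_neq e3) v3k v4k); by rewrite !inE eqxx ?orbT.
    have x1v1 : edge x1 v1 by rewrite edgeC.
    have [b [c [x1b x1c bv cv cb]]] := three_nbrs x1v1.
    (* All neighbours of [x1] are on the cycle. Besides [v1] only [x] and [y] are possible, and
       having both would make a triangle. *)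
    have onk u : edge x1 u -> u != v1 -> (u == y) || (u == x).
      move=> x1u uv; have := interior_nbr bS in1 x1i x1u.
      have [u5 [u2 ux2]] := x1n _ x1u.
      by rewrite !inE (negPf uv) (negPf u5) (negPf u2) (negPf ux2) /= orbF.
    case/orP: (onk _ x1b bv) => /eqP Eb; case/orP: (onk _ x1c cv) => /eqP Ec; subst b c.
    - by rewrite eqxx in cb.
    - by case: (no_triangle x1c xy x1b).
    - by case: (no_triangle x1b xy x1c).
    - by rewrite eqxx in cb.
have P34 p : spath edge [:: v1; v2; v3; v4] x3 x4 p -> size p <= 3 ->
    exists m, p = [:: m; x4] /\ facial edge turn [:: x3; v3; v4; x4; m].
  have f34 x : edge x3 x -> edge x x4 -> facial edge turn [:: x3; v3; v4; x4; x].
    move=> x3x xx4; apply: (facial_rot 4 (k := [:: v3; v4; x4; x; x3])).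
    apply: five_facial i3 e3 _ _ _ _; last by rewrite edgeC.
    - exact: inn_cl.
    - by apply: inn_cl; rewrite // edgeC.
    - by rewrite clC; apply: inn_cl.
  case: p => [|x [|y [|z [|? ?]]]] // /and4P[ps us ls av] _; move: ps us ls av;
    rewrite /= ?andbT.
  - by move=> _ _ /eqP E; rewrite E eqxx in x34.
  - by move=> x3x _ /eqP E _; rewrite -E x3x in e34.
  - by move=> /andP[x3x xy] _ /eqP E _; subst y; exists x; split=> //; apply: f34.
  - move=> /and3P[x3x xy yz] us /eqP E; subst z => /and4P[_ xS yS _]; move: xS yS us.
    rewrite !inE !negb_or => /and4P[xv1 xv2 xv3 xv4] /and4P[yv1 yv2 yv3 yv4].
    move=> /and3P[/and3P[x3x' x3y _] /andP[_ xx4] yx4].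
    pose k := [:: v3; v4; x4; y; x; x3].
    have [ck [S [bS sub in1]]] : cyc k /\ exists S,
        [/\ bounds S k, {subset k <= ivert G} & #|interior S k| <= 1].
      apply: six_region i3 e3 _ _ _ _ _ _ _ _ _ _ _ => //; try by rewrite eq_sym.
      - exact: inn_cl.
      - by apply: inn_cl; rewrite // edgeC.
      - exact: i34.
      - by rewrite clC; apply: inn_cl.
      - by rewrite edgeC.
    have v1k : v1 \notin k.
      rewrite !inE !negb_or d13 ![v1 == _]eq_sym d41 yv1 xv1 /=.
      apply/andP; split.
        by apply: contraTneq a4 => ->.
      by apply: contraTneq a3 => ->; rewrite edgeC.
    have out u : edge u v1 -> u \notin interior S k.
      by move=> uv; apply: contra v1k => ui; apply: (interior_nbr bS in1 ui uv).
    have nb3 u : edge v3 u -> [|| u == v2, u == v4 | u == x3].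
      by apply: deg3_nbr; rewrite // eq_sym.
    have nb4 u : edge v4 u -> [|| u == v3, u == v5 | u == x4].
      by apply: deg3_nbr; rewrite // eq_sym.
    (* A vertex z inside k is adjacent only to x4, y, x, x3, which form a path;
       without triangles it has at most two neighbours. *)
    have int0 : interior S k = set0.
      apply/eqP; rewrite -subset0; apply/subsetP => z zi.
      have [zk _] := interiorP bS zi.
      have onk u : edge z u -> [|| u == x4, u == y, u == x | u == x3].
        move=> zu; have := interior_nbr bS in1 zi zu; rewrite !inE.
        move: zk; rewrite !inE !negb_or => /and5P[zv3 zv4 zx4 zy /andP[zx zx3]].
        case: (u =P v3) => [E|_] /=.
          subst u; have := nb3 z; rewrite edgeC zu (negPf zv4) (negPf zx3) ?orbF /= => /(_ isT).
          by move=> /eqP E; move: (out z); rewrite zi E => /(_ b1).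
        case: (u =P v4) => [E|_] //=.
        subst u; have := nb4 z; rewrite edgeC zu (negPf zv3) (negPf zx4) ?orbF /= => /(_ isT).
        by move=> /eqP E; move: (out z); rewrite zi E => /(_ e5).
      have tri p q : edge z p -> edge z q -> edge p q -> False.
        by move=> zp zq pq; apply: no_triangle zp pq zq.
      have x4y : edge x4 y by rewrite edgeC.
      have yx : edge y x by rewrite edgeC.
      have xx3 : edge x x3 by rewrite edgeC.
      have [p [q pq]] : exists p q, forall w, edge z w -> w = p \/ w = q.
        have [zy|zy] := boolP (edge z y).
          exists y, x3 => w zw; case/or4P: (onk w zw) => /eqP E; subst w; auto.
            by case: (tri _ _ zw zy x4y).
          by case: (tri _ _ zy zw yx).
        have [zx|zx] := boolP (edge z x).
          exists x4, x => w zw; case/or4P: (onk w zw) => /eqP E; subst w; auto.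
            by rewrite zw in zy.
          by case: (tri _ _ zx zw xx3).
        exists x4, x3 => w zw; case/or4P: (onk w zw) => /eqP E; subst w; auto.
          by rewrite zw in zy.
        by rewrite zw in zx.
      by case: (not_two_nbrs pq).
    (* Empty and without chords, the 6-cycle is a face, to which [insecure_hexagram] applies. *)
    have : facial edge turn k.
      apply: (empty_facial ck sub bS int0); apply: no_chord6 ck _ _ _.
      - apply/negP => /nb3/or3P[] /eqP E; move: yv2 yv4 x3y; rewrite E eqxx //.
      - apply/negP => /nb4/or3P[] /eqP E; move: xv3 xx4; rewrite E ?eqxx // => _ _.
        move: x3x; rewrite E => x3v5.
        by apply: (pentagon_four r2 a3 _ _); rewrite // edgeC.
      - by rewrite edgeC.
    move=> fkk; case: (insecure_hexagram i3 g3 fkk n4 n3 b2 d24 _ m2).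
    by rewrite eq_sym.
case: (@insecure G).
constructor 4; constructor 1; exists v1, v2, v3, v4, v5; split.
  by split; [exact: fk | rewrite /= g1 g2 g3 g4].
exists x1, x2, x3, x4; split.
  by rewrite /is_x; split; apply/and3P.
split; last split.
- split.
  + by rewrite /= !inE !negb_or x12 x13 x14 x23 x24 x34.
  + have sy : symmetric (@edge G) := @edgeC G.
    move=> a b; rewrite !inE => /or4P[] /eqP-> /or4P[] /eqP->; rewrite ?edge_irr // sy //.
  + exact: P25.
  + exact: P34.
- by rewrite /= !nbs_small.
- by case: H1 => H; [left | right] => w /H/nbs_small.
- by case: H2 => H; [left | right] => w /H/nbs_small.
Qed.

(** A common neighbour [w] of [x1] and [x3] closes a 6-cycle with [x2] as the only vertex inside.
    The neighbours of [x2] would be among [v2], [x3] and [w], the last two of which are adjacent. *)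
Lemma insecure_decagram v1 v2 v3 v4 v5 x1 x2 x3 :
  inner_pentagon v1 v2 v3 v4 v5 ->
  {in [:: v1; v2; v3; v4; v5], forall v, ~~ bs v} ->
  {in [:: v1; v2; v3; v4; v5], forall v, deg edge v = 3} ->
  [/\ edge v1 x1, edge v2 x2 & edge v3 x3] ->
  [/\ x1 != v5, x2 != v1 & x3 != v2] -> [/\ x1 != v2, x2 != v3 & x3 != v4] ->
  ~~ bs x1 -> ~~ bs x3 -> False.
Proof.
move=> pk nv d3 [a1 a2 a3] [xp1 xp2 xp3] [xn1 xn2 xn3] n1 n3.
have fk := proj1 pk.
have [e1 e2 e3 e4 e5] := pentagon_edges pk.
have [d13 d24 d35 d41 d52] := pentagon_diag pk.
have [c13 c24 c35 c41 c52] := pentagon_chord pk.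
have [i1 i2 i3 i4 i5] := pentagon_inn pk.
have [g1 g2 g3 g4 g5] : [/\ deg edge v1 = 3, deg edge v2 = 3, deg edge v3 = 3,
  deg edge v4 = 3 & deg edge v5 = 3].
  by split; apply: d3; rewrite !inE eqxx ?orbT.
have [m1 m2 m3 m4 m5] : [/\ ~~ bs v1, ~~ bs v2, ~~ bs v3, ~~ bs v4 & ~~ bs v5].
  by split; apply: nv; rewrite !inE eqxx ?orbT.
have j1 := nbs_inn i1 a1 n1; have j3 := nbs_inn i3 a3 n3.
have r1 := inner_pentagon_rot pk; have r2 := inner_pentagon_rot r1.
have r3 := inner_pentagon_rot r2; have r4 := inner_pentagon_rot r3.
have [b1 b2 b3 b4 b5] : [/\ edge v2 v1, edge v3 v2, edge v4 v3, edge v5 v4 & edge v1 v5].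
  by split; rewrite edgeC.
have x13 : x1 != x3.
  by apply/eqP => E; apply: (pentagon_four pk a1 _ xn1); rewrite E.
have e13 : ~~ edge x1 x3.
  apply/negP => E; have [//|E1 _] := pentagon_five pk j1 a1 a3 E _ xp3.
  by rewrite E1 eqxx in xp1.
have e12 : ~~ edge x1 x2.
  apply/negP => E.
  have ne : v1 != x2 by rewrite eq_sym.
  have fk2 : facial edge turn [:: v2; v1; x1; x2].
    apply: four_facial i2 b1 _ _ _ _ ne; rewrite ?inn_cl //.
      by rewrite edgeC.
    by rewrite eq_sym.
  apply: (insecure_tetragram i2 g2 fk2 e2 _ _ m3); rewrite ?(negPf n1) // eq_sym //.
have common w : ~ (edge x1 w /\ edge x3 w).
  case=> x1w x3w.
  have wv : w \notin [:: v1; v2; v3; v4; v5].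
    rewrite !inE !negb_or; apply/and5P; split; apply/negP => /eqP E; subst w.
    - by apply: (pentagon_four pk _ a3 xp3) => //; rewrite edgeC in x3w.
    - by apply: (no_triangle e1 _ a1); rewrite edgeC.
    - by apply: (pentagon_four pk a1 _ xn1); rewrite edgeC.
    - by apply: (pentagon_four r3 _ a1 xp1); rewrite edgeC.
    - by apply: (pentagon_four r2 a3 _ xn3); rewrite edgeC.
  move: wv; rewrite !inE !negb_or => /and5P[wv1 wv2 wv3 wv4 wv5].
  pose k := [:: v2; v3; x3; w; x1; v1].
  have [ck [S [bS sub in1]]] : cyc k /\ exists S,
      [/\ bounds S k, {subset k <= ivert G} & #|interior S k| <= 1].
    apply: six_region i2 e2 _ _ _ _ e1 _ _ _ _ _ d13 => //; try by rewrite eq_sym.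
    - exact: inn_cl.
    - exact: inn_cl.
    - by rewrite clC; apply: inn_cl.
    - by apply: inn_cl; rewrite // edgeC.
  have x2n u : edge x2 u -> [/\ u != v1, u != v3 & u != x1].
    move=> x2u; split; apply: contraTneq x2u => ->.
    - by apply/negP => H; apply: (no_triangle a2 H).
    - by apply/negP => H; apply: (no_triangle a2 H).
    - by rewrite edgeC.
  have v2x2 : edge x2 v2 by rewrite edgeC.
  have x2k : x2 \notin k.
    rewrite !inE !negb_or xp2 xn2 (eq_sym x2 v2) edge_neq //= andbT.
    apply/and3P; split; apply/negP => /eqP E.
    - by apply: (no_triangle e2 a3); rewrite -E.
    - by move: e12; rewrite E x1w.
    - by apply: (no_triangle e1 a2); rewrite E.
  have v4k : v4 \notin k.
    rewrite !inE !negb_or ![v4 == _]eq_sym d24 edge_neq // xn3 wv4 (eq_sym v1) d41 /= ?andbT.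
    by apply: contraTneq a1 => ->; rewrite edgeC.
  have v5k : v5 \notin k.
    rewrite !inE !negb_or d52 ![v5 == _]eq_sym d35 xp1 wv5 (edge_neq b5) /= ?andbT.
    by apply: contraTneq a3 => ->.
  have [l1 l2 _ _ _] := link5 (cyc_uniq (facial_cyc fk)).
  have [[l1' _ _] _] := link6 (cyc_uniq ck).
  have x2i : x2 \in interior S k.
    by apply: (third_inside bS sub ck in1 fk l2 (linkW l1) d13 l1' g2 a2 xn2 xp2 x2k
      (y := v4) (y' := v5) _ _ (edge_neq e4) v4k v5k); rewrite !inE eqxx ?orbT.
  have [b [c [x2b x2c bv cv cb]]] := three_nbrs v2x2.
  have onk u : edge x2 u -> u != v2 -> (u == x3) || (u == w).
    move=> x2u uv; have := interior_nbr bS in1 x2i x2u.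
    have [u1 u3 ux] := x2n _ x2u.
    by rewrite !inE (negPf uv) (negPf u1) (negPf u3) (negPf ux) /= ?orbF.
  case/orP: (onk _ x2b bv) => /eqP Eb; case/orP: (onk _ x2c cv) => /eqP Ec; subst b c.
  - by rewrite eqxx in cb.
  - by case: (no_triangle x2b x3w x2c).
  - by case: (no_triangle x2c x3w x2b).
  - by rewrite eqxx in cb.
case: (@insecure G).
constructor 4; constructor 2; exists v1, v2, v3, v4, v5; split.
  by split; [split; [exact: fk | rewrite /= g1 g2 g3 g4] | exact: g5].
exists x1, x3; split => //.
- by rewrite /is_x; split; apply/and3P.
- by rewrite /= !nbs_small.
Qed.

End Pentagons.

(** * 4-faces with two consecutive edges on the rim *)

Section RimCorners.

Section Zip.
Variable G : planeMap.
Implicit Types (u w : G) (e q : G * G) (k : seq G).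

Definition same_edge q e := (e == q) || (e == flip q).

Lemma same_edgeC x y q : same_edge q (x, y) = same_edge q (y, x).
Proof.
by case: q => u w; rewrite /same_edge /flip !xpair_eqE /= orbC ![(x == _) && _]andbC.
Qed.

(** Presents a cycle as an explicit list of edges, so that the symmetric difference of the rim and a
    face is found by Boolean case analysis. *)
Lemma link_zip k u w : uniq k -> link k u w = has (same_edge (u, w)) (zip k (rot 1 k)).
Proof.
move=> uk; have -> : zip k (rot 1 k) = [seq (x, next k x) | x <- k].
  suff {1}-> : rot 1 k = [seq next k x | x <- k].
    by rewrite -{1}[k]map_id zip_map.
  case: k uk => [|y k] // uk; rewrite rot1_cons; apply: (@eq_from_nth _ y).
    by rewrite size_rcons size_map.
  move=> i; rewrite size_rcons => ik.
  have im : nth y (y :: k) i \in y :: k by rewrite mem_nth.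
  rewrite (nth_map y) // next_nth im index_uniq // nth_rcons.
  case: ltnP => // /(nth_default y) ->; by rewrite if_same.
rewrite has_map; apply/orP/hasP => [[]/andP[xk /eqP E]|[x xk]].
- by exists u; rewrite //= /same_edge E eqxx.
- by exists w; rewrite //= /same_edge /flip /= E eqxx orbT.
- rewrite /= /same_edge /flip /= !xpair_eqE => /orP[]/andP[/eqP <- /eqP <-].
    by left; rewrite xk eqxx.
  by right; rewrite xk eqxx.
Qed.

Lemma rot_three k a b c : cyc k -> a \in k -> next k a = b -> next k b = c ->
  exists i r, rot i k = a :: b :: c :: r.
Proof.
move=> ck ak nab nbc; have uk := cyc_uniq ck; have [i k' kE] := rot_to ak; exists i.
have := cyc_rot i ck; rewrite kE => /and3P[us _ sz].
move: nab nbc; rewrite -!(next_rot i uk) kE.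
case: k' us sz {kE} => [|x [|y r]] //= us _; rewrite eqxx => E; subst x.
move: us; rewrite !inE !negb_or => /and3P[/and3P[ab _ _] _ _].
by rewrite (eq_sym b) (negPf ab) eqxx => ->; exists r.
Qed.

End Zip.

Variable G : insecureDisc.
Implicit Types (a b c d e f g u v w x y z : G) (k : seq G).
Local Notation bs := (@big_or_rim G).

Lemma rim_cl u w : link (rim G) u w -> cl u w.
Proof.
move=> l; have [rS bS] := disc_bounds G; have [ur _] := link_mem l.
have uD : (u, w) \in darts G.
  have := good_sub (disc_good G) ur; rewrite !inE => -> /=.
  by rewrite (link_edge (good_cyc (disc_good G)) l).
have := bS _ uD; rewrite l /boundary /flip /cl /=.
by case: (_ \in _) => //= ->.
Qed.

Lemma inn_rim_nbr v w : inn v -> edge v w -> (w \in rim G) || inn w.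
Proof.
move=> iv vw; case wr: (w \in rim G) => //=.
by apply: cl_inn (inn_cl iv vw) _; rewrite wr.
Qed.

Lemma rim_three a b c : link (rim G) a b -> link (rim G) b c -> a != c ->
  exists r, [/\ cyc (a :: b :: c :: r), a :: b :: c :: r =i rim G,
     size (rim G) = size (a :: b :: c :: r) & link (a :: b :: c :: r) =2 link (rim G)].
Proof.
have cs := good_cyc (disc_good G); have us := cyc_uniq cs.
move=> lab lbc ac; have [ar br] := link_mem lab.
have main k : cyc k -> k =i rim G -> size k = size (rim G) -> link k =2 link (rim G) ->
    next k a = b -> next k b = c -> exists r, [/\ cyc (a :: b :: c :: r),
     a :: b :: c :: r =i rim G,
     size (rim G) = size (a :: b :: c :: r) & link (a :: b :: c :: r) =2 link (rim G)].
  move=> ck km ks kl n1 n2; have ak : a \in k by rewrite km.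
  have [i [r kE]] := rot_three ck ak n1 n2; exists r; rewrite -kE; split.
  - exact: cyc_rot.
  - by move=> x; rewrite mem_rot km.
  - by rewrite size_rot ks.
  - by move=> x y; rewrite link_rot ?kl // cyc_uniq.
case/orP: lab => /andP[_ /eqP E1]; case/orP: lbc => /andP[_ /eqP E2].
- exact: (main (rim G)).
- by case/eqP: ac; rewrite -(prev_next us a) E1 -E2 prev_next.
- by case/eqP: ac; rewrite -E1 E2.
- apply: (main (rev (rim G)) (cyc_rev cs)); rewrite ?size_rev // ?next_rev //.
  + by move=> x; rewrite mem_rev.
  + exact: link_rev.
  + by rewrite -E1 prev_next.
  + by rewrite -E2 prev_next.
Qed.

Lemma facial_walk_sub_disc l a : facial_walk (@edge G) turn l -> a \in l ->
  (a, next l a) \in disc G -> walk l \subset disc G.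
Proof.
move=> fl al aS; apply/subsetP => -[x y]; rewrite inE /= => /andP[xl /eqP ->].
exact: (walk_region fl (disc_region G) al aS).
Qed.

(** Boundaries add modulo 2, so the boundary of the rest lies on [k]. By [sub_boundary] it is all of
    [k], for the rest is neither empty nor everything. *)
Lemma remove_face l k : facial_walk (@edge G) turn l -> walk l \subset disc G -> cyc k ->
  (forall u w, edge u w -> link (rim G) u w (+) link l u w -> link k u w) ->
  ~ (disc G \subset walk l) -> bounds (disc G :\: walk l) k.
Proof.
move=> fl sub ck lk nsub; have [rA bA] := disc_bounds G.
have [a al] := cyc_mem (facial_walk_cyc fl).
have ls : {subset l <= ivert G}.
  apply: (cyc_ivert (facial_walk_cyc fl) al).
  by have := region_dart rA (subsetP sub _ (walk_next al)); rewrite !inE => /andP[].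
have [rW bW] := facial_walk_bounds fl ls.
have rS : region (disc G :\: walk l).
  split; first by apply/subsetP => p; rewrite inE => /andP[_ /(region_dart rA)].
  by move=> p; rewrite !in_setD; case: rA => _ ->; case: rW => _ ->.
have sE p : (p \in disc G :\: walk l) = (p \in disc G) (+) (p \in walk l).
  rewrite in_setD; case pW: (p \in walk l); last by rewrite addbF.
  by rewrite (subsetP sub _ pW).
have bE p : p \in darts G -> boundary (disc G :\: walk l) p =
    link (rim G) p.1 p.2 (+) link l p.1 p.2.
  move=> pD; rewrite -bA // -bW // /boundary !sE.
  by case: (_ \in _); case: (_ \in _); case: (_ \in _); case: (_ \in _).
split=> //; case: (sub_boundary ck rS) => // [p pD|S0].
  by rewrite bE //; apply: lk; apply: dartP.
have [|E|E] := region_no_boundary rS; first by move=> p /S0 ->.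
- case: nsub; apply/subsetP => p pA; apply: contraT => pW.
  by have := in_set0 p; rewrite -E in_setD pW pA.
- have aW := walk_next al; have := region_dart rW aW.
  by rewrite -E in_setD aW.
Qed.

Lemma interior_remove l k v : walk l \subset disc G -> bounds (disc G :\: walk l) k ->
  inn v -> v \notin l -> v \notin k -> v \in interior (disc G :\: walk l) k.
Proof.
move=> sub [rS _] iv vl vk; have [w vw] := has_nbr v.
apply: (interior_mem rS vk (u := w)); left; rewrite in_setD (inn_dart iv vw).1 andbT.
by rewrite inE /= (negPf vl).
Qed.

Lemma remove_face_not_good l k : walk l \subset disc G -> walk l != set0 ->
  good (disc G :\: walk l) k -> False.
Proof.
move=> sub l0 g; have [_ mA] := disc_min G; have := mA _ _ g; rewrite leqNgt => /negP; apply.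
apply: proper_card; rewrite properEneq subsetDl andbT; apply/eqP => /setP E.
case/set0Pn: l0 => p pl; have := E p; rewrite in_setD pl (subsetP sub _ pl) //.
Qed.

Lemma walk_neq0 l : facial_walk (@edge G) turn l -> walk l != set0.
Proof.
case=> + _; case: l => [|a r] // _; apply/set0Pn; exists (a, next (a :: r) a).
by rewrite walk_next // inE eqxx.
Qed.

Lemma disc_not_walk l : disc G \subset walk l -> False.
Proof.
move=> sub; have /set0Pn[v vi] := good_int (disc_good G).
have iv : inn v by [].
have [u [vu]] : exists u, edge v u /\ u != next l v.
  have [w vw] := has_nbr v; have [x [y [vx vy xw yw xy]]] := three_nbrs vw.
  have [E|] := eqVneq x (next l v); last by exists x.
  by exists y; rewrite -E.
have := subsetP sub _ (inn_dart iv vu).1; rewrite inE /= => /andP[_ ->].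
by [].
Qed.

(** The face would have the whole rim as its boundary and so be the disc, which contains a vertex
    with three neighbours. This excludes 5-faces that lose charge at all their edges. *)
Lemma all_rim_face l : facial_walk (@edge G) turn l -> walk l \subset disc G ->
  (forall u w, link l u w -> link (rim G) u w) -> False.
Proof.
move=> fl sub lk; have cl := facial_walk_cyc fl.
have [a al] := cyc_mem (facial_walk_cyc fl).
have [rA bA] := disc_bounds G; have aW := walk_next al; have aA := subsetP sub _ aW.
have ls : {subset l <= ivert G}.
  by apply: (cyc_ivert cl al); have := region_dart rA aA; rewrite !inE => /andP[].
have bW := facial_walk_bounds fl ls; have [rW bdW] := bW.
case: (sub_boundary (good_cyc (disc_good G)) rW) => [p pD|B0|BE].
- by rewrite bdW //; apply: lk.
- have := B0 _ (region_dart rA aA); rewrite bdW /=; last exact: region_dart rA aA.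
  by rewrite /link al eqxx.
have [E|E] : walk l = disc G \/ walk l = darts G :\: disc G.
  exact: (@bounds_eq _ _ _ (rim G)).
- by apply: (@disc_not_walk l); rewrite E.
- by move: aW; rewrite E in_setD aA.
Qed.

Section Corner.
Variables a b c d : G.
Hypothesis fl : facial_walk (@edge G) turn [:: a; b; c; d].
Hypothesis abA : (a, b) \in disc G.
Hypothesis lab : link (rim G) a b.
Hypothesis lbc : link (rim G) b c.
Local Notation l := [:: a; b; c; d].

Let ul : uniq l. Proof. exact/cyc_uniq/facial_walk_cyc. Qed.

Let walkA : walk l \subset disc G.
Proof.
by apply: (facial_walk_sub_disc fl (a := a)); rewrite ?inE ?eqxx //; have [-> _ _ _] := next4 ul.
Qed.

Let disc_walk := @disc_not_walk l.

(** If the rim has length 4, the disc would be the face itself. In a longer rim either a triangle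
    arises, or removing the face leaves a 4-cycle that still encloses all interior vertices, against
    minimality. *)
Lemma rim_corner_rim : d \in rim G -> False.
Proof.
move=> dr; have [e1 e2 e3 e4] := facial_walk4_edges fl.
have [ac bd] : a != c /\ b != d.
  by move: ul; rewrite /= !inE !negb_or => /and4P[/and3P[_ ? _] /andP[_ ?] _ _].
have [r [ct tm ts tl]] := rim_three lab lbc ac.
have ut := cyc_uniq ct; have := good_size (disc_good G); rewrite ts.
have dt : d \in a :: b :: c :: r by rewrite tm.
have da : d != a by apply: edge_neq.
have dc : d != c by rewrite eq_sym edge_neq.
move: dt; rewrite !inE (negPf da) (negPf dc) (eq_sym d) (negPf bd) /= => dr'.
have ad : edge a d by rewrite edgeC.
have kbad k : cyc k -> size k = 4 -> {subset k <= rim G} ->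
    (forall u w, edge u w -> link (rim G) u w (+) link l u w -> link k u w) -> False.
  move=> ck sk krim lk; have bS := remove_face fl walkA ck lk disc_walk.
  apply: (remove_face_not_good walkA (walk_neq0 fl) (k := k)).
  split; rewrite ?sk //; first by move=> x /krim/(good_sub (disc_good G)).
  have /set0Pn[v iv] := good_int (disc_good G); apply/set0Pn; exists v.
  have vr : v \notin rim G by apply: inn_nrim.
  apply: interior_remove bS iv _ _ => //; last by apply: contra vr => /krim.
  rewrite !inE !negb_or; have [[ar br] [_ cr]] := (link_mem lab, link_mem lbc).
  by apply/and4P; split; apply: contraNneq vr => ->.
case: r ct ut tm ts tl dr' => [|e [|f [|g [|? ?]]]] // ct ut tm ts tl + _.
- rewrite inE => /eqP E; subst e.
  have [rA bA] := disc_bounds G; have bW : bounds (walk l) l.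
    apply: (facial_walk_bounds fl) => x xl; apply: (good_sub (disc_good G)).
    by rewrite -tm.
  have [E|E] := bounds_eq bW (bounds_link (fun x y => esym (tl x y)) (disc_bounds G)).
    by apply: disc_walk; rewrite E.
  have aW : (a, next l a) \in walk l by rewrite walk_next // inE eqxx.
  have [n _ _ _] := next4 ul; rewrite n in aW.
  by move: aW; rewrite E inE abA.
- have /and3P[_ /= /and5P[_ _ ce ef /andP[fa _]] _] := ct.
  rewrite !inE => /orP[] /eqP E; [subst e|subst f].
    by apply: (no_triangle ef fa); rewrite edgeC.
  by apply: (no_triangle ce ef).
have /and3P[_ /= /and5P[_ _ ce ef /and3P[fg ga _]] _] := ct.
have lkE k : uniq k -> (forall u w, has (same_edge (u, w)) (zip (rcons [:: a, b, c, e, f & [:: g]] a)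
    (behead (rcons [:: a, b, c, e, f & [:: g]] a))) (+)
    has (same_edge (u, w)) (zip l (rot 1 l)) -> has (same_edge (u, w)) (zip k (rot 1 k))) ->
    forall u w, edge u w -> link (rim G) u w (+) link l u w -> link k u w.
  move=> uk H u w _; rewrite -tl !link_zip //; exact: H.
rewrite !inE => /or3P[] /eqP E; [subst e|subst f|subst g].
- have ck : cyc [:: a; d; f; g].
    apply: cyc4 => //.
      by move: ut; rewrite /= !inE !negb_or => /and5P[/and5P[_ _ _ ? _] _ _ _ _].
    by move: ut; rewrite /= !inE !negb_or => /and5P[_ _ _ /andP[_ ?] _].
  apply: (kbad [:: a; d; f; g]) => //.
  + by move=> x; rewrite -tm !inE => /or4P[] ->; rewrite ?orbT.
  + apply: lkE (cyc_uniq ck) _ => u w /=; rewrite (same_edgeC d a).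
    by do ![case: (same_edge (u, w) (_, _)) => //=].
- by apply: (no_triangle ce ef).
- have ck : cyc [:: c; e; f; d].
    apply: cyc4 => //; first by rewrite edgeC.
      by move: ut; rewrite /= !inE !negb_or => /and5P[_ _ /and3P[_ ? _] _ _].
    by move: ut; rewrite /= !inE !negb_or => /and5P[_ _ _ /andP[_ ?] _].
  apply: (kbad [:: c; e; f; d]) => //.
  + by move=> x; rewrite -tm !inE => /or4P[] ->; rewrite ?orbT.
  + apply: lkE (cyc_uniq ck) _ => u w /=; rewrite (same_edgeC d c).
    by do ![case: (same_edge (u, w) (_, _)) => //=].
Qed.

(** Removing the face replaces [b] by [d] on the rim, and only [d] stops being interior. The result
    is a smaller good disc unless nothing else was inside or a hexagon around a single vertex
    remains; in that last case the tetragram at [d] is secure. *)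
Lemma rim_corner_inn : ~~ bs d -> False.
Proof.
move=> nd; have [e1 e2 e3 e4] := facial_walk4_edges fl.
have [ac bd] : a != c /\ b != d.
  by move: ul; rewrite /= !inE !negb_or => /and4P[/and3P[_ ? _] /andP[_ ?] _ _].
have [r [ct tm ts tl]] := rim_three lab lbc ac.
have ut := cyc_uniq ct; have sz6 := good_size (disc_good G); rewrite ts in sz6.
have dr : d \notin rim G := nbs_nrim nd.
have [[ar br] [_ cr]] := (link_mem lab, link_mem lbc).
have dc : edge d c by rewrite edgeC.
have id : inn d.
  have dcl : cl c d.
    have cW : (c, next l c) \in walk l by rewrite walk_next // !inE eqxx !orbT.
    have [_ _ n3 _] := next4 ul; rewrite n3 in cW.
    by rewrite /cl (subsetP walkA _ cW).
  exact: cl_inn dcl dr.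
have dt : d \notin a :: b :: c :: r by rewrite tm.
set k := a :: d :: c :: r.
have ck : cyc k.
  case/and3P: ct => ut' et st; rewrite /cyc; apply/and3P; split=> //.
    move: ut' dt; rewrite /= !inE !negb_or.
    move=> /and4P[/and3P[_ -> ->] _ -> ->] /and4P[da _ -> ->].
    by rewrite eq_sym da.
  by move: et; rewrite /= dc [edge a d]edgeC e4 => /and3P[_ _ ->].
have krim x : x \in k -> (x \in rim G) || (x == d).
  by rewrite -tm !inE => /or4P[] ->; rewrite ?orbT.
have lk u w : edge u w -> link (rim G) u w (+) link l u w -> link k u w.
  move=> _; rewrite -tl !link_zip ?(cyc_uniq ck) // !rot1_cons /=.
  rewrite (same_edgeC c d) (same_edgeC d a).
  move: (same_edge _ (a, b)) (same_edge _ (b, c)) (same_edge _ (d, c)) (same_edge _ (a, d)).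
  by move: (has _ _) => h p1 p2 p3 p4; case: p1; case: p2; case: p3; case: p4; case: h.
have bS := remove_face fl walkA ck lk disc_walk.
have inS v : inn v -> v != d -> v \in interior (disc G :\: walk l) k.
  move=> iv vd; have vr := inn_nrim iv; apply: interior_remove bS iv _ _ => //.
    by rewrite !inE !negb_or vd andbT; apply/and3P; split; apply: contraNneq vr => ->.
  by apply: contra vr => /krim; rewrite (negPf vd) orbF.
have sk : size k = size (rim G) by rewrite ts.
have ks : {subset k <= ivert G}.
  apply: cyc_ivert ck (_ : a \in k) _; first by rewrite inE eqxx.
  exact: (good_sub (disc_good G) ar).
have ngood := remove_face_not_good walkA (walk_neq0 fl) (k := k).
(* If [d] is the only interior vertex, the rim has length at most 5, and a third neighbour of [d] on
   it produces a triangle. *)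
have [S0|S0] := eqVneq (interior (disc G :\: walk l) k) set0.
  have only v : inn v -> v = d.
    by move=> iv; apply/eqP/negPn/negP => /(inS v iv); rewrite S0 inE.
  have sz5 : size k <> 6.
    rewrite sk => s6; have /card_gt1P[x [y [xi yi]]] := good_six (disc_good G) s6.
    by rewrite (only x xi) (only y yi) eqxx.
  have [z [dz za zc]] := third_nbr e4 dc ac.
  have zt : z \in a :: b :: c :: r.
    rewrite tm; have /orP[//|/only E] := inn_rim_nbr id dz.
    by rewrite E edge_irr in dz.
  have zb : z != b by apply/eqP => E; subst z; apply: (no_triangle e4 e1).
  move: zt; rewrite !inE (negPf za) (negPf zb) (negPf zc) /=.
  have sz3 : size r <> 3 by move=> E; apply: sz5; rewrite /k /= E.
  case: (r) ct sz6 sz3 => [|e [|f [|? [|? ?]]]] //.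
    move=> /and3P[_ /= /and5P[_ _ ce ea _] _] _ _; rewrite inE => /eqP E; subst z.
    by apply: (no_triangle dc ce).
  move=> /and3P[_ /= /and5P[_ _ ce ef /andP[fa _]] _] _ _.
  rewrite !inE => /orP[] /eqP E; subst z; first exact: (no_triangle dc ce).
  by apply: (no_triangle e4 _ dz); rewrite edgeC.
(* The only way in which k fails to be good: a hexagon around a single vertex y. *)
have s6 : size k = 6.
  apply/eqP; apply: contraT => n6; case: ngood; split=> //; last by move/eqP; rewrite (negPf n6).
have in1 : #|interior (disc G :\: walk l) k| <= 1.
  rewrite leqNgt; apply/negP => gt1; case: ngood; split=> //.
have [y iy yd] : exists2 y, inn y & y != d.
  have /card_gt1P[x [y [xi yi xy]]] := good_six (disc_good G) (etrans (esym sk) s6).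
  have [E|] := eqVneq x d; last by exists x.
  by exists y; rewrite // -E eq_sym.
have yS := inS y iy yd.
have only v : inn v -> v != d -> v = y.
  by move=> iv vd; apply: interior_two in1 (inS v iv vd) yS.
have onk u : edge y u -> u \in k by apply: interior_nbr bS in1 yS.
have yr : y \notin rim G := inn_nrim iy.
have [e [f [g rE]]] : exists e f g, r = [:: e; f; g].
  by move: s6; rewrite /k; case: (r) => [|e [|f [|g [|? ?]]]] // _; exists e, f, g.
subst r.
have /and3P[_ /= /and5P[_ _ ce ef /and3P[fg ga _]] _] := ct.
have [[_ _ lce] [lef lfg lga]] := link6 ut; rewrite !tl in lce lef lfg lga.
have [er fr gr] : [/\ e \in rim G, f \in rim G & g \in rim G].
  by rewrite -!tm !inE !eqxx !orbT.
have nrim x : x \in rim G -> y != x by move=> xr; apply: contraNneq yr => ->.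
have drim x : x \in rim G -> d != x by move=> xr; apply: contraNneq dr => ->.
have tri u w : edge y u -> edge u w -> edge y w -> False.
  by move=> yu uw yw; apply: no_triangle yu uw yw.
(* Otherwise [y a d c] would be a second face with the corner [c d a]. *)
have nac : edge y a -> edge y c -> False.
  move=> ya yc; have f2 : facial edge turn [:: y; a; d; c].
    apply: four_facial iy ya _ _ _ yd ac; first by rewrite clC inn_cl.
      exact: inn_cl.
    by rewrite edgeC.
  have [_ _ l3 l4] := link4 ul; have [_ m2 m3 _] := link4 (cyc_uniq (facial_cyc f2)).
  have ca : c != a by rewrite eq_sym.
  have [E _] := facial_share (or_introl fl) f2 ca l3 l4 (linkW m3) (linkW m2).
  have := E y; rewrite !inE eqxx (negPf (nrim _ ar)) (negPf (nrim _ br)).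
  by rewrite (negPf (nrim _ cr)) (negPf yd).
have ynbr u : edge y u -> [|| u == a, u == d, u == c, u == e, u == f | u == g].
  by move=> /onk; rewrite !inE.
have nya : ~~ edge y a.
  apply/negP => ya; apply: (@not_two_nbrs _ y a (if edge y e then e else f)) => w yw.
  case/or4P: (ynbr w yw) => [||| /or3P[]] /eqP E; subst w; auto.
  - by case: (tri _ _ yw e4 ya).
  - by case: nac.
  - by rewrite yw; auto.
  - by case: ifP => ye; auto; case: (tri _ _ ye ef yw).
  - by case: (tri _ _ yw ga ya).
have nyc : ~~ edge y c.
  apply/negP => yc; apply: (@not_two_nbrs _ y c (if edge y f then f else g)) => w yw.
  case/or4P: (ynbr w yw) => [||| /or3P[]] /eqP E; subst w; auto.
  - by rewrite yw in nya.
  - by case: (tri _ _ yw dc yc).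
  - by case: (tri _ _ yc ce yw).
  - by rewrite yw; auto.
  - by case: ifP => yf; auto; case: (tri _ _ yf fg yw).
have nyf : ~~ edge y f.
  apply/negP => yf; apply: (@not_two_nbrs _ y d f) => w yw.
  case/or4P: (ynbr w yw) => [||| /or3P[]] /eqP E; subst w; auto.
  - by rewrite yw in nya.
  - by rewrite yw in nyc.
  - by case: (tri _ _ yw ef yf).
  - by case: (tri _ _ yf fg yw).
have ynbr3 u : edge y u -> [\/ u = d, u = e | u = g].
  move=> yu; case/or4P: (ynbr u yu) => [||| /or3P[]] /eqP E; subst u.
  - by rewrite yu in nya.
  - by constructor 1.
  - by rewrite yu in nyc.
  - by constructor 2.
  - by rewrite yu in nyf.
  - by constructor 3.
(* Having at least three neighbours, [y] is adjacent to [d], [e] and [g]: the hexagon is divided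
   into three 4-faces. *)
have [ydE yeE ygE] : [/\ edge y d, edge y e & edge y g].
  split; apply: contraT => n.
  - by case: (@not_two_nbrs _ y e g) => w yw; case: (ynbr3 w yw) => E; subst w; auto; rewrite yw in n.
  - by case: (@not_two_nbrs _ y d g) => w yw; case: (ynbr3 w yw) => E; subst w; auto; rewrite yw in n.
  - by case: (@not_two_nbrs _ y d e) => w yw; case: (ynbr3 w yw) => E; subst w; auto; rewrite yw in n.
have ndf : ~~ edge d f.
  apply/negP => df.
  have f3 : facial edge turn [:: y; d; f; e].
    apply: four_facial iy ydE _ _ _ (nrim f fr) (drim e er); first exact: inn_cl.
      by rewrite clC; apply: rim_cl.
    by rewrite edgeC.
  have eg : e != g by move: ut; rewrite /= !inE !negb_or => /and5P[_ _ _ /andP[_ ?] _].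
  have f4 : facial edge turn [:: y; e; f; g].
    apply: four_facial iy yeE _ _ _ (nrim f fr) eg; try exact: rim_cl.
    by rewrite edgeC.
  have [_ _ m3 m4] := link4 (cyc_uniq (facial_cyc f3)).
  have [n1 n2 _ _] := link4 (cyc_uniq (facial_cyc f4)).
  have [E _] := facial_share f3 f4 (nrim f fr) (linkW m4) (linkW m3) n1 n2.
  have := E d; rewrite !inE eqxx orbT (eq_sym d y) (negPf yd) (negPf (drim e er)).
  by rewrite (negPf (drim f fr)) (negPf (drim g gr)).
have ad : edge a d by rewrite edgeC.
have cd : edge c d by [].
have dnbr w : edge d w -> w \in [set a; c; y].
  move=> dw; have nd' : w != d by rewrite eq_sym edge_neq.
  have /orP[wr|iw] := inn_rim_nbr id dw; last by rewrite (only w iw nd') !inE eqxx !orbT.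
  move: wr; rewrite -tm !inE => /or4P[|||/or3P[]] /eqP E; subst w; rewrite ?eqxx ?orbT //.
  - by case: (no_triangle e4 e1 dw).
  - by case: (no_triangle dc ce dw).
  - by rewrite dw in ndf.
  - by case: (no_triangle dw ga e4).
have dy : edge d y by rewrite edgeC.
have d3 : deg edge d = 3.
  apply/eqP; rewrite eqn_leq (@deg_gt2 G d) andbT.
  have sub : [set w | edge d w] \subset [set a; c; y].
    by apply/subsetP => w; rewrite inE => /dnbr.
  apply: leq_trans (subset_leq_card sub) _.
  by rewrite -setUA cardsU1 cards2; case: (_ \in _); case: (_ == _).
have ny : ~~ bs y.
  rewrite /big_or_rim (negPf yr) orbF /big -ltnNge.
  have sub : [set w | edge y w] \subset [:: a; d; c; e; f; g].
    by apply/subsetP => w; rewrite inE => /onk.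
  exact: leq_ltn_trans (leq_trans (subset_leq_card sub) (card_size _)) _.
have fl3 : facial edge turn [:: d; a; b; c] := facial_rot 3 (or_introl fl).
(* Neighbours of [y] in [big_or_rim] can only be [e] and [g], which are joined to [c] and [a] along
   the rim. The last hypothesis of [insecure_tetragram] allows exactly this. *)
apply: (insecure_tetragram id d3 fl3 dy _ _ ny); rewrite ?nrim // => _ w yw bw.
case: (ynbr3 w yw) => E; subst w.
- by rewrite bw in nd.
- by rewrite [cl e c]clC (rim_cl lce) orbT.
- by rewrite (rim_cl lga).
Qed.

End Corner.

End RimCorners.

(** * Discharging *)

Section Discharging.
Variable G : insecureDisc.
Implicit Types (a b c d e f g u v w x y z : G) (k : seq G) (p : G * G).
Local Notation bs := (@big_or_rim G).

(* Charges are counted in units of 1/60. Every inner dart gives 60 to its tail,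
   every dart of the disc gives 60 to its face, and 240 is needed at every
   interior vertex and every face. For a dart p, vgain p and vloss p are the
   amounts that the tail of p receives and sends at p, and fgain p and floss p
   are those of the face of p. The rules are as follows.
   - A vertex v in bs sends 36 to each neighbour not in bs and 10 to both faces
     of each inner edge at v; a face loses 20 at each edge of the rim.
   - A vertex not in bs sends share v to each neighbour not in bs (12 or 5 if it
     has at least two or exactly one neighbour in bs).
   - A face of length at least 5 sends 20 to each of its cubic vertices.
   - A noncubic vertex sends spare to a corner without neighbours in bs; a 4-face
     passes this on to the opposite vertex. A 4-face with just one vertex in bs
     sends the 20 that it has received to the opposite vertex.
   - A cubic vertex sends to a face what its neighbour outside of that face
     provides in excess (across). *)
Definition nbig v := #|[set w | edge v w & bs w]|.
Definition nquad v := #|[set w | edge v w & flen (v, w) == 4]|.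
Definition share v :=
  if 1 < nbig v then 12
  else if (nbig v == 1) && ~~ ((deg edge v == 3) && (1 < nquad v)) then 5 else 0.
Definition opp p := next_dart (next_dart p).
Definition cubic p := ~~ bs p.1 && (deg edge p.1 == 3).
(* In a cubic vertex, turn p.1 p.2 is the neighbour that does not bound the corner of p. *)
Definition across p :=
  if cubic p then
    if nbig p.1 == 0 then share (turn p.1 p.2)
    else if [&& nbig p.1 == 1, bs (turn p.1 p.2) & nquad p.1 <= 1] then 26 - 20 * nquad p.1
    else 0
  else 0.
Definition spare p := [&& ~~ bs p.1, 3 < deg edge p.1, 0 < nbig p.1, ~~ bs p.2
  & ~~ bs (turnback p.1 p.2)].
Definition to_opp p :=
  if (flen p == 4) && ~~ bs (opp p).1 then
    if [&& bs p.1, ~~ bs p.2 & ~~ bs (turnback p.1 p.2)] then 20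
    else 10 * spare p
  else 0.
Definition long_cubic p := cubic p && (4 < flen p).

Definition vgain p := 36 * (~~ bs p.1 && bs p.2) + (~~ bs p.1 && ~~ bs p.2) * share p.2 +
  20 * long_cubic p + to_opp (opp p).
Definition vloss p := 20 * bs p.1 + 36 * (bs p.1 && ~~ bs p.2) +
  (~~ bs p.1 && ~~ bs p.2) * share p.1 + across p + 10 * spare p.
Definition fgain p := (p \in inner (disc G)) * (10 * bs p.1 + 10 * bs p.2) +
  across p + 10 * spare p.
Definition floss p := 20 * link (rim G) p.1 p.2 + 20 * long_cubic p + to_opp p.

Definition vertex_pays v :=
  240 + \sum_(w | edge v w) vloss (v, w) <= \sum_(w | edge v w) (60 + vgain (v, w)).
Definition face_pays p :=
  240 + \sum_(i < flen p) floss (iter i (@next_dart G) p) <=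
  \sum_(i < flen p) (60 + fgain (iter i (@next_dart G) p)).

(** The form in which [insecure_tetragram] enters the discharging: a cubic corner of a 4-face has
    one donor across the face and another behind its third neighbour. *)
Lemma tetra_big v a d b c : inn v -> deg edge v = 3 -> facial edge turn [:: v; a; d; b] ->
  edge v c -> c != a -> c != b -> ~~ bs c ->
  bs d /\ exists w, [/\ edge c w, bs w, ~~ cl w a & ~~ cl w b].
Proof.
move=> iv d3 fk vc ca cb nc; case bd: (bs d); last first.
  by case: (insecure_tetragram iv d3 fk vc ca cb nc); rewrite bd.
split=> //; apply: NNPP => H; apply: (insecure_tetragram iv d3 fk vc ca cb nc) => _ w cw bw.
apply: contraT; rewrite negb_or => /andP[wa wb]; case: H; exists w; split=> //.
Qed.

Lemma facial_walk_turn (l : seq G) x : facial_walk (@edge G) turn l -> x \in l ->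
  turn (next l x) x = next l (next l x).
Proof. by case=> _ [_ fl] /fl[_ []]. Qed.

Lemma corner4 v w : edge v w -> flen (v, w) = 4 -> exists d u,
  [/\ facial_walk (@edge G) turn [:: v; w; d; u], turn v u = w, opp (v, w) = (d, u),
      turnback d u = w & opp (d, u) = (v, w)].
Proof.
move=> vw f4; have [d [u fw]] := facial_walk4 vw f4; exists d, u.
have [_ [us _]] := fw; have [n1 n2 n3 n4] := next4 us.
have T x := @facial_walk_turn [:: v; w; d; u] x fw.
have [e1 e2 e3 e4] := facial_walk4_edges fw.
have := T v; have := T w; have := T d; have := T u.
rewrite !(n1, n2, n3, n4) !inE !eqxx ?orbT => /(_ isT) t4 /(_ isT) t3 /(_ isT) t2 /(_ isT) t1.
split=> //.
- by rewrite /opp !next_dartE ?t1 ?t2.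
- by rewrite -t2 turnK // edgeC.
- by rewrite /opp !next_dartE ?t3 ?t4.
Qed.

Lemma to_opp4 d u v w : flen (d, u) = 4 -> opp (d, u) = (v, w) -> turnback d u = w ->
  to_opp (d, u) = if bs v then 0 else if [&& bs d, ~~ bs u & ~~ bs w] then 20
    else 10 * spare (d, u).
Proof. by move=> f4 ov tb; rewrite /to_opp f4 ov /= tb; case: (bs v). Qed.

Lemma flen_opp p : flen (opp p) = flen p.
Proof. by rewrite /opp !flen_next. Qed.

Lemma nbig_pos v w : edge v w -> bs w -> 0 < nbig v.
Proof. by move=> vw bw; apply/card_gt0P; exists w; rewrite inE vw. Qed.

Lemma nbig_two v w x : edge v w -> bs w -> edge v x -> bs x -> w != x -> 1 < nbig v.
Proof.
move=> vw bw vx bx wx; apply/card_gt1P; exists w, x.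
by split; rewrite // inE ?vw ?vx.
Qed.

Lemma share_two v : 1 < nbig v -> share v = 12.
Proof. by rewrite /share => ->. Qed.

Lemma share0 v : 0 < nbig v -> share v < 5 ->
  [/\ nbig v = 1, deg edge v = 3 & 1 < nquad v].
Proof.
move=> b0; rewrite /share; case: (ltnP 1 (nbig v)) => // b1.
have -> : nbig v = 1 by apply/eqP; rewrite eqn_leq b1.
rewrite eqxx /=; by case: andP => [[/eqP d3 q2] _|]; first by split.
Qed.

Lemma sum_deg3 v a b c (F : G -> nat) : deg edge v = 3 -> edge v a -> edge v b -> edge v c ->
  a != b -> a != c -> b != c -> \sum_(w | edge v w) F w = F a + F b + F c.
Proof.
move=> d3 va vb vc ab ac bc.
rewrite (eq_bigl (fun w => w \in [:: a; b; c])); last first.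
  move=> w; rewrite !inE; apply/idP/idP; first exact: deg3_nbr.
  by case/or3P => /eqP ->.
rewrite -big_uniq /=; last by rewrite !inE negb_or ab ac bc.
by rewrite !big_cons big_nil addn0 addnA.
Qed.

Lemma nbig_deg3 v a b c : deg edge v = 3 -> edge v a -> edge v b -> edge v c ->
  a != b -> a != c -> b != c -> nbig v = bs a + bs b + bs c.
Proof.
move=> d3 va vb vc ab ac bc; rewrite /nbig -sum1dep_card big_mkcondr /=.
by rewrite (sum_deg3 _ d3 va vb vc) //; do 3!case: (bs _).
Qed.

Lemma nquad_deg3 v a b c : deg edge v = 3 -> edge v a -> edge v b -> edge v c ->
  a != b -> a != c -> b != c ->
  nquad v = (flen (v, a) == 4) + (flen (v, b) == 4) + (flen (v, c) == 4).
Proof.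
move=> d3 va vb vc ab ac bc; rewrite /nquad -sum1dep_card big_mkcondr /=.
by rewrite (sum_deg3 _ d3 va vb vc) //; do 3!case: (_ == 4).
Qed.

Lemma deg3_frame v a : deg edge v = 3 -> edge v a -> exists b c,
  [/\ [/\ edge v b, edge v c, a != b, a != c & b != c],
      [/\ turn v a = b, turn v b = c & turn v c = a] &
      [/\ turnback v b = a, turnback v c = b & turnback v a = c]].
Proof.
move=> d3 va; have vb := turn_edge va; have vc := turn_edge vb.
have ab : a != turn v a by rewrite eq_sym turn_neq.
have bc : turn v a != turn v (turn v a) by rewrite eq_sym turn_neq.
have ac : a != turn v (turn v a) by rewrite eq_sym turn2_neq.
have [tb tc] := deg3_turn d3 va vb vc ab ac bc erefl.
exists (turn v a), (turn v (turn v a)); split=> //.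
by split; rewrite ?turnK // -{1}tc turnK.
Qed.

Lemma inn_darts v w : inn v -> edge v w -> (v, w) \in darts G.
Proof. by move=> iv vw; apply: region_dart (disc_region G) (inn_dart iv vw).1. Qed.

Lemma flen_long v w : inn v -> edge v w -> (4 < flen (v, w)) = (flen (v, w) != 4).
Proof.
move=> iv vw; have := flen_gt3 (inn_darts iv vw).
by rewrite [4 < _]ltn_neqAle eq_sym => ->; rewrite andbT.
Qed.

Lemma insecure_octagram a b c d : facial edge turn [:: a; b; c; d] -> deg edge a = 3 ->
  deg edge b = 3 -> deg edge c = 3 -> deg edge d = 3 -> False.
Proof.
move=> fk da db dc dd; case: (@insecure G); constructor 3; exists a, b, c, d.
by split; [split | rewrite /secure_octagram]; rewrite //= /small da db dc dd.
Qed.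

(** * Final charge of vertices *)

Section CubicVertex.
Variable v : G.
Hypothesis iv : inn v.
Hypothesis nv : ~~ bs v.
Hypothesis d3 : deg edge v = 3.

Lemma vgain_cubic w : edge v w ->
  vgain (v, w) = 36 * bs w + ~~ bs w * share w + 20 * (flen (v, w) != 4) + to_opp (opp (v, w)).
Proof.
move=> vw; rewrite /vgain /long_cubic /cubic /= nv d3 /= flen_long //.
Qed.

Lemma vloss_cubic w : edge v w ->
  vloss (v, w) = ~~ bs w * share v + across (v, w).
Proof.
move=> vw; rewrite /vloss /spare /= nv d3 (negPf nv) /=.
by rewrite !muln0 addn0.
Qed.

Lemma nbig0 w : nbig v = 0 -> edge v w -> ~~ bs w.
Proof.
by move=> b0 vw; apply/negP => bw; have := nbig_pos vw bw; rewrite b0.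
Qed.

(** A cubic vertex has 180 and needs 240. Here each of its faces provides 20: a long face directly,
    a 4-face because [tetra_big] puts its opposite vertex in [big_or_rim]. What the neighbours send
    is passed on by [across]. *)
Lemma discharge_cubic0 : nbig v = 0 -> vertex_pays v.
Proof.
rewrite /vertex_pays => b0; have s0 : share v = 0 by rewrite /share b0.
have le w : edge v w -> share w + 80 <= 60 + vgain (v, w).
  move=> vw; have nw := nbig0 b0 vw; rewrite vgain_cubic // nw (negPf nw).
  suff : 20 <= 20 * (flen (v, w) != 4) + to_opp (opp (v, w)).
    by move: (to_opp _) (share _) => x y; lia.
  case: eqP => // f4; have [d [u [fw tu oE tb oE']]] := corner4 vw f4.
  have [e1 e2 e3 e4] := facial_walk4_edges fw.
  have vu : edge v u by rewrite edgeC.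
  have wu : w != u by rewrite -tu turn_neq.
  have [c [vc cw cu]] := third_nbr vw vu wu.
  have [bd _] := tetra_big iv d3 (or_introl fw) vc cw cu (nbig0 b0 vc).
  have f4' : flen (d, u) = 4 by rewrite -oE flen_opp.
  by rewrite oE (to_opp4 f4' oE' tb) (negPf nv) bd (nbig0 b0 vu) nw.
apply: leq_trans (_ : \sum_(w | edge v w) (share w + 80) <= _); last exact: leq_sum.
rewrite [X in _ <= X]big_split /= sum_nat_cond_const -/(deg edge v) d3 addnC.
rewrite leq_add2r; rewrite [X in _ <= X]reindex_turn; apply: leq_sum => w vw.
by rewrite vloss_cubic // s0 muln0 /across /cubic /= nv d3 b0.
Qed.

(** Two neighbours in [big_or_rim] give 72; the vertex keeps 60 and has 12 for the third, whence the
    12 in [share]. *)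
Lemma discharge_cubic2 : 1 < nbig v -> vertex_pays v.
Proof.
rewrite /vertex_pays => b2; have [a va] := has_nbr v.
have [b [c [[vb vc ab ac bc] _ _]]] := deg3_frame d3 va.
rewrite !(sum_deg3 _ d3 va vb vc) // !vgain_cubic // !vloss_cubic // (share_two b2).
have ac0 w : across (v, w) = 0.
  rewrite /across; case: ifP => // _; move: b2; rewrite /=.
  by case: (nbig v) => [|[|n]].
rewrite !ac0; move: b2; rewrite (nbig_deg3 d3 va vb vc ab ac bc).
move: (share a) (share b) (share c) (to_opp _) (to_opp _) (to_opp _) => s1 s2 s3 o1 o2 o3.
move: (20 * _) (20 * _) (20 * _) => q1 q2 q3.
by case: (bs a); case: (bs b); case: (bs c) => // _; rewrite /=; clear; lia.
Qed.

Section OneBig.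
Variables a b c : G.
Hypotheses (va : edge v a) (vb : edge v b) (vc : edge v c).
Hypotheses (ab : a != b) (ac : a != c) (bc : b != c).
Hypotheses (tva : turn v a = b) (tvb : turn v b = c) (tvc : turn v c = a).
Hypotheses (ba : bs a) (nb : ~~ bs b) (nc : ~~ bs c).
Hypothesis b1 : nbig v = 1.

Lemma quad_corner w x y : edge v w -> edge v x -> edge v y -> y != w -> y != x ->
  turn v x = w -> ~~ bs y -> flen (v, w) = 4 ->
  exists d z, [/\ facial_walk (@edge G) turn [:: v; w; d; x], bs d, cl w d & cl d x] /\
    [/\ edge y z, bs z, ~~ cl z w & ~~ cl z x].
Proof.
move=> vw vx vy yw yx txw ny f4; have [d [u [fw tu _ _ _]]] := corner4 vw f4.
have [e1 e2 e3 e4] := facial_walk4_edges fw.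
have ux : u = x by apply: (@turn_inj _ v); rewrite ?txw // edgeC.
subst u; have [bd [z zP]] := tetra_big iv d3 (or_introl fw) vy yw yx ny.
have [_ l2 l3 _] := link4 (cyc_uniq (facial_walk_cyc fw)).
have clk s t : link [:: v; w; d; x] s t -> cl s t.
  by apply: (facial_cl (or_introl fw) _ iv); rewrite inE eqxx.
by exists d, z; split=> //; split=> //; apply: clk.
Qed.

(** The vertex opposite to [v] is next to [b], and [tetra_big] finds a donor next to [c]. If the
    face of [(v, a)] has length 4 too, the roles of [b] and [c] are exchanged; the donors differ
    because one is joined to [a] in the disc and the other is not. *)
Lemma side_quad_left : flen (v, b) = 4 -> [/\ 0 < nbig b, 0 < nbig c &
  flen (v, a) = 4 -> 1 < nbig b /\ 1 < nbig c].
Proof.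
move=> fb; have [||d [w [[_ bd cbd cda] [cw bw wb wa]]]] := quad_corner vb va vc _ _ tva nc fb.
- by rewrite eq_sym.
- by rewrite eq_sym.
have bd' := cl_edge cbd; split; [exact: nbig_pos bd' bd | exact: nbig_pos cw bw | move=> fa].
have [||d' [w' [[_ bd2 cad' cdc'] [bw' bbw' wa' wc']]]] := quad_corner va vc vb _ _ tvc nb fa => //.
  by rewrite eq_sym.
split.
- apply: (nbig_two bd' bd bw' bbw'); apply: contraNneq wa' => <-; exact: cda.
- have cd' : edge c d' by rewrite edgeC; apply: cl_edge.
  apply: (nbig_two cd' bd2 cw bw); apply: contraNneq wa => <-; by rewrite clC.
Qed.

Lemma side_quad_right : flen (v, a) = 4 -> 0 < nbig b /\ 0 < nbig c.
Proof.
move=> fa.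
have [||d [w [[_ bd cad cdc] [bw bbw _ _]]]] := quad_corner va vc vb _ _ tvc nb fa => //.
  by rewrite eq_sym.
have cd : edge c d by rewrite edgeC; apply: cl_edge.
by split; [exact: nbig_pos bw bbw | exact: nbig_pos cd bd].
Qed.

(** If both shares are below 5, then [b] and [c] are cubic. The opposite vertex [d] is in
    [big_or_rim], or else it is noncubic because octagrams are insecure, and a second 4-face at [b]
    or [c] gives it a neighbour in [big_or_rim]. Either way it sends at least 10. *)
Lemma middle_quad : flen (v, c) = 4 -> 0 < nbig b -> 0 < nbig c ->
  (flen (v, a) != 4) || (flen (v, b) != 4) ->
  4 <= share b + share c + to_opp (opp (v, c)).
Proof.
move=> fc bb0 bc0 nfab.
case: (leqP 5 (share b)) => sb; first by apply: leq_trans (ltnW sb) _; rewrite -addnA leq_addr.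
case: (leqP 5 (share c)) => sc; first by apply: leq_trans (ltnW sc) _; rewrite -addnA addnCA leq_addr.
have [bb1 db qb] := share0 bb0 sb; have [bc1 dc qc] := share0 bc0 sc.
apply: leq_trans (leq_addl _ _).
have [d [u [fw tu oE tb oE']]] := corner4 vc fc.
have [e1 e2 e3 e4] := facial_walk4_edges fw.
have ub : u = b by apply: (@turn_inj _ v); rewrite ?tvb // edgeC.
subst u; have f4' : flen (d, b) = 4 by rewrite -oE flen_opp.
rewrite oE (to_opp4 f4' oE' tb) (negPf nv) nb nc !andbT.
case bd: (bs d) => //.
have ib := nbs_inn iv vb nb; have ic := nbs_inn iv vc nc.
have ndd : ~~ bs d by rewrite bd.
have id := nbs_inn ic e2 ndd.
have d4 : 3 < deg edge d.
  rewrite ltn_neqAle (@deg_gt2 G d) andbT; apply/eqP => E.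
  exact: (insecure_octagram (or_introl fw) d3 dc (esym E) db).
have [_ [us _]] := fw; have [n1 n2 n3 n4] := next4 us.
have tcv : turn c v = d by have := facial_walk_turn fw (mem_head _ _); rewrite n1 n2.
have tbd : turn b d = v.
  have dl : d \in [:: v; c; d; b] by rewrite !inE eqxx !orbT.
  by have := facial_walk_turn fw dl; rewrite n3 n4.
have cv : edge c v by rewrite edgeC.
have bv : edge b v by rewrite edgeC.
have bd' : edge b d by rewrite edgeC.
suff bd0 : 0 < nbig d by rewrite /spare /= bd d4 bd0 nb tb nc.
case/orP: nfab => nf.
- have [d' [z [[cd' cz vd' vz dz] [t1 t2 t3] _]]] := deg3_frame dc cv.
  rewrite tcv in t1; subst d'.
  have fz : flen (c, z) = 4.
    move: qc; rewrite (nquad_deg3 dc cv cd' cz) //.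
    have -> : flen (c, v) = flen (v, a) by rewrite -(flen_next (c, v)) next_dartE // tvc.
    by rewrite (negPf nf); case: (flen (c, z) =P 4) => //; case: (_ == 4).
  have [d2 [u [fw2 tu2 _ _ _]]] := corner4 cz fz.
  have [e1' e2' e3' e4'] := facial_walk4_edges fw2.
  have ud : u = d by apply: (@turn_inj _ c); rewrite ?t2 // edgeC.
  subst u; have [bd2 _] := tetra_big ic dc (or_introl fw2) cv vz vd' nv.
  by apply: (nbig_pos (w := d2)); rewrite // edgeC.
- have [d' [z [[bd2 bz vd' vz dz] [t1 t2 t3] _]]] := deg3_frame db bd'.
  rewrite tbd in t1; subst d'.
  have fz : flen (b, d) = 4.
    move: qb; rewrite (nquad_deg3 db bd' bv bz) //.
    have -> : flen (b, z) = flen (v, b) by rewrite -(flen_next (v, b)) next_dartE // t2.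
    by rewrite (negPf nf) addn0; case: (flen (b, d) =P 4) => //; case: (_ == 4).
  have [d2 [u [fw2 tu2 _ _ _]]] := corner4 bd' fz.
  have [e1' e2' e3' e4'] := facial_walk4_edges fw2.
  have uz : u = z by apply: (@turn_inj _ b); rewrite ?t3 // edgeC.
  subst u; have vd : v != d by rewrite eq_sym.
  have [bd3 _] := tetra_big ib db (or_introl fw2) bv vd dz nv.
  exact: nbig_pos e2' bd3.
Qed.

(** With q 4-faces at [v], the 36 from [a] and the 20 from each long face exceed the missing 60 by
    36 - 20q. For q at most 1 this is 5 + 5 + (26 - 20q), the amounts in [share] and [across]. For q
    = 2 the vertex lacks 4, for q = 3 it lacks 24 = 12 + 12, supplied by [b], [c] and the face
    between them. *)
Lemma discharge_cubic1 : vertex_pays v.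
Proof.
rewrite /vertex_pays !(sum_deg3 _ d3 va vb vc) // !vgain_cubic // !vloss_cubic //.
rewrite ba nb nc (negPf nb) (negPf nc) /=.
have qE := nquad_deg3 d3 va vb vc ab ac bc.
have acE w : across (v, w) = if bs (turn v w) && (nquad v <= 1) then 26 - 20 * nquad v else 0.
  by rewrite /across /cubic /= nv d3 b1.
have sv : share v = if nquad v <= 1 then 5 else 0.
  by rewrite /share b1 d3 /= [nquad v <= 1]leqNgt.
rewrite !acE sv tva tvb tvc ba (negPf nb) (negPf nc) /=.
case: (leqP (nquad v) 1) => q1.
  move: q1; rewrite qE; move: (share b) (share c) (to_opp _) (to_opp _) (to_opp _).
  by clear; do 3!case: (_ == 4); rewrite //= => *; lia.
have key : 20 * nquad v <= 36 + share b + share c + to_opp (opp (v, c)).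
  move: q1; rewrite qE; case: (flen (v, b) =P 4) => [fb|/eqP fb].
    have [bb0 bc0 two] := side_quad_left fb; case: (flen (v, a) =P 4) => [fa|/eqP fa].
      have [bb2 bc2] := two fa; rewrite !share_two // => _.
      by apply: leq_trans (leq_addr _ _); case: (_ == 4).
    case: (flen (v, c) =P 4) => // fc _; have := middle_quad fc bb0 bc0; rewrite fa => /(_ isT).
    by rewrite -!addnA; move: (_ + _) => x; clear; lia.
  case: (flen (v, a) =P 4) => [fa|_]; case: (flen (v, c) =P 4) => // fc _.
  have [bb0 bc0] := side_quad_right fa; have := middle_quad fc bb0 bc0.
  rewrite fb orbT => /(_ isT).
  by rewrite -!addnA; move: (_ + _) => x; clear; lia.
move: key; rewrite qE.
move: (share b) (share c) (to_opp (opp (v, a))) (to_opp (opp (v, b))) (to_opp (opp (v, c))).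
by clear; do 3!case: (_ == 4); rewrite /= => *; lia.
Qed.

End OneBig.

Lemma discharge_cubic : vertex_pays v.
Proof.
case: (ltngtP 1 (nbig v)) => [b2|b0|b1].
- exact: discharge_cubic2.
- by apply: discharge_cubic0; move: b0; case: (nbig v).
have /card_gt0P[a] : 0 < nbig v by rewrite -b1.
rewrite inE => /andP[va ba].
have [b [c [[vb vc ab ac bc] [t1 t2 t3] _]]] := deg3_frame d3 va.
have := nbig_deg3 d3 va vb vc ab ac bc; rewrite -b1 ba.
case nb: (bs b); case nc: (bs c) => // _.
by apply: (discharge_cubic1 va vb vc) => //; rewrite ?nb ?nc.
Qed.

End CubicVertex.

Lemma vloss_bs p : bs p.1 -> vloss p <= 56.
Proof.
by move=> bp; rewrite /vloss /across /cubic /spare bp /=; case: (bs p.2).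
Qed.

(** At most 20 + 36 of the 60 units of an edge leave, so 60 edges retain 60 * 4 = 240. *)
Lemma discharge_big v : inn v -> bs v -> vertex_pays v.
Proof.
rewrite /vertex_pays => iv bv; have d60 : 60 <= deg edge v.
  by move: bv; rewrite /big_or_rim (negPf (inn_nrim iv)) orbF.
apply: leq_trans (_ : \sum_(w | edge v w) (4 + vloss (v, w)) <= _).
  rewrite [X in _ <= X]big_split /= leq_add2r sum_nat_cond_const -/(deg edge v).
  by rewrite (leq_mul2r 4 60).
apply: leq_sum => w vw; apply: leq_trans (leq_addr _ _).
by rewrite -[60]/(4 + 56) leq_add2l vloss_bs.
Qed.

Lemma sum_bs v : \sum_(w | edge v w) bs w = nbig v.
Proof.
by rewrite /nbig -sum1dep_card big_mkcondr; apply: eq_bigr => w _; case: (bs w).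
Qed.

Lemma sum_nbs v : \sum_(w | edge v w) ~~ bs w + nbig v = deg edge v.
Proof.
rewrite -sum_bs -big_split /= -[RHS]muln1 -[RHS](sum_nat_cond_const _ 1).
by apply: eq_bigr => w _; case: (bs w).
Qed.

(** The two corners next to the neighbour in [big_or_rim] are not spare. *)
Lemma sum_spare v : nbig v = 1 -> \sum_(w | edge v w) spare (v, w) + 2 <= deg edge v.
Proof.
move=> b1; have /card_gt0P[a] : 0 < nbig v by rewrite b1.
rewrite inE => /andP[va ba]; have vb := turn_edge va; have nab := turn_neq va.
have -> : \sum_(w | edge v w) spare (v, w) = #|[set w | edge v w & spare (v, w)]|.
  by rewrite -sum1dep_card big_mkcondr; apply: eq_bigr => w _; case: (spare _).
rewrite /deg -(cardsID [set w | edge v w & spare (v, w)] [set w | edge v w]).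
apply: leq_add.
  by apply: subset_leq_card; apply/subsetP => w; rewrite !inE => /andP[-> ->].
have -> : 2 = #|[set a; turn v a]| by rewrite cards2 eq_sym nab.
apply: subset_leq_card; apply/subsetP => w; rewrite !inE => /orP[] /eqP ->.
  by rewrite va /= /spare /= ba !andbF.
by rewrite vb /= /spare /= turnK // ba !andbF.
Qed.

(** The critical case is degree 4 with one neighbour in [big_or_rim]: 276 units, less three shares
    of 5 and two spare corners of 10, leave 241. *)
Lemma discharge_deg4 v : inn v -> ~~ bs v -> 3 < deg edge v -> vertex_pays v.
Proof.
rewrite /vertex_pays => iv nv d4.
have nd3 : (deg edge v == 3) = false by rewrite eq_sym ltn_eqF.
have lossE : \sum_(w | edge v w) vloss (v, w) =
    share v * (\sum_(w | edge v w) ~~ bs w) + 10 * \sum_(w | edge v w) spare (v, w).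
  rewrite !big_distrr -big_split /=; apply: eq_bigr => w _.
  rewrite /vloss /across /cubic /= nv nd3 (negPf nv) /=.
  by rewrite !muln0 addn0 mulnC.
have gain : 60 * deg edge v + 36 * nbig v <= \sum_(w | edge v w) (60 + vgain (v, w)).
  rewrite [X in _ <= X]big_split /= sum_nat_cond_const -/(deg edge v) mulnC leq_add2l.
  rewrite -sum_bs big_distrr /=; apply: leq_sum => w _.
  by rewrite /vgain /= nv /=; do 2!apply: leq_trans (leq_addr _ _); apply: leq_addr.
apply: leq_trans gain; rewrite lossE.
have [b0|b0] := posnP (nbig v).
  rewrite {1}/share b0 mul0n add0n big1 ?muln0 ?addn0; last first.
    by move=> w _; rewrite /spare /= b0 !andbF.
  by rewrite (leq_mul2l 60 4).
have dE := sum_nbs v.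
have le : \sum_(w | edge v w) spare (v, w) <= \sum_(w | edge v w) ~~ bs w.
  apply: leq_sum => w _; rewrite /spare /=; case: (bs w) => /=; first by rewrite !andbF.
  exact: leq_b1.
move: dE le d4 (@sum_spare v); rewrite /share nd3 /=.
move: (\sum_(w | _) _) (\sum_(w | _) _) => x y.
move: (deg edge v) (nbig v) b0 => d [|[|n]] // _; rewrite /=.
  by move=> E le d4 /(_ erefl); clear -E le d4; lia.
by move=> E le d4 _; clear -E le d4; lia.
Qed.

End Discharging.

(** * Final charge of faces of length 4 or at least 6 *)

Section FaceDischarging.
Variable G : insecureDisc.
Implicit Types (a b c d e f g u v w x y z : G) (k : seq G) (p : G * G).
Local Notation bs := (@big_or_rim G).

Lemma link_rim_bs u w : link (rim G) u w -> bs u /\ bs w.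
Proof. by move=> /link_mem[ur wr]; rewrite /big_or_rim ur wr !orbT. Qed.

Lemma disc_inner p : p \in disc G -> (p \in inner (disc G)) = ~~ link (rim G) p.1 p.2.
Proof.
move=> pA; have [rA bA] := disc_bounds G; rewrite -bA ?(region_dart rA) //.
by rewrite inE /boundary pA /= negbK.
Qed.

(** Every dart is worth at least 40. An inner dart with its tail in [big_or_rim] saves the 20 for a
    cubic vertex and receives 10; a head in [big_or_rim] brings another 10. *)
Lemma net_long p : p \in disc G -> 4 < flen p ->
  floss p + (if link (rim G) p.1 p.2 then 40 else 40 + 30 * bs p.1 + 10 * bs p.2) <=
  60 + fgain p.
Proof.
move=> pA f5; have o0 : to_opp p = 0 by rewrite /to_opp gtn_eqF.
rewrite /floss /fgain o0 disc_inner // addn0.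
case lk: (link _ _ _); rewrite /= ?mul0n ?mul1n.
  have [bp _] := link_rim_bs lk; rewrite /long_cubic /cubic bp /=.
  by move: (across p) (spare p) => x y; clear; lia.
have : long_cubic p <= ~~ bs p.1 by rewrite /long_cubic /cubic; case: (bs p.1) => //=; apply: leq_b1.
move: (long_cubic p : nat) (across p) (spare p : nat) => l x y.
by case: (bs p.1); case: (bs p.2); rewrite /=; clear; lia.
Qed.

Lemma discharge_long_face p : p \in disc G -> 5 < flen p -> face_pays p.
Proof.
rewrite /face_pays => pA f6.
apply: leq_trans (_ : \sum_(i < flen p) (40 + floss (iter i (@next_dart G) p)) <= _).
  rewrite [X in _ <= X]big_split /= leq_add2r sum_nat_const card_ord.
  by rewrite -[240]/(6 * 40) leq_mul2r.
apply: leq_sum => i _; have iA : iter i (@next_dart G) p \in disc G.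
  by rewrite region_iter //; apply: disc_region.
have fi : 4 < flen (iter i (@next_dart G) p).
  suff -> : flen (iter i (@next_dart G) p) = flen p by apply: ltnW.
  by elim: (nat_of_ord i) => //= j IH; rewrite flen_next.
apply: leq_trans (net_long iA fi); rewrite addnC leq_add2l.
by case: ifP => // _; rewrite -addnA leq_addr.
Qed.

Lemma facial_walk_step (l : seq G) x : facial_walk (@edge G) turn l -> x \in l ->
  next_dart (x, next l x) = (next l x, next l (next l x)).
Proof.
move=> fl xl; rewrite next_dartE ?(facial_walk_turn fl) //.
by case: fl => _ [_ /(_ x xl)[]].
Qed.

Lemma facial_walk4_steps a b c d : facial_walk (@edge G) turn [:: a; b; c; d] ->
  [/\ next_dart (a, b) = (b, c), next_dart (b, c) = (c, d), next_dart (c, d) = (d, a) &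
      next_dart (d, a) = (a, b)].
Proof.
move=> fl; have [_ [us _]] := fl; have [n1 n2 n3 n4] := next4 us.
have S x (xl : x \in [:: a; b; c; d]) := facial_walk_step fl xl.
have := S a; have := S b; have := S c; have := S d.
by rewrite !(n1, n2, n3, n4) !inE !eqxx !orbT => -> // -> // -> // ->.
Qed.

Lemma facial_walk5_steps a b c d e : facial_walk (@edge G) turn [:: a; b; c; d; e] ->
  [/\ next_dart (a, b) = (b, c), next_dart (b, c) = (c, d), next_dart (c, d) = (d, e),
      next_dart (d, e) = (e, a) & next_dart (e, a) = (a, b)].
Proof.
move=> fl; have [_ [us _]] := fl; have [n1 n2 n3 n4 n5] := next5 us.
have S x (xl : x \in [:: a; b; c; d; e]) := facial_walk_step fl xl.
have := S a; have := S b; have := S c; have := S d; have := S e.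
by rewrite !(n1, n2, n3, n4, n5) !inE !eqxx !orbT => -> // -> // -> // -> // ->.
Qed.

Lemma face_sum4 a b c d (F : G * G -> nat) : facial_walk (@edge G) turn [:: a; b; c; d] ->
  \sum_(i < 4) F (iter i (@next_dart G) (a, b)) = F (a, b) + F (b, c) + F (c, d) + F (d, a).
Proof.
move=> /facial_walk4_steps[s1 s2 s3 _].
by rewrite !big_ord_recr big_ord0 /= add0n s1 s2 s3.
Qed.

Lemma face_sum5 a b c d e (F : G * G -> nat) :
  facial_walk (@edge G) turn [:: a; b; c; d; e] ->
  \sum_(i < 5) F (iter i (@next_dart G) (a, b)) =
  F (a, b) + F (b, c) + F (c, d) + F (d, e) + F (e, a).
Proof.
move=> /facial_walk5_steps[s1 s2 s3 s4 _].
by rewrite !big_ord_recr big_ord0 /= add0n s1 s2 s3 s4.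
Qed.

Lemma rim_corner a b c d : facial_walk (@edge G) turn [:: a; b; c; d] ->
  (a, b) \in disc G -> link (rim G) a b -> link (rim G) b c -> bs d && (d \notin rim G).
Proof.
move=> fl abA lab lbc; apply/andP; split; apply: contraT => nd.
  by case: (rim_corner_inn fl abA lab lbc nd).
by case: (rim_corner_rim fl abA lab lbc); rewrite negbK in nd.
Qed.

Lemma to_opp_le d u v w : flen (d, u) = 4 -> opp (d, u) = (v, w) -> turnback d u = w ->
  to_opp (d, u) <= 20 * [&& bs d, ~~ bs u, ~~ bs v & ~~ bs w] + 10 * spare (d, u).
Proof.
move=> f4 ov tb; rewrite (to_opp4 f4 ov tb).
by case: (bs v) => //=; case: ifP => _; rewrite ?leq_addr ?leq_addl.
Qed.

(** The face has exactly 240, so all that it sends must be received. The 20 passed on from a single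
    vertex in [big_or_rim] came from its two edges. Rim edges are paid for by the inner edges at
    their ends and, when two of them are consecutive, by the fourth vertex, which [rim_corner] puts
    in [big_or_rim]. *)
Lemma discharge_four_face p : p \in disc G -> flen p = 4 -> face_pays p.
Proof.
rewrite /face_pays; case: p => a b abA f4; have ab := region_edge (disc_region G) abA.
have [c [d fl]] := facial_walk4 ab f4; have [s1 s2 s3 s4] := facial_walk4_steps fl.
have fl1 := facial_walk_rot 1 fl; have fl2 := facial_walk_rot 2 fl.
have fl3 := facial_walk_rot 3 fl; rewrite /rot /= in fl1 fl2 fl3.
have [_ cA] := disc_region G.
have bcA : (b, c) \in disc G by rewrite -s1 cA.
have cdA : (c, d) \in disc G by rewrite -s2 cA.
have daA : (d, a) \in disc G by rewrite -s3 cA.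
have [fb fc fd] : [/\ flen (b, c) = 4, flen (c, d) = 4 & flen (d, a) = 4].
  have fb : flen (b, c) = 4 by rewrite -s1 flen_next.
  have fc : flen (c, d) = 4 by rewrite -s2 flen_next.
  by split=> //; rewrite -s3 flen_next.
have tb x y z : edge x y -> next_dart (x, y) = (y, z) -> turnback y z = x.
  by move=> xy; rewrite next_dartE // => -[<-]; rewrite turnK // edgeC.
have [e1 e2 e3 e4] := facial_walk4_edges fl.
have o1 := to_opp_le f4 (etrans (congr1 _ s1) s2) (tb _ _ _ e4 s4).
have o2 := to_opp_le fb (etrans (congr1 _ s2) s3) (tb _ _ _ e1 s1).
have o3 := to_opp_le fc (etrans (congr1 _ s3) s4) (tb _ _ _ e2 s2).
have o4 := to_opp_le fd (etrans (congr1 _ s4) s1) (tb _ _ _ e3 s3).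
have RC x y z t : facial_walk (@edge G) turn [:: x; y; z; t] -> (x, y) \in disc G ->
    link (rim G) x y && link (rim G) y z ==> bs t && (t \notin rim G).
  by move=> fl' xyA; apply/implyP => /andP[]; apply: rim_corner fl' xyA.
have R1 := RC _ _ _ _ fl abA; have R2 := RC _ _ _ _ fl1 bcA.
have R3 := RC _ _ _ _ fl2 cdA; have R4 := RC _ _ _ _ fl3 daA.
have L u w : link (rim G) u w ==> [&& bs u, bs w, u \in rim G & w \in rim G].
  apply/implyP => l; by have [-> ->] := link_rim_bs l; have [-> ->] := link_mem l.
have L1 := L a b; have L2 := L b c; have L3 := L c d; have L4 := L d a.
have nc q : flen q = 4 -> long_cubic q = false by rewrite /long_cubic => ->; rewrite andbF.
rewrite f4 (face_sum4 (@floss G) fl) (face_sum4 (fun p => 60 + fgain p) fl).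
rewrite /floss /fgain !disc_inner // !nc //= !muln0 !addn0.
move: (across _) (across _) (across _) (across _) => x1 x2 x3 x4.
move: o1 o2 o3 o4 L1 L2 L3 L4 R1 R2 R3 R4.
move: (spare _ : nat) (spare _ : nat) (spare _ : nat) (spare _ : nat) => y1 y2 y3 y4.
move: (to_opp _) (to_opp _) (to_opp _) (to_opp _) => z1 z2 z3 z4.
move: (link _ a b) (link _ b c) (link _ c d) (link _ d a) => l1 l2 l3 l4.
move: (bs a) (bs b) (bs c) (bs d) (a \in _) (b \in _) (c \in _) (d \in _).
clear => ba bb bc bd ra rb rc rd o1 o2 o3 o4 L1 L2 L3 L4 R1 R2 R3 R4.
(* [across] and [spare] never hurt the face; the remaining terms depend on finitely many
   Booleans. *)
have : 20 * (l1 + l2 + l3 + l4) + 20 * ([&& ba, ~~ bb, ~~ bc & ~~ bd] +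
    [&& bb, ~~ bc, ~~ bd & ~~ ba] + [&& bc, ~~ bd, ~~ ba & ~~ bb] +
    [&& bd, ~~ ba, ~~ bb & ~~ bc]) <=
  ~~ l1 * (10 * ba + 10 * bb) + ~~ l2 * (10 * bb + 10 * bc) +
  ~~ l3 * (10 * bc + 10 * bd) + ~~ l4 * (10 * bd + 10 * ba).
  clear -L1 L2 L3 L4 R1 R2 R3 R4; move: L1 L2 L3 L4 R1 R2 R3 R4.
  by case: l1 => /=; case: l2 => /=; case: l3 => /=; case: l4 => //=;
    case: ba => //=; case: bb => //=; case: bc => //=; case: bd => //=;
    case: ra => //=; case: rb => //=; case: rc => //=; case: rd.
clear -o1 o2 o3 o4; move: o1 o2 o3 o4.
move: (nat_of_bool (~~ l1) * _) (nat_of_bool (~~ l2) * _).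
move: (nat_of_bool (~~ l3) * _) (nat_of_bool (~~ l4) * _) => m3 m4 m1 m2.
move: [&& ba, _, _ & _] [&& bb, _, _ & _] [&& bc, _, _ & _] [&& bd, _, _ & _].
by lia.
Qed.

End FaceDischarging.

(** * Charge that reaches a 5-face across its vertices *)

Section FiveFaces.
Variable G : insecureDisc.
Implicit Types (a b c d e f g t u v w x y z : G) (k : seq G) (p : G * G).
Local Notation bs := (@big_or_rim G).

Lemma cubic_frame t v w (x := turn v w) : edge v t -> turn v t = w -> deg edge v = 3 ->
  [/\ [/\ edge v w, edge v x, t != w, t != x & w != x],
      turn v x = t, turnback v w = t, turnback v x = w & turnback v t = x].
Proof.
move=> vt tw d3; have [b [c [[vb vc tb tc bc] [t1 t2 t3] [u1 u2 u3]]]] := deg3_frame d3 vt.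
have wE : w = b by rewrite -tw.
by rewrite /x wE t2.
Qed.

(** For consecutive vertices [u], [v], [w] of a face with a 4-face across the edge [uv]: this is
    [tetra_big] at [v], with [w] as third neighbour. [quad_behind] is the mirror image, at the other
    end of the edge. *)
Lemma quad_ahead u v w : inn v -> deg edge v = 3 -> edge v u -> turn v u = w -> ~~ bs w ->
  flen (v, u) = 4 ->
  [/\ bs (turn u v), cl (turn u v) (turn v w) &
      exists z, [/\ edge w z, bs z & ~~ cl z (turn v w)]].
Proof.
move=> iv d3 vu tw nw f4; have [[vw vx uw ux wx] tx _ _ _] := cubic_frame vu tw d3.
have [d [y [fw ty oE _ _]]] := corner4 vu f4.
have [e1 e2 e3 e4] := facial_walk4_edges fw.
have yx : y = turn v w by apply: (@turn_inj _ v); rewrite ?ty ?tx // edgeC.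
subst y; have uv : edge u v by rewrite edgeC.
have dE : d = turn u v.
  have := congr1 (fun p => p.1) oE; rewrite /opp next_dartE // next_dartE ?turn_edge //.
subst d; have wu : w != u by rewrite eq_sym.
have [bd [z [wz bz zu zx]]] := tetra_big iv d3 (or_introl fw) vw wu wx nw.
have [_ _ l3 _] := link4 (cyc_uniq (facial_walk_cyc fw)).
split=> //; last by exists z.
by apply: (facial_cl (or_introl fw) _ iv l3); rewrite inE eqxx.
Qed.

Lemma quad_behind t u v : inn u -> deg edge u = 3 -> edge u t -> turn u t = v -> ~~ bs t ->
  flen (v, u) = 4 ->
  bs (turnback v u) /\ exists z, [/\ edge t z, bs z & ~~ cl z (turn u v)].
Proof.
move=> iu d3 ut tv nt f4; have [[uv ux tv' tx vx] txt _ _ _] := cubic_frame ut tv d3.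
have vu : edge v u by rewrite edgeC.
have [d [y [fw ty oE _ _]]] := corner4 vu f4.
have [e1 e2 e3 e4] := facial_walk4_edges fw.
have dE : d = turn u v.
  have := congr1 (fun p => p.1) oE; rewrite /opp next_dartE // next_dartE ?turn_edge //.
subst d; have yE : turnback v u = y by rewrite -ty turnK // edgeC.
have fk : facial edge turn [:: u; turn u v; y; v] := facial_rot 1 (or_introl fw).
have [by' [z [tz bz zx _]]] := tetra_big iu d3 fk ut tx tv' nt.
by rewrite yE; split=> //; exists z.
Qed.

Lemma only_big v t w z : edge v t -> turn v t = w -> deg edge v = 3 -> ~~ bs t -> ~~ bs w ->
  edge v z -> bs z -> z = turn v w.
Proof.
move=> vt tw d3 nt nw vz bz; have [[vw vx tw' tx wx] _ _ _ _] := cubic_frame vt tw d3.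
have := deg3_nbr d3 vt vw vx tw' tx wx vz.
by case/or3P=> /eqP // E; [rewrite -E bz in nt | rewrite -E bz in nw].
Qed.

Lemma nquad_cubic t v w : edge v t -> turn v t = w -> deg edge v = 3 -> flen (v, w) != 4 ->
  nquad v = (flen (v, t) == 4) + (flen (w, v) == 4).
Proof.
move=> vt tw d3 f; have [[vw vx tw' tx wx] _ _ _ _] := cubic_frame vt tw d3.
rewrite (nquad_deg3 d3 vt vw vx) // (negPf f) addn0; congr (_ + (_ == 4)).
by rewrite -(flen_next (w, v)) next_dartE // edgeC.
Qed.

Lemma across_cubic t v w : edge v t -> turn v t = w -> deg edge v = 3 -> ~~ bs v ->
  ~~ bs t -> ~~ bs w -> across (v, w) =
  if bs (turn v w) then (if nquad v <= 1 then 26 - 20 * nquad v else 0) else share (turn v w).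
Proof.
move=> vt tw d3 nv nt nw; have [[vw vx tw' tx wx] _ _ _ _] := cubic_frame vt tw d3.
rewrite /across /cubic /= nv d3 /= (nbig_deg3 d3 vt vw vx) // (negPf nt) (negPf nw) /=.
by case: (bs (turn v w)).
Qed.

(** A share below 5 would make [turn v w] cubic with at least two 4-faces. But two of its three
    faces are those of [(v, t)] and [(w, v)], which have another length. *)
Lemma share_outside t v w : edge v t -> turn v t = w -> deg edge v = 3 ->
  flen (v, t) != 4 -> flen (w, v) != 4 -> 0 < nbig (turn v w) -> 5 <= share (turn v w).
Proof.
move=> vt tw d3 f1 f2 b0; have [[vw vx tw' tx wx] txt _ _ _] := cubic_frame vt tw d3.
rewrite leqNgt; apply/negP => lt; have [_ dx] := share0 b0 lt.
have xv : edge (turn v w) v by rewrite edgeC.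
have [b [c [[xb xc vb vc bc] [t1 t2 t3] _]]] := deg3_frame dx xv.
rewrite (nquad_deg3 dx xv xb xc) //.
have -> : flen (turn v w, v) = flen (v, t) by rewrite -(flen_next (_, v)) next_dartE // txt.
have -> : flen (turn v w, b) = flen (w, v).
  rewrite -(flen_next (w, v)) next_dartE 1?edgeC // -(flen_next (v, turn v w)).
  by rewrite next_dartE // t1.
by rewrite (negPf f1) (negPf f2); case: (_ == 4).
Qed.

Lemma quad_ahead_cubic u v w y : inn v -> deg edge v = 3 -> deg edge w = 3 ->
  edge v u -> turn v u = w -> turn w v = y -> ~~ bs v -> ~~ bs w -> ~~ bs y ->
  flen (v, u) = 4 ->
  [/\ bs (turn u v), cl (turn u v) (turn v w), bs (turn w y)
    & ~~ cl (turn w y) (turn v w)].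
Proof.
move=> iv d3 dw vu tv tw nv nw ny f4.
have [b1 c1 [z [wz bz cz]]] := quad_ahead iv d3 vu tv nw f4.
have wv : edge w v by rewrite edgeC -tv turn_edge.
by have zE := only_big wv tw dw nv ny wz bz; rewrite -zE.
Qed.

Lemma quad_behind_cubic r t u v : inn u -> deg edge u = 3 -> deg edge t = 3 ->
  edge t r -> edge u t -> turn t r = u -> turn u t = v -> ~~ bs r -> ~~ bs t -> ~~ bs u ->
  flen (v, u) = 4 ->
  [/\ bs (turnback v u), bs (turn t u) & ~~ cl (turn t u) (turn u v)].
Proof.
move=> iu d3 dt tr ut tt tu nr nt nu f4.
have [b1 [z [tz bz cz]]] := quad_behind iu d3 ut tu nt f4.
by have zE := only_big tr tt dt nr nu tz bz; rewrite -zE.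
Qed.

(** The lemmas ahead and behind are applied at the two ends of [uv]. A further 4-face across a
    neighbouring side would join two outer neighbours which, by the same lemmas, are not joined in
    the disc. *)
Lemma quad_cubic r t u v w : inn u -> inn v -> inn w -> deg edge t = 3 -> deg edge u = 3 ->
  deg edge v = 3 -> deg edge w = 3 ->
  [/\ edge t r, edge u t, edge v u & edge w v] ->
  [/\ turn t r = u, turn u t = v, turn v u = w & turn w v = r] ->
  [/\ ~~ bs r, ~~ bs t, ~~ bs u, ~~ bs v & ~~ bs w] -> flen (v, u) = 4 ->
  [/\ bs (turn t u), bs (turn u v), bs (turn v w) & bs (turn w r)] /\
  (flen (u, t) != 4 /\ flen (w, v) != 4).
Proof.
move=> iu iv iw dt du dv dw [tr ut vu wv] [tt tu tv tw] [nr nt nu nv nw] f4.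
have [a1 a2 a3 a4] := quad_ahead_cubic iv dv dw vu tv tw nv nw nr f4.
have [b1 b2 b3] := quad_behind_cubic iu du dt tr ut tt tu nr nt nu f4.
have [_ _ _ _ xv] := cubic_frame vu tv dv; rewrite xv in b1.
split=> //; split; apply/eqP => E.
  by have [_ c _] := quad_ahead iu du ut tu nv E; rewrite c in b3.
by have [_ c _] := quad_ahead iw dw wv tw nr E; rewrite clC c in a4.
Qed.

Section Oriented.
Variables v1 v2 v3 v4 v5 : G.
Local Notation l := [:: v1; v2; v3; v4; v5].
Hypothesis fl : facial_walk (@edge G) turn l.
Hypothesis il : {in l, forall v, inn v}.
Hypothesis nl : {in l, forall v, ~~ bs v}.
Hypothesis f5 : flen (v1, v2) = 5.

Lemma oriented_facts :
  [/\ edge v1 v5, edge v2 v1, edge v3 v2, edge v4 v3 & edge v5 v4] /\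
  [/\ turn v1 v5 = v2, turn v2 v1 = v3, turn v3 v2 = v4, turn v4 v3 = v5 & turn v5 v4 = v1] /\
  [/\ flen (v2, v3) != 4, flen (v3, v4) != 4, flen (v4, v5) != 4, flen (v5, v1) != 4
    & flen (v1, v2) != 4].
Proof.
have [e1 e2 e3 e4 e5] : [/\ edge v1 v2, edge v2 v3, edge v3 v4, edge v4 v5 & edge v5 v1].
  by case/and3P: (facial_walk_cyc fl) => _ /= /and5P[? ? ? ? /andP[? _]] _.
have [_ [us _]] := fl; have [n1 n2 n3 n4 n5] := next5 us.
have T x (xl : x \in l) := facial_walk_turn fl xl.
have t1 := T v1; have t2 := T v2; have t3 := T v3; have t4 := T v4; have t5 := T v5.
rewrite n1 n2 !inE eqxx in t1; rewrite n2 n3 !inE eqxx orbT in t2.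
rewrite n3 n4 !inE eqxx !orbT in t3; rewrite n4 n5 !inE eqxx !orbT in t4.
rewrite n5 n1 !inE eqxx !orbT in t5.
have E2 : flen (v2, v3) = 5 by rewrite -f5 -(flen_next (v1, v2)) next_dartE // t1.
have E3 : flen (v3, v4) = 5 by rewrite -E2 -(flen_next (v2, v3)) next_dartE // t2.
have E4 : flen (v4, v5) = 5 by rewrite -E3 -(flen_next (v3, v4)) next_dartE // t3.
have E5 : flen (v5, v1) = 5 by rewrite -E4 -(flen_next (v4, v5)) next_dartE // t4.
split; first by split; rewrite edgeC.
by split; [split=> //; [apply: t5 | apply: t1 | apply: t2 | apply: t3 | apply: t4]
  | rewrite f5 E2 E3 E4 E5].
Qed.

Let pk : inner_pentagon v1 v2 v3 v4 v5.
Proof. by split; first by left. Qed.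

(** Five cubic vertices cost 100, and the face has 60 to spare. By [insecure_decagram], of two outer
    neighbours two steps apart one is in [big_or_rim], so at least three are. Each brings 26, or 6
    beside one 4-face, and by [quad_cubic] a 4-face forces four of them. *)
Lemma share_five_cubic : {in l, forall v, deg edge v = 3} ->
  40 <= across (v1, v2) + across (v2, v3) + across (v3, v4) + across (v4, v5) + across (v5, v1).
Proof.
move=> d3; have [[e1 e2 e3 e4 e5] [[t1 t2 t3 t4 t5] [g2 g3 g4 g5 g1]]] := oriented_facts.
have [i1 i2 i3 i4 i5] := pentagon_inn pk.
have [n1 n2 n3 n4 n5] : [/\ ~~ bs v1, ~~ bs v2, ~~ bs v3, ~~ bs v4 & ~~ bs v5].
  by split; apply: nl; rewrite !inE eqxx ?orbT.
have [d1 d2 d3' d4 d5] : [/\ deg edge v1 = 3, deg edge v2 = 3, deg edge v3 = 3,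
  deg edge v4 = 3 & deg edge v5 = 3].
  by split; apply: d3; rewrite !inE eqxx ?orbT.
rewrite (across_cubic e1 t1) // (across_cubic e2 t2) // (across_cubic e3 t3) //.
rewrite (across_cubic e4 t4) // (across_cubic e5 t5) //.
rewrite (nquad_cubic e1 t1 d1 g1) (nquad_cubic e2 t2 d2 g2) (nquad_cubic e3 t3 d3' g3).
rewrite (nquad_cubic e4 t4 d4 g4) (nquad_cubic e5 t5 d5 g5).
have Q r t u v w : inn u -> inn v -> inn w -> deg edge t = 3 -> deg edge u = 3 ->
    deg edge v = 3 -> deg edge w = 3 -> [/\ edge t r, edge u t, edge v u & edge w v] ->
    [/\ turn t r = u, turn u t = v, turn v u = w & turn w v = r] ->
    [/\ ~~ bs r, ~~ bs t, ~~ bs u, ~~ bs v & ~~ bs w] ->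
    (flen (v, u) == 4) ==> [&& bs (turn t u), bs (turn u v), bs (turn v w), bs (turn w r),
      flen (u, t) != 4 & flen (w, v) != 4].
  move=> *; apply/implyP => /eqP f4.
  by have [[-> -> -> ->] [-> ->]] : [/\ bs (turn t u), bs (turn u v), bs (turn v w)
    & bs (turn w r)] /\ (flen (u, t) != 4 /\ flen (w, v) != 4) by apply: quad_cubic.
have q12 := @Q v4 v5 v1 v2 v3; have q23 := @Q v5 v1 v2 v3 v4; have q34 := @Q v1 v2 v3 v4 v5.
have q45 := @Q v2 v3 v4 v5 v1; have q51 := @Q v3 v4 v5 v1 v2.
have {q12} q12 := q12 i1 i2 i3 d5 d1 d2 d3' (And4 e5 e1 e2 e3) (And4 t5 t1 t2 t3) (And5 n4 n5 n1 n2 n3).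
have {q23} q23 := q23 i2 i3 i4 d1 d2 d3' d4 (And4 e1 e2 e3 e4) (And4 t1 t2 t3 t4) (And5 n5 n1 n2 n3 n4).
have {q34} q34 := q34 i3 i4 i5 d2 d3' d4 d5 (And4 e2 e3 e4 e5) (And4 t2 t3 t4 t5) (And5 n1 n2 n3 n4 n5).
have {q45} q45 := q45 i4 i5 i1 d3' d4 d5 d1 (And4 e3 e4 e5 e1) (And4 t3 t4 t5 t1) (And5 n2 n3 n4 n5 n1).
have {q51} q51 := q51 i5 i1 i2 d4 d5 d1 d2 (And4 e4 e5 e1 e2) (And4 t4 t5 t1 t2) (And5 n3 n4 n5 n1 n2).
have {}Q := 0.
have D a b c d e (pk' : inner_pentagon a b c d e) : [:: a; b; c; d; e] =i l ->
    edge a e -> edge b a -> edge c b -> turn a e = b -> turn b a = c -> turn c b = d ->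
    bs (turn a b) || bs (turn c d).
  move=> E ae ba cb ta tb tc; apply: contraT; rewrite negb_or => /andP[na nc].
  have nl' : {in [:: a; b; c; d; e], forall v, ~~ bs v} by move=> v; rewrite E; apply: nl.
  have dl' : {in [:: a; b; c; d; e], forall v, deg edge v = 3} by move=> v; rewrite E; apply: d3.
  have da : deg edge a = 3 by apply: dl'; rewrite !inE eqxx.
  have db : deg edge b = 3 by apply: dl'; rewrite !inE eqxx orbT.
  have dc : deg edge c = 3 by apply: dl'; rewrite !inE eqxx !orbT.
  have [[_ a1 _ a2 a3] _ _ _ _] := cubic_frame ae ta da.
  have [[_ b1 _ b2 b3] _ _ _ _] := cubic_frame ba tb db.
  have [[_ c1 _ c2 c3] _ _ _ _] := cubic_frame cb tc dc.
  case: (@insecure_decagram G a b c d e (turn a b) (turn b c) (turn c d)) => //.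
    by split; rewrite eq_sym.
  by split; rewrite eq_sym.
have r1 := inner_pentagon_rot pk; have r2 := inner_pentagon_rot r1.
have r3 := inner_pentagon_rot r2; have r4 := inner_pentagon_rot r3.
have D1 := D _ _ _ _ _ pk (fun=> erefl) e1 e2 e3 t1 t2 t3.
have D2 := D _ _ _ _ _ r1 (mem_rot 1 l) e2 e3 e4 t2 t3 t4.
have D3 := D _ _ _ _ _ r2 (mem_rot 2 l) e3 e4 e5 t3 t4 t5.
have D4 := D _ _ _ _ _ r3 (mem_rot 3 l) e4 e5 e1 t4 t5 t1.
have D5 := D _ _ _ _ _ r4 (mem_rot 4 l) e5 e1 e2 t5 t1 t2.
clear D Q; move: q12 q23 q34 q45 q51 D1 D2 D3 D4 D5.
move: (flen (v2, v1) == 4) (flen (v3, v2) == 4) (flen (v4, v3) == 4) (flen (v5, v4) == 4).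
move: (flen (v1, v5) == 4) (share _) (share _) (share _) (share _) (share _).
move: (bs _) (bs _) (bs _) (bs _) (bs _).
clear => b1 b2 b3 b4 b5 q51 s1 s2 s3 s4 s5 q12 q23 q34 q45.
have le0 (b : bool) (X s : nat) : (if b then X else 0) <= (if b then X else s) by case: b.
move=> c12 c23 c34 c45 c51 D1 D2 D3 D4 D5.
apply: leq_trans (leq_add (leq_add (leq_add (leq_add (le0 _ _ _) (le0 _ _ _))
  (le0 _ _ _)) (le0 _ _ _)) (le0 _ _ _)).
move: c12 c23 c34 c45 c51 D1 D2 D3 D4 D5; clear.
by case: q12 => /=; case: q23 => //=; case: q34 => //=; case: q45 => //=; case: q51 => //=;
  case: b1 => //=; case: b2 => //=; case: b3 => //=; case: b4 => //=; case: b5 => //=.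
Qed.

(** Four cubic vertices cost 20 more than the face can spare. An outer neighbour in [big_or_rim]
    brings 26, or 6 together with others forced by a 4-face. If there is none, no side borders a
    4-face, and [insecure_pentagon] provides enough vertices with a neighbour in [big_or_rim]: [v5]
    counts 10, an outer neighbour 5. *)
Lemma share_four_cubic : {in [:: v1; v2; v3; v4], forall v, deg edge v = 3} ->
  3 < deg edge v5 ->
  20 <= across (v1, v2) + across (v2, v3) + across (v3, v4) + across (v4, v5) +
    10 * spare (v5, v1).
Proof.
move=> d3 d5; have [[e1 e2 e3 e4 e5] [[t1 t2 t3 t4 t5] [g2 g3 g4 g5 g1]]] := oriented_facts.
have [i1 i2 i3 i4 i5] := pentagon_inn pk.
have [n1 n2 n3 n4 n5] : [/\ ~~ bs v1, ~~ bs v2, ~~ bs v3, ~~ bs v4 & ~~ bs v5].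
  by split; apply: nl; rewrite !inE eqxx ?orbT.
have [d1 d2 d3' d4] : [/\ deg edge v1 = 3, deg edge v2 = 3, deg edge v3 = 3 & deg edge v4 = 3].
  by split; apply: d3; rewrite !inE eqxx ?orbT.
have [[_ a1 _ x1e x1n] _ _ _ bk1] := cubic_frame e1 t1 d1.
have [[_ a2 _ x2e x2n] _ _ _ bk2] := cubic_frame e2 t2 d2.
have [[_ a3 _ x3e x3n] _ _ _ bk3] := cubic_frame e3 t3 d3'.
have [[_ a4 _ x4e x4n] _ _ _ bk4] := cubic_frame e4 t4 d4.
have T1 := share_outside e1 t1 d1; have T2 := share_outside e2 t2 d2.
have T3 := share_outside e3 t3 d3'; have T4 := share_outside e4 t4 d4.
rewrite (across_cubic e1 t1) // (across_cubic e2 t2) // (across_cubic e3 t3) //.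
rewrite (across_cubic e4 t4) //.
rewrite (nquad_cubic e1 t1 d1 g1) (nquad_cubic e2 t2 d2 g2) (nquad_cubic e3 t3 d3' g3).
rewrite (nquad_cubic e4 t4 d4 g4).
have bk5 : turnback v5 v1 = v4 by rewrite -t5 turnK.
have -> : spare (v5, v1) = (0 < nbig v5) by rewrite /spare /= n5 d5 bk5 n1 n4 /= andbT.
have q12 : (flen (v2, v1) == 4) ==> [&& bs (turn v1 v2), bs (turn v2 v3), bs (turn v3 v4),
    flen (v3, v2) != 4 & flen (v1, v5) != 4].
  apply/implyP => /eqP f4.
  have [-> _ -> c1] := quad_ahead_cubic i2 d2 d3' e2 t2 t3 n2 n3 n4 f4.
  have [+ _] := quad_behind i1 d1 e1 t1 n5 f4; rewrite bk2 => -> /=.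
  apply/andP; split; apply/eqP => E.
    by have [_ c _] := quad_ahead i3 d3' e3 t3 n4 E; rewrite clC c in c1.
  have [_ _ _ c2] := quad_ahead_cubic i1 d1 d2 e1 t1 t2 n1 n2 n3 E.
  by have [_ c _] := quad_ahead i2 d2 e2 t2 n3 f4; rewrite clC c in c2.
have q23 : (flen (v3, v2) == 4) ==> [&& bs (turn v1 v2), bs (turn v2 v3), bs (turn v3 v4),
    bs (turn v4 v5), flen (v4, v3) != 4 & flen (v2, v1) != 4].
  apply/implyP => /eqP f4.
  have [-> _ -> c1] := quad_ahead_cubic i3 d3' d4 e3 t3 t4 n3 n4 n5 f4.
  have [+ -> c2] := quad_behind_cubic i2 d2 d1 e1 e2 t1 t2 n5 n1 n2 f4; rewrite bk3 => -> /=.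
  apply/andP; split; apply/eqP => E.
    by have [_ c _] := quad_ahead i4 d4 e4 t4 n5 E; rewrite clC c in c1.
  by have [_ c _] := quad_ahead i2 d2 e2 t2 n3 E; rewrite c in c2.
have q34 : (flen (v4, v3) == 4) ==> [&& bs (turn v2 v3), bs (turn v3 v4),
    bs (turn v4 v5) & flen (v5, v4) != 4].
  apply/implyP => /eqP f4.
  have [-> c1 _] := quad_ahead i4 d4 e4 t4 n5 f4.
  have [+ -> _] := quad_behind_cubic i3 d3' d2 e2 e3 t2 t3 n1 n2 n3 f4; rewrite bk4 => -> /=.
  apply/eqP => E.
  have [_ _ c2] := quad_behind_cubic i4 d4 d3' e3 e4 t3 t4 n2 n3 n4 E.
  by rewrite c1 in c2.
have q45 : (flen (v5, v4) == 4) ==> bs (turn v3 v4).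
  apply/implyP => /eqP f4.
  by have [_ -> _] := quad_behind_cubic i4 d4 d3' e3 e4 t3 t4 n2 n3 n4 f4.
have q51 : (flen (v1, v5) == 4) ==> bs (turn v2 v3).
  apply/implyP => /eqP f4.
  by have [_ _ -> _] := quad_ahead_cubic i1 d1 d2 e1 t1 t2 n1 n2 n3 f4.
have touched u : nbig u = 0 -> forall w, edge u w -> ~~ bs w.
  by move=> u0 w uw; apply/negP => bw; have := nbig_pos uw bw; rewrite u0.
have tch : ~~ [|| bs (turn v1 v2), bs (turn v2 v3), bs (turn v3 v4) | bs (turn v4 v5)] ->
    (0 < nbig v5) && (0 < nbig (turn v2 v3)) || (0 < nbig (turn v3 v4)) && (0 < nbig (turn v4 v5)).
  rewrite 3!negb_or => /and4P[m1 m2 m3 m4]; apply: contraT.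
  rewrite negb_or !negb_and -!eqn0Ngt => /andP[/orP H1 /orP H2].
  case: (@insecure_pentagon G v1 v2 v3 v4 v5 _ _ _ _ pk nl d3 (And4 a1 a2 a3 a4)).
  - by split; rewrite eq_sym.
  - by split; rewrite eq_sym.
  - by move=> x; rewrite !inE => /or4P[] /eqP->.
  - by case: H1 => /eqP /touched; auto.
  - by case: H2 => /eqP /touched; auto.
(* The pentagram read backwards. Each of the four combinations with [tch] adds up to 20. *)
have tch' : ~~ [|| bs (turn v1 v2), bs (turn v2 v3), bs (turn v3 v4) | bs (turn v4 v5)] ->
    (0 < nbig v5) && (0 < nbig (turn v3 v4)) || (0 < nbig (turn v2 v3)) && (0 < nbig (turn v1 v2)).
  rewrite 3!negb_or => /and4P[m1 m2 m3 m4]; apply: contraT.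
  rewrite negb_or !negb_and -!eqn0Ngt => /andP[/orP H1 /orP H2].
  have nl' : {in [:: v4; v3; v2; v1; v5], forall v, ~~ bs v}.
    by move=> x xl; apply: nl; move: xl; rewrite !inE => /or4P[|||/orP[]] ->; rewrite ?orbT.
  have dl' : {in [:: v4; v3; v2; v1], forall v, deg edge v = 3}.
    by move=> x xl; apply: d3; move: xl; rewrite !inE => /or4P[] ->; rewrite ?orbT.
  case: (@insecure_pentagon G v4 v3 v2 v1 v5 _ _ _ _ (inner_pentagon_rev pk) nl' dl'
    (And4 a4 a3 a2 a1)).
  - by split; rewrite eq_sym.
  - by split; rewrite eq_sym.
  - by move=> x; rewrite !inE => /or4P[] /eqP->.
  - by case: H1 => /eqP /touched; auto.
  - by case: H2 => /eqP /touched; auto.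
clear touched; move: q12 q23 q34 q45 q51 tch tch' T1 T2 T3 T4.
move: (flen (v2, v1) == 4) (flen (v3, v2) == 4) (flen (v4, v3) == 4) (flen (v5, v4) == 4).
move: (flen (v1, v5) == 4) => q51 q12 q23 q34 q45.
move: (share (turn v1 v2)) (share (turn v2 v3)) (share (turn v3 v4)) (share (turn v4 v5)).
move=> s1 s2 s3 s4.
move: (0 < nbig v5) (0 < nbig (turn v1 v2)) (0 < nbig (turn v2 v3)) (0 < nbig (turn v3 v4)).
move: (0 < nbig (turn v4 v5)) => h4 h5 h1 h2 h3.
move: (bs (turn v1 v2)) (bs (turn v2 v3)) (bs (turn v3 v4)) (bs (turn v4 v5)).
clear => b1 b2 b3 b4 c12 c23 c34 c45 c51 tch tch' T1 T2 T3 T4.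
have [nob|someb] := boolP (~~ [|| b1, b2, b3 | b4]).
  have {}tch := tch nob; have {}tch' := tch' nob.
  move: nob c12 c23 c34 c45 c51; rewrite !negb_or => /and4P[/negPf -> /negPf -> /negPf -> /negPf ->].
  rewrite /= ?andbF !implybF => q12' q23' q34' q45' q51'.
  have low (h : bool) (s : nat) : (h -> 4 < s) -> 5 * h <= s by case: h => // /(_ isT).
  have {}T1 := low _ _ (T1 q51' q12'); have {}T2 := low _ _ (T2 q12' q23').
  have {}T3 := low _ _ (T3 q23' q34'); have {}T4 := low _ _ (T4 q34' q45').
  move: tch tch' T1 T2 T3 T4; clear.
  by case: h5; case: h1; case: h2; case: h3; case: h4 => //= _ _; lia.
have le0 (b : bool) (X s : nat) : (if b then X else 0) <= (if b then X else s) by case: b.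
apply: leq_trans (leq_addr _ _).
apply: leq_trans (leq_add (leq_add (leq_add (le0 _ _ _) (le0 _ _ _)) (le0 _ _ _)) (le0 _ _ _)).
move: c12 c23 c34 c45 c51 someb; clear.
by case: q12 => /=; case: q23 => //=; case: q34 => //=; case: q45 => //=; case: q51 => //=;
  case: b1 => //=; case: b2 => //=; case: b3 => //=; case: b4 => //=.
Qed.

End Oriented.
End FiveFaces.

(** * Final charge of faces of length 5 *)

Section PentagonalFaces.
Variable G : insecureDisc.
Implicit Types (a b c d e f g t u v w x y z : G) (k : seq G) (p : G * G).
Local Notation bs := (@big_or_rim G).

(** By [net_long] the darts bring 5 * 40, so 40 is missing. If some but not all vertices are in
    [big_or_rim], a dart entering a run of them adds 10 and one leaving it adds 30. If all are, some
    edge is off the rim by [all_rim_face] and adds 40. If none is, the number of cubic vertices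
    decides. *)
Lemma discharge_five_face p : p \in disc G -> flen p = 5 -> face_pays p.
Proof.
rewrite /face_pays; case: p => a b abA f5; have ab := region_edge (disc_region G) abA.
have [c [d [e fl]]] := facial_walk5 ab f5; have [_ [us _]] := fl.
have [n1 n2 n3 n4 n5] := next5 us; have [s1 s2 s3 s4 _] := facial_walk5_steps fl.
have fl1 := facial_walk_rot 1 fl; have fl2 := facial_walk_rot 2 fl.
have fl3 := facial_walk_rot 3 fl; have fl4 := facial_walk_rot 4 fl.
rewrite /rot /= in fl1 fl2 fl3 fl4.
have W := facial_walk_sub_disc fl (mem_head _ _); rewrite n1 in W; have {}W := W abA.
have [_ cA] := disc_region G.
have bcA : (b, c) \in disc G by rewrite -s1 cA.
have cdA : (c, d) \in disc G by rewrite -s2 cA.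
have deA : (d, e) \in disc G by rewrite -s3 cA.
have eaA : (e, a) \in disc G by rewrite -s4 cA.
have fb : flen (b, c) = 5 by rewrite -s1 flen_next.
have fc : flen (c, d) = 5 by rewrite -s2 flen_next.
have fd : flen (d, e) = 5 by rewrite -s3 flen_next.
have fe : flen (e, a) = 5 by rewrite -s4 flen_next.
rewrite f5 (face_sum5 (@floss G) fl) (face_sum5 (fun p => 60 + fgain p) fl).
have L u w : link (rim G) u w ==> bs u && bs w.
  by apply/implyP => /link_rim_bs[-> ->].
have [someb|nob] := boolP [|| bs a, bs b, bs c, bs d | bs e].
  have long (q : G * G) : flen q = 5 -> 4 < flen q by move=> ->.
  have m1 := net_long abA (long _ f5); have m2 := net_long bcA (long _ fb).
  have m3 := net_long cdA (long _ fc); have m4 := net_long deA (long _ fd).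
  have m5 := net_long eaA (long _ fe).
  have nall : ~~ [&& link (rim G) a b, link (rim G) b c, link (rim G) c d, link (rim G) d e
      & link (rim G) e a].
    apply/negP => /and5P[k1 k2 k3 k4 k5]; apply: (all_rim_face fl W) => u w.
    have one x y : x \in [:: a; b; c; d; e] -> next [:: a; b; c; d; e] x = y -> link (rim G) x y.
      by rewrite !inE => /or4P[|||/orP[]] /eqP -> <-; rewrite ?(n1, n2, n3, n4, n5).
    by case/orP=> /andP[ul /eqP E]; [| rewrite linkC]; apply: one.
  have L1 := L a b; have L2 := L b c; have L3 := L c d; have L4 := L d e; have L5 := L e a.
  move: m1 m2 m3 m4 m5; rewrite /=.
  move: (floss _) (floss _) (floss _) (floss _) (floss _) => x1 x2 x3 x4 x5.
  move: (60 + _) (60 + _) (60 + _) (60 + _) (60 + _) => y1 y2 y3 y4 y5 m1 m2 m3 m4 m5.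
  have : 240 <= (if link (rim G) a b then 40 else 40 + 30 * bs a + 10 * bs b) +
     (if link (rim G) b c then 40 else 40 + 30 * bs b + 10 * bs c) +
     (if link (rim G) c d then 40 else 40 + 30 * bs c + 10 * bs d) +
     (if link (rim G) d e then 40 else 40 + 30 * bs d + 10 * bs e) +
     (if link (rim G) e a then 40 else 40 + 30 * bs e + 10 * bs a).
    move: someb nall L1 L2 L3 L4 L5; clear.
    move: (link _ a b) (link _ b c) (link _ c d) (link _ d e) (link _ e a) => l1 l2 l3 l4 l5.
    move: (bs a) (bs b) (bs c) (bs d) (bs e) => b1 b2 b3 b4 b5.
    by case: b1; case: b2; case: b3; case: b4; case: b5 => //=; case: l1 => //=;
      case: l2 => //=; case: l3 => //=; case: l4 => //=; case: l5.
  move: m1 m2 m3 m4 m5.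
  move: (if _ then _ else _) (if _ then _ else _) (if _ then _ else _) (if _ then _ else _).
  by move: (if _ then _ else _); clear; lia.
move: nob; rewrite 4!negb_or => /and5P[na nb nc nd ne].
have ni u w : (u, w) \in disc G -> ~~ bs u -> inn u.
  move=> uw nu; apply: (cl_inn (u := w)); last exact: nbs_nrim.
  by rewrite /cl uw orbT.
have [ia ib ic id ie] : [/\ inn a, inn b, inn c, inn d & inn e].
  by split; [apply: ni abA na|apply: ni bcA nb|apply: ni cdA nc|apply: ni deA nd|apply: ni eaA ne].
have il : {in [:: a; b; c; d; e], forall v, inn v}.
  by move=> v; rewrite !inE => /or4P[|||/orP[]] /eqP->.
have nl : {in [:: a; b; c; d; e], forall v, ~~ bs v}.
  by move=> v; rewrite !inE => /or4P[|||/orP[]] /eqP->.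
have nlink u w : ~~ bs u -> link (rim G) u w = false.
  by move=> nu; apply/negP => /link_rim_bs[bu _]; rewrite bu in nu.
have val (q : G * G) : ~~ bs q.1 -> flen q = 5 ->
    floss q = 20 * (deg edge q.1 == 3) /\ across q + 10 * spare q <= fgain q.
  move=> nq fq; rewrite /floss /fgain /to_opp fq nlink // /long_cubic /cubic nq fq /= andbT.
  by rewrite muln0 add0n addn0 -addnA leq_addl.
have [-> g1] := val (a, b) na f5; have [-> g2] := val (b, c) nb fb.
have [-> g3] := val (c, d) nc fc; have [-> g4] := val (d, e) nd fd.
have [-> g5] := val (e, a) ne fe; rewrite /=.
have rotm i : rot i [:: a; b; c; d; e] =i [:: a; b; c; d; e] := mem_rot i _.
have four v1 v2 v3 v4 v5 : facial_walk (@edge G) turn [:: v1; v2; v3; v4; v5] ->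
    [:: v1; v2; v3; v4; v5] =i [:: a; b; c; d; e] -> flen (v1, v2) = 5 ->
    [&& deg edge v1 == 3, deg edge v2 == 3, deg edge v3 == 3, deg edge v4 == 3 & deg edge v5 != 3] ->
    20 <= across (v1, v2) + across (v2, v3) + across (v3, v4) + across (v4, v5) +
      10 * spare (v5, v1).
  move=> fl' E f' /and5P[/eqP d1 /eqP d2 /eqP d3 /eqP d4 d5].
  apply: share_four_cubic => //.
  - by move=> v; rewrite E; apply: il.
  - by move=> v; rewrite E; apply: nl.
  - by move=> v; rewrite !inE => /or4P[] /eqP->.
  - by rewrite ltn_neqAle eq_sym d5 (@deg_gt2 G).
have h5 := four a b c d e fl (fun=> erefl) f5.
have h1 := four b c d e a fl1 (rotm 1) fb.
have h2 := four c d e a b fl2 (rotm 2) fc.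
have h3 := four d e a b c fl3 (rotm 3) fd.
have h4 := four e a b c d fl4 (rotm 4) fe.
have h : [&& deg edge a == 3, deg edge b == 3, deg edge c == 3, deg edge d == 3 & deg edge e == 3] ->
    40 <= across (a, b) + across (b, c) + across (c, d) + across (d, e) + across (e, a).
  move=> /and5P[/eqP d1 /eqP d2 /eqP d3 /eqP d4 /eqP d5]; apply: share_five_cubic => //.
  by move=> v; rewrite !inE => /or4P[|||/orP[]] /eqP->.
clear four; move: g1 g2 g3 g4 g5 h h1 h2 h3 h4 h5.
move: (fgain (a, b)) (fgain (b, c)) (fgain (c, d)) (fgain (d, e)) (fgain (e, a)).
move: (across (a, b)) (across (b, c)) (across (c, d)) (across (d, e)) (across (e, a)).
move: (spare (a, b) : nat) (spare (b, c) : nat) (spare (c, d) : nat) (spare (d, e) : nat).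
move: (spare (e, a) : nat).
move: (deg edge a == 3) (deg edge b == 3) (deg edge c == 3) (deg edge d == 3) (deg edge e == 3).
clear => d1 d2 d3 d4 d5 p5 p1 p2 p3 p4 a1 a2 a3 a4 a5 x1 x2 x3 x4 x5 g1 g2 g3 g4 g5.
case: d1; case: d2; case: d3; case: d4; case: d5 => /= h h1 h2 h3 h4 h5; try by lia.
all: try by have := h isT; lia.
all: try by have := h1 isT; lia.
all: try by have := h2 isT; lia.
all: try by have := h3 isT; lia.
all: try by have := h4 isT; lia.
all: try by have := h5 isT; lia.
Qed.

End PentagonalFaces.

(** * The total charge *)

Section Total.
Variable G : insecureDisc.
Implicit Types (u v w : G) (p : G * G).
Local Notation bs := (@big_or_rim G).
Local Notation I := (inner (disc G)).

Lemma sum_inner_flip (F : G * G -> nat) : \sum_(p in I) F (flip p) = \sum_(p in I) F p.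
Proof.
rewrite [RHS](reindex_inj (inv_inj (@flipK G))) /=.
by apply: eq_bigl => p; rewrite inner_flip.
Qed.

Lemma disc_outer_bs p : p \in disc G -> p \notin I -> bs p.1.
Proof. by move=> pA; rewrite disc_inner // negbK => /link_rim_bs[]. Qed.

Lemma sum_disc_inner (F : G * G -> nat) : (forall p, bs p.1 -> F p = 0) ->
  \sum_(p in disc G) F p = \sum_(p in I) F p.
Proof.
move=> F0; rewrite (big_setID I) /= [X in _ + X]big1; last first.
  by move=> p; rewrite inE => /andP[pI pA]; apply/F0/disc_outer_bs.
rewrite addn0; apply: eq_bigl => p; rewrite inE andbC; case: (boolP (p \in I)) => //.
by rewrite inE => /andP[->].
Qed.

Lemma sum_disc_link : \sum_(p in disc G) link (rim G) p.1 p.2 = size (rim G).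
Proof.
have gA := disc_good G.
have := card_bounds (good_cyc gA) (good_sub gA) (good_bounds gA).
rewrite -sum1_card (big_setID I) /= sum1_card.
have -> : disc G :&: I = I.
  by apply/setIidPr/subsetP => p; rewrite inE => /andP[].
move/addnI => <-; rewrite [LHS](big_setID I) /= big1 ?add0n => [|p].
  by apply: eq_bigr => p; rewrite inE => /andP[pI pA]; move: pI; rewrite disc_inner // negbK => ->.
by rewrite inE => /andP[pA]; rewrite disc_inner // => /negPf ->.
Qed.

(** [opp] permutes the darts of the disc, and a vertex in [big_or_rim] receives nothing through
    [to_opp]; hence only inner darts remain. *)
Lemma sum_to_opp : \sum_(p in disc G) to_opp p = \sum_(p in I) to_opp (opp p).
Proof.
have [_ cA] := disc_region G; have nI := @next_dart_inj G.
rewrite (reindex_inj (inj_comp nI nI)) /= (eq_bigl (mem (disc G))); last first.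
  by move=> p; rewrite /= !cA.
apply: sum_disc_inner => p bp; rewrite /to_opp.
change (next_dart (next_dart p)) with (opp p).
rewrite flen_opp; case: eqP => //= f4.
by have := iter_flen p; rewrite f4 /= /opp => ->; rewrite bp.
Qed.

(** All that is sent is received, except for the 20 that a face loses at each rim edge. *)
Lemma discharge_balance : \sum_(p in I) vgain p + \sum_(p in disc G) fgain p + 20 * size (rim G) =
  \sum_(p in I) vloss p + \sum_(p in disc G) floss p.
Proof.
have gE : \sum_(p in I) vgain p = 36 * \sum_(p in I) (~~ bs p.1 && bs p.2) +
    \sum_(p in I) (~~ bs p.1 && ~~ bs p.2) * share p.2 + 20 * \sum_(p in I) long_cubic p +
    \sum_(p in I) to_opp (opp p).
  by rewrite /vgain; move: 20 36 => m n; rewrite !big_split /= !big_distrr.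
have lE : \sum_(p in I) vloss p = 20 * \sum_(p in I) bs p.1 +
    36 * \sum_(p in I) (bs p.1 && ~~ bs p.2) +
    \sum_(p in I) (~~ bs p.1 && ~~ bs p.2) * share p.1 + \sum_(p in I) across p +
    10 * \sum_(p in I) spare p.
  by rewrite /vloss; move: 10 20 36 => m n k; rewrite !big_split /= !big_distrr.
have fgE : \sum_(p in disc G) fgain p =
    \sum_(p in disc G) (p \in I) * (10 * bs p.1 + 10 * bs p.2) +
    \sum_(p in disc G) across p + 10 * \sum_(p in disc G) spare p.
  by rewrite /fgain; move: 10 => k; rewrite !big_split /= !big_distrr.
have flE : \sum_(p in disc G) floss p =
    20 * \sum_(p in disc G) link (rim G) p.1 p.2 + 20 * \sum_(p in disc G) long_cubic p +
    \sum_(p in disc G) to_opp p.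
  by rewrite /floss; move: 20 => k; rewrite !big_split /= !big_distrr.
rewrite {}gE {}lE {}fgE {}flE sum_disc_link.
rewrite sum_to_opp (@sum_disc_inner (@across G)); last first.
  by move=> p bp; rewrite /across /cubic bp.
rewrite (@sum_disc_inner (fun p => spare p)); last by move=> p bp; rewrite /spare bp.
rewrite (@sum_disc_inner (fun p => long_cubic p)); last first.
  by move=> p bp; rewrite /long_cubic /cubic bp.
have -> : \sum_(p in I) ~~ bs p.1 && bs p.2 = \sum_(p in I) bs p.1 && ~~ bs p.2.
  by rewrite -sum_inner_flip; apply: eq_bigr => p _; rewrite /= andbC.
have -> : \sum_(p in I) (~~ bs p.1 && ~~ bs p.2) * share p.2 =
    \sum_(p in I) (~~ bs p.1 && ~~ bs p.2) * share p.1.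
  by rewrite -sum_inner_flip; apply: eq_bigr => p _; rewrite /= andbC.
have -> : \sum_(p in disc G) (p \in I) * (10 * bs p.1 + 10 * bs p.2) =
    20 * \sum_(p in I) bs p.1.
  rewrite (big_setID I) /= [X in _ + X]big1; last first.
    by move=> p; rewrite inE => /andP[/negPf ->].
  have -> : disc G :&: I = I by apply/setIidPr/subsetP => p; rewrite inE => /andP[].
  rewrite addn0 (eq_bigr (fun p => 10 * bs p.1 + 10 * bs p.2)); last first.
    by move=> p ->; rewrite mul1n.
  transitivity (10 * \sum_(p in I) bs p.1 + 10 * \sum_(p in I) bs p.2).
    by move: 10 => k; rewrite big_split /= !big_distrr.
  by rewrite -(sum_inner_flip (fun p => bs p.2)) /= -mulnDl.
clear; do ![move: (\sum_(p in _) _) => ?]; lia.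
Qed.

Lemma discharge_vertex v : inn v -> vertex_pays v.
Proof.
move=> iv; have [bv|nv] := boolP (bs v); first exact: discharge_big.
have [d4|] := ltnP 3 (deg edge v); first exact: discharge_deg4.
move=> d3; apply: discharge_cubic => //; apply/eqP; rewrite eqn_leq d3.
exact: (@deg_gt2 G).
Qed.

Lemma discharge_face p : p \in disc G -> face_pays p.
Proof.
move=> pA; have := flen_gt3 (region_dart (disc_region G) pA).
rewrite leq_eqVlt => /orP[/eqP f4|]; first exact: discharge_four_face.
rewrite leq_eqVlt => /orP[/eqP f5|]; first exact: discharge_five_face.
exact: discharge_long_face.
Qed.

Lemma sum_inner_split (F : G * G -> nat) : \sum_(p in I) F p =
  \sum_(v in interior (disc G) (rim G)) \sum_(w | edge v w) F (v, w) +
  \sum_(p in I | p.1 \in rim G) F p.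
Proof.
rewrite pair_big_dep /= [LHS](bigID (fun p => p.1 \in rim G)) /= addnC; congr (_ + _).
apply: eq_big => [[v w]|[v w] _] //=; apply/andP/andP => [[vI nv]|[iv vw]].
  move: vI; rewrite inE => /andP[vA _]; split; last exact: region_edge (disc_region G) vA.
  by apply: interior_mem (disc_region G) nv _; left; apply: vA.
have [vA wA] := inn_dart iv vw; split; first by rewrite inE vA.
exact: inn_nrim.
Qed.

(** Otherwise the interior would be closed under adjacency and never reach the rim, against
    connectivity. *)
Lemma rim_inner_dart : exists2 p, p \in I & p.1 \in rim G.
Proof.
apply: NNPP => H; have gA := disc_good G.
have [v iv] : exists v, inn v by apply/set0Pn/good_int/disc_good.
have [r rr] := cyc_mem (good_cyc gA).
have step u w : inn u -> edge u w -> inn w.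
  move=> iu uw; have [uA wA] := inn_dart iu uw.
  apply: interior_mem (disc_region G) _ (or_introl wA); apply/negP => wr.
  by apply: H; exists (w, u); rewrite // inE wA.
have [w vw] := has_nbr v; have [vA _] := inn_dart iv vw.
have rv : connect edge root v.
  by have := region_dart (disc_region G) vA; rewrite inE => /andP[].
have : connect edge v r.
  rewrite (sym_connect_sym (@edgeC G)) in rv.
  by apply: connect_trans rv _; have := good_sub gA rr; rewrite inE.
case/connectP => q; elim: q v iv {w vw vA rv} => [|w q IH] v iv /=.
  by move=> _ E; have := inn_nrim iv; rewrite -E rr.
by case/andP => /(step _ _ iv) iw /(IH _ iw); apply.
Qed.

(** By [euler_disc], with a rim of length s, the supply exceeds the demand by at most 60s - 240, and
    the rim edges absorb 20s of it. As 40s is at most 240, nothing is left, while one inner dart at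
    the rim leaves 4. *)
Lemma disc_contradiction : False.
Proof.
have gA := disc_good G; have [p0 p0I p0r] := rim_inner_dart.
have cA := card_bounds (good_cyc gA) (good_sub gA) (good_bounds gA).
have eu := euler_disc (good_cyc gA) (good_sub gA) (good_bounds gA).
have cst n (S : {set G * G}) (F : G * G -> nat) :
    \sum_(p in S) (n + F p) = n * #|S| + \sum_(p in S) F p.
  by rewrite big_split /= sum_nat_const mulnC.
have sz := good_size gA; have bal := discharge_balance.
(* The 4 is kept at [p0]: a rim vertex has no demand and sends at most 56 of the 60 units of an
   inner dart. *)
have V : 240 * #|interior (disc G) (rim G)| + \sum_(p in I) vloss p + 4 <=
    60 * #|I| + \sum_(p in I) vgain p.
  rewrite -cst !sum_inner_split addnA -addnA; apply: leq_add.
    rewrite mulnC -sum_nat_const -big_split /=; apply: leq_sum => v; exact: discharge_vertex.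
  have pc : p0 \in [pred p in I | p.1 \in rim G] by rewrite inE p0I.
  rewrite (bigD1 p0 pc) [X in _ <= X](bigD1 p0 pc) /= addnAC; apply: leq_add.
    have := @vloss_bs _ p0; rewrite /big_or_rim p0r orbT => /(_ isT).
    by move: (vloss _) (vgain _); clear; lia.
  apply: leq_sum => p /andP[/andP[_ pr] _].
  have := @vloss_bs _ p; rewrite /big_or_rim pr orbT => /(_ isT).
  by move: (vloss _) (vgain _); clear; lia.
have F : 240 * nfaces (disc G) + \sum_(p in disc G) floss p <=
    60 * #|disc G| + \sum_(p in disc G) fgain p.
  rewrite -cst !(big_region _ _ (disc_region G)) /nfaces mulnC -sum_nat_const -big_split /=.
  by apply: leq_sum => p; rewrite inE => /andP[pA _]; apply: discharge_face.
have sums D J s n f g l g' l' : D = J + s -> J + 2 <= 2 * n + 2 * f -> s <= 6 ->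
    g + g' + 20 * s = l + l' -> 240 * n + l + 4 <= 60 * J + g -> 240 * f + l' <= 60 * D + g' ->
    False by clear; lia.
exact: sums cA eu sz bal V F.
Qed.

End Total.

Theorem theorem4p4 (V : finType) (adj : rel V) (rot : V -> V -> V) :
  symmetric adj -> irreflexive adj ->
  plane_embedding adj rot ->
  0 < #|V| ->
  triangle_free adj ->
  has_secure_multigram adj rot.
Proof.
move=> sym irr emb /card_gt0P[r _] tf; apply: NNPP => H.
have d3 v : 2 < deg adj v.
  by rewrite ltnNge; apply/negP => d2; apply: H; constructor 1; exists v.
have [A [s mA]] := @exists_minimal_disc (PlaneMap sym irr emb tf d3 r).
exact: (disc_contradiction (InsecureDisc mA H)).
Qed.
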